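(* Let $t_f\in(0,\infty)$. Consider the system, parametrized by $k\in\mathbb{N}_0$, $$\dot x(t)=f_0(t,x(t))+\sum_{i=1}^{l}w_k^{p_i}f_i(t,x(t))\,u_i(w_kt),\qquad \dot w(t)=\|x(t)\|^2,$$ for $t\in[t_0+kt_f,\,t_0+(k+1)t_f)$, with $p_i=\tfrac12$ for all $i\in\{1,\dots,l\}$, where $w_k=w(t_0+kt_f;t_0,w_0)$ is the solution of the $w$-equation with initial time $t_0$ and initial condition $w_0$, sampled at the constant rate $t_f$. Suppose Assumptions A1, A2 and A3 of the context hold. Suppose that the origin is globally uniformly exponentially stable for the Lie-bracket system associated with the $x$-equation (see context; it is the same for all $k$), i.e. there exist $\bar\alpha\in[1,\infty)$ and $\bar\beta\in(0,\infty)$ such that for all $t_0\in\mathbb{R}$ and all $x_0\in\mathbb{R}^n$ its solution $\bar x$ with $\bar x(t_0)=x_0$ satisfies $$\|\bar x(t)\|\le\bar\alpha\,\|x_0\|\,e^{-\bar\beta(t-t_0)}\quad\text{for all }t\in[t_0,\infty).$$ Suppose further that $t_f$ is sufficiently large that there exists $D\in(0,\infty)$ with $\bar\alpha e^{-\bar\beta t_f}+D\in(0,1)$. Then, for any $x_0\in\mathbb{R}^n$ and any $w_0\in(0,\infty)$, $\lim_{t\to\infty}\|x(t;t_0,x_0)\|=0$, and $w(t;t_0,w_0)$ is bounded and converges to a finite limit.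
   Context: Here $x(t)\in\mathbb{R}^n$, $w(t)\in\mathbb{R}$, $\|\cdot\|$ is the norm on $\mathbb{R}^n$, $l\ge1$ is an integer, $f_i:\mathbb{R}\times\mathbb{R}^n\to\mathbb{R}^n$ for $i=0,\dots,l$, and $u_i:\mathbb{R}\to\mathbb{R}$ for $i=1,\dots,l$. $\partial_1$ denotes the partial derivative with respect to $t$; $\mathcal L_{f_j}f_i(t,x)=\frac{\partial f_i}{\partial x}(t,x)\,f_j(t,x)$; $[f_i,f_j]=\mathcal L_{f_i}f_j-\mathcal L_{f_j}f_i$. The Lie-bracket system associated with $\dot x=f_0(t,x)+\sum_{i=1}^l\omega^{p_i}f_i(t,x)u_i(\omega t)$ is $$\dot{\bar x}(t)=f_0(t,\bar x(t))+\lim_{\omega\to\infty}\sum_{1\le i<j\le l}[f_i,f_j](t,\bar x(t))\,\gamma_{ij}(\omega),$$ with $T=2\pi\omega^{-1}$ and $\gamma_{ij}(\omega)=\frac{\omega^{p_i+p_j}}{T}\int_0^T\int_0^\theta u_j(\omega\theta)\,u_i(\omega\tau)\,d\tau\,d\theta$. Assumption A1: for all $i\in\{1,\dots,l\}$, $u_i$ is measurable with $\sup_{t\in\mathbb{R}}|u_i(t)|\le1$; $u_i(t+2\pi)=u_i(t)$ for all $t$; and $\int_0^{2\pi}u_i(t)\,dt=0$. Assumption A2: there is $L\in(0,\infty)$ such that for all $i,j,m\in\{0,1,\dots,l\}$ the functions $f_i$, $\partial_1f_i$, $\mathcal L_{f_j}f_i$, $\partial_1\mathcal L_{f_j}f_i$,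 $\mathcal L_{f_m}\mathcal L_{f_j}f_i$ are continuous in the first argument, globally uniformly $L$-Lipschitz in the second argument, and defined for all $t\in\mathbb{R}$ and almost every $x\in\mathbb{R}^n$; additionally each of these functions vanishes at $(t,0)$ for all $t$. Assumption A3: for all $i,j\in\{1,\dots,l\}$, if $p_i+p_j>1$ then either $\int_0^T\int_0^\theta u_j(\omega\theta)u_i(\omega\tau)\,d\tau\,d\theta=0$, or $[f_i,f_j](t,x)=0$ for all $x\in\mathbb{R}^n$, $t\in\mathbb{R}$ (void here since $p_i=\tfrac12$). *)

(* Defs.v *)
(* MathComp-Analysis, over an arbitrary R : realType. *)
From HB Require Import structures.
From mathcomp Require Import all_boot all_order all_algebra.
From mathcomp Require Import all_classical all_reals all_analysis.

Set Implicit Arguments.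
Unset Strict Implicit.
Unset Printing Implicit Defensive.
Import Order.TTheory GRing.Theory Num.Theory.
Import numFieldNormedType.Exports.
Local Open Scope classical_set_scope.
Local Open Scope ring_scope.

(* The library norm on row vectors is the max norm; it induces the topology
   used for continuity and differentiability below, while all quantitative
   statements use the Euclidean norm. *)
Definition enorm (R : realType) (n : nat) (x : 'rV[R]_n) : R :=
  Num.sqrt (\sum_(i < n) x 0 i ^+ 2).

(* Lebesgue-null subsets of R^n: coverable by countably many boxes of
   arbitrarily small total volume. *)
Definition lebesgue_null (R : realType) (n : nat) (A : set 'rV[R]_n) : Prop :=
  forall e : R, 0 < e -> exists a b : nat -> 'rV[R]_n,
    [/\ (forall k i, a k 0 i <= b k 0 i),
        A `<=` \bigcup_k [set x | forall i, a k 0 i <= x 0 i <= b k 0 i]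
      & (\sum_(0 <= k <oo) (\prod_(i < n) (b k 0 i - a k 0 i))%:E <= e%:E)%E].

Definition almost_every (R : realType) (n : nat) (P : set 'rV[R]_n) : Prop :=
  lebesgue_null [set x | ~ P x].

(* Measurability with respect to the Lebesgue (completed Borel) sigma-algebra,
   the one on which completed_lebesgue_measure is defined. *)
Definition lebesgue_measurable (R : realType) (v : R -> R) : Prop :=
  measurable_fun setT (v : caratheodory_type (@wlength R idfun)^*%mu -> R).

(* y is locally absolutely continuous on I with y' = v almost everywhere *)
Definition is_primitive (R : realType) (I : set R) (v y : R -> R) : Prop :=
  forall a b : R, I a -> I b -> a <= b ->
    (@completed_lebesgue_measure R).-integrable `[a, b] (fun s => (v s)%:E) /\
    y b = y a + \int[@completed_lebesgue_measure R]_(s in `[a, b]) v s.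

(* Caratheodory solutions on I of dx/dt = F (t, x); the inputs being merely
   measurable, there are no classical solutions in general. *)
Definition is_solution (R : realType) (n : nat) (F : R -> 'rV[R]_n -> 'rV[R]_n)
    (I : set R) (x : R -> 'rV[R]_n) : Prop :=
  forall c : 'I_n,
    is_primitive I (fun t => F t (x t) 0 c) (fun t => x t 0 c).

(* A time-varying field that is only defined for all t and almost every x, but
   is Lipschitz in x uniformly in t, extends uniquely by continuity to all x.
   Such fields are represented below by this total extension: g1, resp. Lhg,
   is the extension of the field obtained from g by differentiation. *)
Definition is_partial1 (R : realType) (n : nat)
    (g g1 : R -> 'rV[R]_n -> 'rV[R]_n) : Prop :=
  almost_every [set x | forall t : R,
    is_derive t (1 : R) (fun s : R => g s x) (g1 t x)].

(* Lhg t x = L_h g (t, x) = (dg/dx)(t, x) h(t, x) *)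
Definition is_lie_derivative (R : realType) (n : nat)
    (h g Lhg : R -> 'rV[R]_n -> 'rV[R]_n) : Prop :=
  almost_every [set x | forall t : R,
    differentiable (g t) x /\ Lhg t x = 'd (g t) x (h t x)].

Definition regular_field (R : realType) (n : nat) (L : R)
    (g : R -> 'rV[R]_n -> 'rV[R]_n) : Prop :=
  [/\ (forall x, continuous (fun t : R => g t x)),
      (forall t x y, enorm (g t x - g t y) <= L * enorm (x - y))
    & (forall t, g t 0 = 0)].

(* The control fields f_1, ..., f_l are f (lift ord0 i) for i : 'I_l, and
   f ord0 is the drift f_0. *)
Section Averaging.
Variables (R : realType) (n l : nat).
Notation field := (R -> 'rV[R]_n -> 'rV[R]_n).
Variables (p : 'I_l -> R) (u : 'I_l -> R -> R) (f : 'I_l.+1 -> field).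
(* Lf j i stands for L_{f_j} f_i. *)
Variable Lf : 'I_l.+1 -> 'I_l.+1 -> field.

Definition A1 : Prop :=
  forall i, [/\ lebesgue_measurable (u i),
    (forall t, `|u i t| <= 1),
    (forall t, u i (t + 2 * pi) = u i t)
  & \int[@completed_lebesgue_measure R]_(t in `[0, 2 * pi]) u i t = 0].

Definition A2 : Prop :=
  exists (L : R) (df : 'I_l.+1 -> field) (dLf : 'I_l.+1 -> 'I_l.+1 -> field)
         (LLf : 'I_l.+1 -> 'I_l.+1 -> 'I_l.+1 -> field),
    0 < L /\
    forall i j m : 'I_l.+1,
      [/\ is_partial1 (f i) (df i),
          is_lie_derivative (f j) (f i) (Lf j i),
          is_partial1 (Lf j i) (dLf j i)
        & is_lie_derivative (f m) (Lf j i) (LLf m j i)] /\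
      [/\ regular_field L (f i), regular_field L (df i),
          regular_field L (Lf j i), regular_field L (dLf j i)
        & regular_field L (LLf m j i)].

Definition bracket (i j : 'I_l) : field := fun t x =>
  Lf (lift ord0 i) (lift ord0 j) t x - Lf (lift ord0 j) (lift ord0 i) t x.

Definition double_integral (i j : 'I_l) (omega : R) : R :=
  \int[@completed_lebesgue_measure R]_(theta in `[0, 2 * pi / omega])
    \int[@completed_lebesgue_measure R]_(tau in `[0, theta])
      (u j (omega * theta) * u i (omega * tau)).

Definition A3 : Prop :=
  forall i j : 'I_l, 1 < p i + p j ->
    (forall omega : R, 0 < omega -> double_integral i j omega = 0) \/
    (forall t x, bracket i j t x = 0).

Definition gamma_ij (i j : 'I_l) (omega : R) : R :=
  omega `^ (p i + p j) / (2 * pi / omega) * double_integral i j omega.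

Definition bracket_system : field := fun t x =>
  f ord0 t x +
  lim ((\sum_(i < l) \sum_(j < l | (i < j)%N)
          gamma_ij i j omega *: bracket i j t x) @[omega --> +oo]).

Definition oscillating_system (omega : R) : field := fun t x =>
  f ord0 t x +
  \sum_(i < l) (omega `^ p i * u i (omega * t)) *: f (lift ord0 i) t x.

(* Trajectories of the system in which w, sampled at the times t0 + k tf,
   is the frequency on the k-th sampling interval. Taking these intervals
   closed encodes the continuity of (x, w) at the sampling times. *)
Definition sampled_trajectory (t0 tf : R) (x0 : 'rV[R]_n) (w0 : R)
    (x : R -> 'rV[R]_n) (w : R -> R) : Prop :=
  [/\ x t0 = x0, w t0 = w0 &
    forall k : nat,
      let Ik := `[t0 + k%:R * tf, t0 + k.+1%:R * tf] in
      is_solution (oscillating_system (w (t0 + k%:R * tf))) [set` Ik] x /\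
      is_primitive [set` Ik] (fun t => enorm (x t) ^+ 2) w].

End Averaging.

Definition exponentially_stable_with (R : realType) (n : nat) (alpha beta : R)
    (F : R -> 'rV[R]_n -> 'rV[R]_n) : Prop :=
  forall (t0 : R) (x0 : 'rV[R]_n) (xb : R -> 'rV[R]_n),
    is_solution F `[t0, +oo[ xb -> xb t0 = x0 ->
    forall t, t0 <= t ->
      enorm (xb t) <= alpha * enorm x0 * expR (- beta * (t - t0)).

(* Main.v *)
Require Import Defs.
From HB Require Import structures.
From mathcomp Require Import all_boot all_order all_algebra.
From mathcomp Require Import all_classical all_reals all_analysis.
From mathcomp Require Import measurable_realfun.
From mathcomp Require Import ring lra.

Set Implicit Arguments.
Unset Strict Implicit.
Unset Printing Implicit Defensive.
Import Order.TTheory GRing.Theory Num.Theory.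
Import numFieldNormedType.Exports.
Local Open Scope classical_set_scope.
Local Open Scope ring_scope.

(** Two mechanisms play together: a fast frequency makes the state contract, and
    a contracting state stops the frequency from growing.

    Averaging.  For a large frequency omega, a trajectory of the oscillating
    system on an interval of the fixed length tf starting at a satisfies
      |x(t)| <= (alpha e^(- beta (t - a)) + C / sqrt omega) |x(a)|
    with C independent of the trajectory ([averaging_estimate]).  The error is
    proportional to |x(a)| because all fields vanish at the origin.

    Conclusion from averaging.  The frequency w has derivative |x|^2, hence is
    nondecreasing.  If its samples w_k ever exceed a certain threshold, then
    from that time on the samples e_k of |x| satisfy e_(k+1) <= q e_k with
    q = alpha e^(- beta tf) + D < 1 and w_(k+1) - w_k <= (alpha + D)^2 tf e_k^2,
    so that w_k + A e_k^2 is nonincreasing for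
    A = (alpha + D)^2 tf / (1 - q^2).  In every case w is bounded, and it
    converges.  The frequencies being bounded, |x| changes at most by a fixed
    factor E on each sampling interval, in particular
      |x(t)|^2 tf <= E^4 (w_(k+1) - w_k)  for t_(k+1) <= t <= t_(k+2),
    and the right-hand side tends to 0.

    Proof of the averaging estimate.  Let U_i be the periodic primitive of u_i,
    A_ij the mean of U_i u_j, and W_ij the periodic primitive of U_i u_j - A_ij
    ([averaging_data]); the A_ij are antisymmetric, since U_i U_j is periodic.
    In the variable
      z = x - omega^(-1/2) sum_i U_i(omega t) f_i(t, x)
            + omega^(-1) sum_ij W_ij(omega t) L_(f_j) f_i(t, x)
    the terms of order sqrt omega in x' cancel, those of order 1 leave
    f_0 - sum_ij A_ij L_(f_j) f_i, which by antisymmetry is the right-hand side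
    of the Lie-bracket system, and the rest is O(omega^(-1/2)) |x|
    ([near_identity_transform]).  Gronwall's inequality compares z with the
    solution of the Lie-bracket system that starts at the same point
    ([picard_global]).

    Regularity.  The fields are differentiable only at almost every x, and a
    trajectory may well stay in the exceptional null set.  They can still be
    differentiated along trajectories ([chain_rule]): by Fubini's theorem, a
    suitable small translate of the trajectory spends little time in the null
    set ([null_translate]); elsewhere the classical chain rule applies to the
    translate, with derivatives that are close to the expected ones, all fields
    involved being Lipschitz; and a version of Gronwall's inequality that
    tolerates a small set of bad times ([ae_gronwall]) concludes.  Because the
    inputs are merely measurable, the functions of time are Lipschitz functions
    with a derivative almost everywhere ([lip_primitive]), and the fundamental
    theorem of calculus for these is proved first. *)

(** * Completed Lebesgue measure versus its Borel part *)

Section CompletedLebesgue.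
Context {R : realType}.
Local Notation mu := (@lebesgue_measure R).
Local Notation cmu := (@completed_lebesgue_measure R).
Local Notation cara := (caratheodory_type (@wlength R idfun)^*%mu).

Lemma borel_cara (A : set R) : measurable A -> measurable (A : set cara).
Proof. by move=> mA; exact: sub_caratheodory. Qed.

Lemma negligible_cara (N : set R) : mu.-negligible N -> cmu.-negligible N.
Proof. by move=> [A [mA A0 NA]]; exists A; split => //; exact: borel_cara. Qed.

Lemma measurable_idfun_cara : measurable_fun setT (idfun : cara -> measurableTypeR R).
Proof. by move=> _ B mB; rewrite setTI; exact: borel_cara. Qed.

Lemma measurable_fun_cara d (T : measurableType d) (D : set R) (f : R -> T) :
  measurable D ->
  measurable_fun D f -> measurable_fun (D : set cara) (f : cara -> T).
Proof. by move=> mD mf _ B mB; apply: borel_cara; exact: mf. Qed.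

(** The identity is measurable from the completed line to the Borel line and
    pushes the completed measure forward to Lebesgue measure; for nonnegative
    functions this is the change of variables, for the others one splits. *)
Lemma integral_cara (D : set R) (f : R -> \bar R) : measurable D ->
  measurable_fun D f ->
  (\int[cmu]_(x in D) f x = \int[mu]_(x in D) f x)%E.
Proof.
move=> mD mf.
have ge0E (g : R -> \bar R) : measurable_fun D g -> (forall x, D x -> (0 <= g x)%E) ->
    (\int[cmu]_(x in D) g x = \int[mu]_(x in D) g x)%E.
  move=> mg g0.
  rewrite -(ge0_integral_pushforward measurable_idfun_cara cmu mD mg); last first.
    by move=> y; rewrite inE; exact: g0.
  by [].
rewrite integralE [RHS]integralE !ge0E //.
- exact: measurable_funeneg.
- exact: measurable_funepos.
Qed.

Lemma integrable_cara (D : set R) (f : R -> \bar R) : measurable D ->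
  mu.-integrable D f -> cmu.-integrable D f.
Proof.
move=> mD /integrableP[mf fi]; apply/integrableP; split.
  exact: measurable_fun_cara.
by rewrite integral_cara//; exact: measurableT_comp.
Qed.

(** A completed measurable set is a Borel set up to a Borel null set. Doing this
    for the countably many sets v > q, q rational, and setting v to 0 on the
    union G of the null sets makes every superlevel set Borel: v > x is the union
    of the v > q over the rationals q >= x. *)
Lemma borel_representative (D : set R) (v : R -> R) : measurable D ->
  measurable_fun (D : set cara) (v : cara -> R) ->
  exists v' : R -> R, [/\ measurable_fun D v',
    (forall t, `|v' t| <= `|v t|) &
    {ae mu, forall t, D t -> v' t = v t}].
Proof.
move=> mD mv.
have H (q : rat) : exists F : set R, [/\ measurable F, mu F = 0%E &
   exists A : set R, measurable A /\ (D `&` [set t | ratr q < v t]) `\` F = A `\` F].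
  have : measurable (D `&` [set t | ratr q < v t] : set cara).
    have := mv (borel_cara mD) `]ratr q, +oo[%classic (measurable_itv _).
    by rewrite preimage_itvoy.
  move=> mqv.
  have : (completed_algebra_gen mu).-sigma.-measurable (D `&` [set t | ratr q < v t]).
    by rewrite completed_caratheodory_measurable.
  rewrite g_sigma_completed_algebra_genE => -[A mA [N [F [mF F0 NF]]] AN].
  exists F; split => //; exists A; split => //; rewrite -AN.
  rewrite setDUl; apply/seteqP; split=> t /=; last by left.
  by move=> [//|[Nt Ft]]; have := NF _ Nt.
have {H} /choice[F HF] := H.
pose G := \bigcup_(i in [set: rat]) F i.
have mG : measurable G.
  by apply: bigcupT_measurable_rat => q; have [] := HF q.
have G0 : mu G = 0%E.
  have : mu.-negligible G.
    have -> : G = \bigcup_n (if (unpickle n : option rat) is Some q then F q else set0).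
      apply/seteqP; split=> t.
        move=> [q _ Fq]; exists (pickle q); [exact: I|rewrite pickleK; exact: Fq].
      by move=> [n _]; case: unpickle => // q Fq; exists q.
    apply: negligible_bigcup => n; case: unpickle => [q|]; last exact: negligible_set0.
    by have [mF F0 _] := HF q; exists (F q); split.
  by move=> ?; exact/negligibleP.
exists (fun t => if t \in G then 0 else v t); split.
- move=> _; apply: (measurability _ (RGenOInfty.measurableE R)) => //.
  move=> _ [_ [x ->] <-].
  have -> : D `&` (fun t => if t \in G then 0 else v t) @^-1` `]x, +oo[ =
     (if 0 > x then D `&` G else set0) `|`
     \bigcup_(q in [set: rat]) (if x <= ratr q then
        (D `&` [set t | ratr q < v t]) `\` G else set0).
    rewrite preimage_itvoy; apply/seteqP; split => t/=.
    - move=> [Dt]; case: ifPn => tG.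
        by rewrite inE in tG => -> ; left.
      move=> xv; right; have [q] := rat_in_itvoo xv.
      rewrite in_itv/= => /andP[xq qv]; exists q => //=.
      by rewrite ltW//; split => //; rewrite notin_setE in tG.
    - move=> [|[q _]].
        by case: ifPn => // x0 [Dt Gt]; split => //; rewrite mem_set.
      case: ifPn => //= xq [[Dt qv] nG].
      by split => //; rewrite memNset//; exact: le_lt_trans qv.
  apply: measurableU.
    by case: ifPn => // _; exact: measurableI.
  apply: bigcupT_measurable_rat => q; case: ifPn => // _.
  have [mF F0 [A [mA AF]]] := HF q.
  have -> : (D `&` [set t | ratr q < v t]) `\` G = (A `\` F q) `\` G.
    rewrite -AF; apply/seteqP; split=> t /=.
      by move=> [Dv nG]; split => //; split => // Ft; apply: nG; exists q.
    by move=> [[Dv _] nG].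
  by do 2 (apply: measurableD => //).
- by move=> t; case: ifPn => // _; rewrite normr0.
- exists G; split => // t /= H; apply: contrapT => nG; apply: H => _.
  by rewrite memNset.
Qed.

(** Gives access to the filter lemmas for statements that hold almost everywhere
    on the line; made an instance where it is used. *)
Lemma lebesgue_ae_filter : Filter (almost_everywhere mu).
Proof. exact: ae_filter_ringOfSetsType. Qed.

End CompletedLebesgue.

(** * Gronwall's inequality with a small set of bad times *)

Section Gronwall.
Context {R : realType}.
Local Notation mu := (@lebesgue_measure R).

Lemma is_derive_near (t : R) (y : R -> R) (v : R) : is_derive t 1 y v ->
  forall eta : R, 0 < eta ->
  \forall h \near 0^'+, `|y (t + h) - y t - h * v| <= eta * h.
Proof.
move=> [dy dyv] eta eta0.
have H : h^-1 *: (y (h *: 1 + t) - y t) @[h --> 0^'] --> v.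
  by rewrite -dyv; exact: dy.
have /cvgrPdist_le/(_ _ eta0) {}H := cvg_dnbhs_at_right H.
near=> h.
have h0 : 0 < h by near: h; exact: nbhs_right_gt.
have : `|v - h^-1 *: (y (h *: 1 + t) - y t)| <= eta by near: h.
rewrite -[h *: 1]/(h * 1) mulr1 [h + t]addrC -[_ *: _]/(_ * _) => le.
have -> : y (t + h) - y t - h * v = - (h * (v - h^-1 * (y (t + h) - y t))).
  by field; rewrite gt_eqF.
by rewrite normrN normrM (gtr0_norm h0) [leRHS]mulrC ler_pM2l.
Unshelve. all: by end_near. Qed.

(** Gronwall's inequality for a function whose right Dini derivative is controlled
    only outside a set E of measure at most e; on E one falls back on the bound Lam
    for the slopes, which costs Lam e. The comparison function is
      B t = e^(K (t - a)) (N a + (eps + eta) (t - a) + Lam psi t),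
    where psi t is the measure of the part before t of an open set U that contains E
    and exceeds it by at most eta. Real induction gives N <= B: near a point of U
    the term Lam psi has slope Lam, and near the other points the Dini inequality
    holds. *)
Lemma ae_gronwall (a b K eps Lam e : R) (N : R -> R) (E : set R) :
  a <= b -> 0 <= K -> 0 <= eps -> 0 <= Lam -> 0 <= e ->
  measurable E -> (mu E <= e%:E)%E -> 0 <= N a ->
  (forall s t, a <= s -> s <= t -> t <= b -> N t - N s <= Lam * (t - s)) ->
  (forall t, a < t < b -> ~ E t -> forall eta, 0 < eta ->
     \forall h \near 0^'+, N (t + h) <= N t + h * (K * N t + eps + eta)) ->
  N b <= expR (K * (b - a)) * (N a + eps * (b - a) + Lam * e).
Proof.
move=> ab K0 eps0 Lam0 e0 mE Ee Na0 lipN diniN.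
have ba0 : 0 <= b - a by rewrite subr_ge0.
suff H eta : 0 < eta -> N b <= expR (K * (b - a)) *
    (N a + (eps + eta) * (b - a) + Lam * (e + eta)).
  apply/ler_addgt0Pr => d d0.
  pose C := expR (K * (b - a)) * (b - a + Lam).
  have C0 : 0 <= C by apply: mulr_ge0; [exact: expR_ge0|exact: addr_ge0].
  have eta0 : 0 < d / (C + 1) by rewrite divr_gt0// ltr_wpDl.
  apply: (le_trans (H _ eta0)).
  have CE : d / (C + 1) * C <= d.
    rewrite mulrAC ler_pdivrMr ?ltr_wpDl//.
    by rewrite ler_pM2l// lerDl.
  move: CE; set q := d / (C + 1); rewrite /C; lra.
move=> eta0.
(* The Dini inequality is assumed in the open interval only, so a joins the bad set. *)
pose E' := E `|` [set a].
have mE' : measurable E' by exact: measurableU.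
have E'e : (mu E' <= e%:E)%E.
  have := measureU2 mu mE (measurable_set1 a).
  by rewrite [X in (_ + X)%E]lebesgue_measure_set1 adde0 => /le_trans; exact.
have [|U [oU E'U muU]] := lebesgue_regularity_outer mE' _ eta0.
  by rewrite (le_lt_trans E'e) ?ltry.
have mU : measurable U by exact: open_measurable.
have Ue : (mu U <= (e + eta)%:E)%E.
  have -> : U = E' `|` (U `\` E').
    by rewrite setDUK.
  have := measureU2 mu mE' (measurableD mU mE').
  by move=> /le_trans; apply; rewrite EFinD leeD// ltW.
have ee0 : 0 <= eps + eta by rewrite addr_ge0// ltW.
pose psi t := fine (mu (U `&` `[a, t])).
have muf t : mu (U `&` `[a, t]) \is a fin_num.
  rewrite ge0_fin_numE//; apply: (@le_lt_trans _ _ (mu U)).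
    by apply: le_measure; rewrite ?inE//; exact: measurableI.
  by rewrite (le_lt_trans Ue) ?ltry.
have psi_mono s t : s <= t -> psi s <= psi t.
  move=> st; rewrite fine_le//; apply: le_measure; rewrite ?inE.
  - exact: measurableI.
  - exact: measurableI.
  - apply: setIS; apply: subset_itvl; by rewrite bnd_simp.
have psi_ge0 t : 0 <= psi t by rewrite fine_ge0.
have psi_add t h : a <= t -> 0 < h -> `[t, t + h] `<=` U -> psi t + h <= psi (t + h).
  move=> at_ h0 thU; rewrite -lee_fin EFinD !fineK//.
  have -> : h%:E = mu `]t, t + h].
    rewrite lebesgue_measure_itv/= lte_fin ltrDl h0.
    by rewrite -EFinB addrAC subrr add0r.
  rewrite -measureU//; last 2 first.
  - exact: measurableI.
  - apply/seteqP; split => // s /= [[_]]; rewrite !in_itv/= => /andP[_ st] /andP[ts _].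
    by have := lt_le_trans ts st; rewrite ltxx.
  apply: le_measure; rewrite ?inE.
  - by apply: measurableU => //; exact: measurableI.
  - exact: measurableI.
  - move=> s /= [[Us]|]; rewrite !in_itv/= => /andP[as_ st].
      by split => //; rewrite as_ (le_trans st)// lerDl ltW.
    split; last by rewrite st (le_trans at_)// ltW.
    by apply: thU => /=; rewrite in_itv/= st ltW.
pose G t := N a + (eps + eta) * (t - a) + Lam * psi t.
pose B t := expR (K * (t - a)) * G t.
have G_ge0 t : a <= t -> 0 <= G t.
  move=> at_; have ta0 : 0 <= t - a by rewrite subr_ge0.
  by rewrite /G; do 2 (apply: addr_ge0 => //; last exact: mulr_ge0).
have G_mono s t : s <= t -> G s <= G t.
  move=> st; rewrite /G; apply: lerD; last by rewrite ler_wpM2l// psi_mono.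
  by rewrite lerD2l ler_wpM2l// lerD2r.
have B_ge0 t : a <= t -> 0 <= B t.
  by move=> at_; rewrite /B mulr_ge0 ?expR_ge0 ?G_ge0.
have B_step t h g : a <= t -> 0 <= h -> 0 <= g -> G t + g <= G (t + h) ->
    B t + h * (K * B t) + g <= B (t + h).
  move=> at_ h0 g0 Gg.
  have -> : B (t + h) = expR (K * (t - a)) * (expR (K * h) * G (t + h)).
    by rewrite /B mulrA -expRD -mulrDr addrAC.
  have e1 : 1 + K * h <= expR (K * h) by exact: expR_ge1Dx.
  have e2 : 1 <= expR (K * (t - a)).
    by rewrite -expR0 ler_expR mulr_ge0// subr_ge0.
  have Gt0 := G_ge0 _ at_.
  have Kh0 : 0 <= K * h by rewrite mulr_ge0.
  apply: (@le_trans _ _ (expR (K * (t - a)) * ((1 + K * h) * (G t + g)))).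
    rewrite /B; set x := expR _ in e2 *.
    have x0 : 0 <= x by lra.
    have : 0 <= (x - 1) * g by rewrite mulr_ge0// subr_ge0.
    have : 0 <= x * (K * h * g) by rewrite mulr_ge0// mulr_ge0.
    by nra.
  rewrite ler_wpM2l ?expR_ge0// ler_pM//; by [rewrite addr_ge0|].
(* Induction step: the inequality N <= B propagates a little to the right. *)
have step t : a <= t -> t < b -> N t <= B t ->
    exists2 s, t < s <= b & N s <= B s.
  move=> at_ tb NB.
  have [Ut|nUt] := pselect (U t).
    have /nbhs_ballP[r /= r0 rU] : nbhs t U by exact: open_nbhs_nbhs.
    pose h := Num.min (r / 2) (b - t).
    have h0 : 0 < h by rewrite lt_min divr_gt0//= subr_gt0.
    have thU : `[t, t + h] `<=` U.
      move=> s /=; rewrite in_itv/= => /andP[ts sth]; apply: rU.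
      rewrite /ball/= ler0_norm ?subr_le0// opprB.
      have : h <= r / 2 by rewrite ge_min lexx.
      by lra.
    have thb : t + h <= b.
      have : h <= b - t by rewrite ge_min lexx orbT.
      by lra.
    exists (t + h); first by rewrite ltrDl h0.
    have := psi_add _ _ at_ h0 thU => psih.
    have Lh0 : 0 <= Lam * h by rewrite mulr_ge0// ltW.
    have /(B_step _ _ _ at_ (ltW h0) Lh0) : G t + Lam * h <= G (t + h).
      rewrite /G; have : Lam * (psi t + h) <= Lam * psi (t + h) by rewrite ler_wpM2l.
      have : (eps + eta) * (t - a) <= (eps + eta) * (t + h - a).
        by rewrite ler_wpM2l// lerD2r lerDl ltW.
      lra.
    have := lipN t (t + h) at_ _ thb; rewrite lerDl (ltW h0) => /(_ isT).
    have : 0 <= h * (K * B t) by rewrite mulr_ge0 ?(ltW h0)// mulr_ge0// B_ge0.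
    have -> : Lam * (t + h - t) = Lam * h by congr (_ * _); ring.
    lra.
  have nE : ~ E t by move=> Et; apply: nUt; apply: E'U; left.
  have ant : a < t.
    by rewrite lt_neqAle at_ andbT; apply/eqP => ta; apply: nUt; apply: E'U; right.
  have : \forall h \near 0^'+, N (t + h) <= N t + h * (K * N t + eps + eta).
    by apply: diniN => //; rewrite ant.
  move=> H.
  near (0:R)^'+ => h.
  have h0 : 0 < h by near: h; exact: nbhs_right_gt.
  have hb : h < b - t by near: h; apply: nbhs_right_lt; rewrite subr_gt0.
  have Nh : N (t + h) <= N t + h * (K * N t + eps + eta) by near: h.
  exists (t + h); first by rewrite ltrDl h0/=; lra.
  have g0 : 0 <= (eps + eta) * h by rewrite mulr_ge0// ltW.
  have /(B_step _ _ _ at_ (ltW h0) g0) : G t + (eps + eta) * h <= G (t + h).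
    rewrite /G; have : Lam * psi t <= Lam * psi (t + h).
      by rewrite ler_wpM2l// psi_mono// lerDl ltW.
    lra.
  have : h * (K * N t) <= h * (K * B t).
    by rewrite ler_wpM2l ?(ltW h0)// ler_wpM2l.
  lra.
(* Suprema: N grows at most with slope Lam and B is nondecreasing, so N <= B holds at
   the supremum c of the set where it holds, and the step forbids c < b. *)
pose S := [set t | a <= t <= b /\ N t <= B t].
have Sa : S a.
  split; first by rewrite lexx.
  rewrite /B /G !subrr !mulr0 expR0 mul1r addr0 lerDl.
  by rewrite mulr_ge0.
have Sub : ubound S b by move=> t [/andP[]].
have hasS : has_sup S by split; [exists a|exists b].
pose c := sup S.
have ac : a <= c by exact: sup_upper_bound.
have cb : c <= b by apply: ge_sup => //; exists a.
have Sc : N c <= B c.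
  apply/ler_addgt0Pr => d d0.
  have r0 : 0 < d / (Lam + 1) by rewrite divr_gt0// ltr_wpDl.
  have rE : Lam * (d / (Lam + 1)) <= d.
    by rewrite mulrA ler_pdivrMr ?ltr_wpDl// mulrC ler_pM2l// lerDl.
  move: r0 rE; set r := d / (Lam + 1) => r0 rE.
  have [t [/andP[at_ tb] NBt] ct] := sup_adherent r0 hasS.
  have tc : t <= c by apply: sup_upper_bound => //; split => //; rewrite at_.
  have := lipN _ _ at_ tc cb => lip1.
  have BB : B t <= B c.
    have cE : t + (c - t) = c by ring.
    have ct0 : 0 <= c - t by rewrite subr_ge0.
    have := @B_step t (c - t) 0 at_ ct0 (lexx _); rewrite cE !addr0 => /(_ (G_mono _ _ tc)).
    apply: le_trans; rewrite lerDl mulr_ge0// mulr_ge0//.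
    exact: B_ge0.
  have : Lam * (c - t) <= d.
    apply: le_trans rE; rewrite ler_wpM2l// lerBlDl -lerBlDr.
    exact: ltW.
  lra.
have cbE : c = b.
  apply/eqP; rewrite eq_le cb/= leNgt; apply/negP => ltcb.
  have [s /andP[cs sb] NBs] := step _ ac ltcb Sc.
  have : s <= c.
    apply: sup_upper_bound => //; split => //.
    by rewrite sb andbT (le_trans ac)// ltW.
  by rewrite leNgt cs.
rewrite cbE in Sc; apply: (le_trans Sc); rewrite /B /G ler_wpM2l ?expR_ge0//.
rewrite lerD2l ler_wpM2l// -lee_fin fineK//.
apply: le_trans Ue; apply: le_measure; rewrite ?inE//.
exact: measurableI.
Unshelve. all: by end_near. Qed.

End Gronwall.

(** * Derivatives of primitives *)

Section Primitives.
Context {R : realType}.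
Local Notation mu := (@lebesgue_measure R).
Local Notation cmu := (@completed_lebesgue_measure R).
Local Notation cara := (caratheodory_type (@wlength R idfun)^*%mu).

Lemma completed_integrable_representative (D : set R) (v : R -> R) :
  measurable D -> cmu.-integrable D (EFin \o v) ->
  exists v' : R -> R, [/\ mu.-integrable D (EFin \o v'),
    {ae mu, forall t, D t -> v' t = v t} &
    forall D', measurable D' -> D' `<=` D ->
      \int[cmu]_(s in D') v s = \int[mu]_(s in D') v' s].
Proof.
move=> mD /integrableP[/measurable_EFinP mv vi].
have [v' [mv' v'v v'E]] := borel_representative mD mv.
have mD' := borel_cara mD.
exists v'; split => //.
  apply/integrableP; split; first exact/measurable_EFinP.
  have mav : measurable_fun D (fun t => `|(EFin \o v') t|)%E.
    by apply: measurableT_comp => //; exact/measurable_EFinP.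
  rewrite -integral_cara//.
  apply: le_lt_trans vi; apply: ge0_le_integral.
  - exact: mD'.
  - by move=> x _; exact: abse_ge0.
  - exact: (measurable_fun_cara mD mav).
  - by apply: measurableT_comp => //; exact/measurable_EFinP.
  - by move=> x _; rewrite /= lee_fin.
move=> E mE ED.
have mE' := borel_cara mE.
have mv'E : measurable_fun E (EFin \o v').
  by apply/measurable_EFinP; exact: (measurable_funS mD ED).
congr fine; rewrite -integral_cara//.
apply: ae_eq_integral.
- exact: mE'.
- by apply/measurable_EFinP; exact: (measurable_funS mD' ED).
- exact: (measurable_fun_cara mE mv'E).
- have [N [mN N0 NE]] := v'E.
  exists N; split => //; first exact: borel_cara.
  move=> t /= H; apply: NE => /= K; apply: H => Et; congr EFin.
  by rewrite K//; exact: ED.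
Qed.

Lemma completed_itv (a b : R) : a <= b -> cmu `[a, b] = (b - a)%:E.
Proof.
move=> ab; have -> : cmu `[a, b] = mu `[a, b] by [].
rewrite lebesgue_measure_itv/= lte_fin; case: ltP => // ba.
by congr EFin; lra.
Qed.

Lemma completed_Rintegral_le (a b M : R) (v : R -> R) : a <= b ->
  cmu.-integrable `[a, b] (EFin \o v) ->
  (forall t, a <= t <= b -> `|v t| <= M) ->
  `|\int[cmu]_(s in `[a, b]) v s| <= M * (b - a).
Proof.
move=> ab iv vM.
have mI : measurable (`[a, b]%classic : set cara) by exact: (borel_cara (measurable_itv `[a, b])).
have iM : cmu.-integrable `[a, b] (EFin \o cst M).
  apply/integrableP; split; first exact: (measurable_cst M%:E).
  rewrite /= integral_cst// [X in (_ * X)%E](_ : _ = (b - a)%:E).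
    by rewrite -EFinM ltry.
  exact: completed_itv.
apply: (le_trans (le_normr_Rintegral mI iv)).
have -> : M * (b - a) = \int[cmu]_(s in `[a, b]) cst M s.
  by rewrite Rintegral_cst//; rewrite [X in fine X](_ : _ = (b - a)%:E)//; exact: completed_itv.
apply: le_Rintegral => //.
exact: (integrable_norm iv).
Qed.

Lemma completed_Rintegral_itvD (a b c : R) (v : R -> R) : a <= b -> b <= c ->
  cmu.-integrable `[a, c] (EFin \o v) ->
  \int[cmu]_(s in `[a, c]) v s =
  \int[cmu]_(s in `[a, b]) v s + \int[cmu]_(s in `[b, c]) v s.
Proof.
move=> ab bc iv.
have [v' [iv' _ E]] := completed_integrable_representative (measurable_itv `[a, c]) iv.
have sub1 : `[a, b] `<=` `[a, c] by apply: subset_itvl; rewrite bnd_simp.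
have sub2 : `[b, c] `<=` `[a, c] by apply: subset_itvr; rewrite bnd_simp.
rewrite !E//.
rewrite -(@Rintegral_itv_obnd_cbnd _ b); last first.
  apply: integrableS iv' => //.
  by apply: subset_itvr; rewrite bnd_simp.
rewrite -(@Rintegral_itvB _ _ _ _ b iv') ?bnd_simp//.
ring.
Qed.

(** Lebesgue's differentiation theorem, applied to an integrable Borel
    representative of v; both facts depend on v only through its integrals. *)
Lemma is_primitive_ae_derive (a b : R) (v y : R -> R) : a < b ->
  is_primitive `[a, b] v y ->
  {within `[a, b], continuous y} /\
  {ae mu, forall t, a < t < b -> is_derive t (1 : R) y (v t)}.
Proof.
move=> ab yv.
have Ia : `[a, b]%classic a by rewrite /= in_itv/= lexx ltW.
have Ib : `[a, b]%classic b by rewrite /= in_itv/= lexx ltW.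
have [iv _] := yv _ _ Ia Ib (ltW ab).
have [v' [iv' v'v E]] := completed_integrable_representative (measurable_itv `[a, b]) iv.
have yE t : a <= t <= b -> y t = y a + \int[mu]_(s in `[a, t]) v' s.
  move=> /andP[at_ tb].
  have It : `[a, b]%classic t by rewrite /= in_itv/= at_.
  have [_ ->] := yv _ _ Ia It at_.
  by rewrite E//; apply: subset_itvl; rewrite bnd_simp.
split.
  have := parameterized_integral_continuous (ltW ab) iv'.
  move=> cF.
  have cG : {within `[a, b], continuous (fun t => y a + \int[mu]_(s in `[a, t]) v' s)}.
    by move=> t; apply: cvgD; [exact: cvg_cst|exact: cF].
  apply: subspace_eq_continuous cG => t /set_mem; rewrite /= in_itv/= => tab.
  exact/esym/yE.
pose f := v' \_ `[a, b].
have mf : mu.-integrable setT (EFin \o f).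
  rewrite -restrict_EFin; apply/integrable_restrict => //=.
  by rewrite setTI.
have iff' u : mu.-integrable [set` Interval (BLeft a) (BRight u)] (EFin \o f).
  exact: integrableS mf.
have locf : locally_integrable [set: R] f.
  by apply: open_integrable_locally => //; exact: openT.
have FTC := FTC1 iff' locf.
have aefilter := @lebesgue_ae_filter R.
apply: filterS2 FTC v'v => t /= H1 H2 /andP[at_ tb].
have It : `[a, b]%classic t by rewrite /= in_itv/= !ltW.
rewrite -(H2 It).
have at1 : (a%:E < t%:E)%E by rewrite lte_fin.
have [] := H1 at1.
set F := fun x => _ => dF; rewrite derive1E => dFE.
have Ft : is_derive t 1 F (v' t).
  have := derivableP dF; rewrite dFE /f patchE mem_set//.
have Gt : is_derive t 1 (cst (y a) \+ F) (v' t).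
  by rewrite -[v' t]add0r; exact: is_deriveD.
apply: near_eq_is_derive Gt => //.
near=> s.
have sI : a <= s <= b.
  have : s \in `]a, b[ by near: s; apply: near_in_itvoo; rewrite in_itv/= at_.
  by rewrite in_itv/= => /andP[? ?]; rewrite !ltW.
rewrite (yE s)//= /F; congr (_ + _).
apply: eq_Rintegral => r /set_mem; rewrite /= in_itv/= => /andP[ar rs].
rewrite /f patchE mem_set//= in_itv/= ar (le_trans rs)//.
by case/andP: sI.
Unshelve. all: by end_near. Qed.

End Primitives.

(** * Lipschitz functions with an almost everywhere derivative *)

(** Composing with this projection extends a function on [a, b] to the line,
    and keeps its Lipschitz constant. *)
Definition clamp (R : realType) (a b t : R) : R := Num.max a (Num.min t b).

Section Clamp.
Context {R : realType}.
Implicit Types a b s t : R.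

Lemma clamp_itv a b t : a <= b -> a <= clamp a b t <= b.
Proof.
by move=> ab; rewrite /clamp le_max lexx/= ge_max ab ge_min lexx orbT.
Qed.

Lemma clamp_id a b t : a <= t <= b -> clamp a b t = t.
Proof. by move=> /andP[at_ tb]; rewrite /clamp min_l// max_r. Qed.

Lemma clamp_lip a b s t : `|clamp a b s - clamp a b t| <= `|s - t|.
Proof.
wlog st : s t / s <= t => [W|].
  have [st|/ltW ts] := leP s t; first exact: W.
  by rewrite distrC [`|s - t|]distrC; exact: W.
rewrite distrC [`|s - t|]distrC [`|t - s|]ger0_norm ?subr_ge0//.
have : 0 <= clamp a b t - clamp a b s <= t - s.
  rewrite /clamp /Num.max /Num.min.
  by do 4 case: ifPn => //; rewrite -?leNgt; lra.
by move=> /andP[d0 dts]; rewrite ger0_norm.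
Qed.

Lemma lipschitz_continuous (V W : normedModType R) (K : R) (f : V -> W) :
  0 <= K -> (forall x y : V, `|f x - f y| <= K * `|x - y|) -> continuous f.
Proof.
move=> K0 fK t; apply/cvgrPdist_le => e e0; near=> s.
apply: (le_trans (fK t s)).
have : `|t - s| <= e / (K + 1).
  near: s; apply: cvgr_dist_le; last by rewrite divr_gt0// ltr_wpDl.
  exact: cvg_id.
move=> /(ler_wpM2l K0)/le_trans; apply.
by rewrite mulrA ler_pdivrMr ?ltr_wpDl// mulrC ler_pM2l// lerDl.
Unshelve. all: by end_near. Qed.

End Clamp.

(** These are the absolutely continuous functions on [a, b] whose derivative v is
    essentially bounded. Boundedness and integrability of v are replaced by a
    Lipschitz bound on y, so that the calculus rules below need no measurability;
    [is_primitive_lip] and [lip_primitive_is_primitive] translate from and to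
    integrals. *)
Definition lip_primitive (R : realType) (a b : R) (v y : R -> R) : Prop :=
  (exists K, forall s t, a <= s <= b -> a <= t <= b ->
     `|y s - y t| <= K * `|s - t|) /\
  {ae @lebesgue_measure R, forall t, a < t < b -> is_derive t (1 : R) y (v t)}.

Section LipPrimitive.
#[local] Existing Instance lebesgue_ae_filter.
Context {R : realType}.
Local Notation mu := (@lebesgue_measure R).
Implicit Types a b : R.

Lemma lip_primitive_lip a b v y : lip_primitive a b v y ->
  exists2 K, 0 <= K & forall s t, a <= s <= b -> a <= t <= b ->
     `|y s - y t| <= K * `|s - t|.
Proof.
move=> [[K yK] _]; exists `|K| => // s t sI tI.
by apply: (le_trans (yK _ _ sI tI)); rewrite ler_wpM2r// ler_norm.
Qed.

Lemma lip_primitive_bounded a b v y : lip_primitive a b v y ->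
  exists2 M, 0 <= M & forall t, a <= t <= b -> `|y t| <= M.
Proof.
move=> /lip_primitive_lip[K K0 yK].
exists (`|y a| + K * `|b - a|); first by rewrite addr_ge0// mulr_ge0.
move=> t /andP[at_ tb].
have ab := le_trans at_ tb.
have := yK t a; rewrite at_ tb lexx ab => /(_ isT isT) le1.
have -> : y t = (y t - y a) + y a by rewrite subrK.
apply: (le_trans (ler_normD _ _)); rewrite addrC lerD2l.
apply: (le_trans le1); rewrite ler_wpM2l//.
by rewrite !ger0_norm ?subr_ge0// lerD2r.
Qed.

Lemma lip_primitive_itv a b c d v y : a <= c -> d <= b ->
  lip_primitive a b v y -> lip_primitive c d v y.
Proof.
move=> ac db [[K yK] dy]; split.
  exists K => s t /andP[cs sd] /andP[ct td].
  by apply: yK; rewrite ?(le_trans ac)//= (le_trans _ db).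
apply: filterS dy => t H /andP[ct td]; apply: H.
by rewrite (le_lt_trans ac)//= (lt_le_trans _ db).
Qed.

Lemma lip_primitive_cst a b (k : R) : lip_primitive a b (fun=> 0) (fun=> k).
Proof.
split; first by exists 0 => s t _ _; rewrite subrr normr0 mul0r.
by apply: aeW => t _; exact: is_derive_cst.
Qed.

Lemma lip_primitive_id a b : lip_primitive a b (fun=> 1) id.
Proof.
split; first by exists 1 => s t _ _; rewrite mul1r.
by apply: aeW => t _; exact: is_derive_id.
Qed.

Lemma lip_primitiveD a b v y v' y' :
  lip_primitive a b v y -> lip_primitive a b v' y' ->
  lip_primitive a b (fun t => v t + v' t) (fun t => y t + y' t).
Proof.
move=> [[K yK] dy] [[K' yK'] dy']; split.
  exists (K + K') => s t sI tI; rewrite mulrDl.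
  have -> : y s + y' s - (y t + y' t) = (y s - y t) + (y' s - y' t) by ring.
  by rewrite (le_trans (ler_normD _ _))// lerD ?yK ?yK'.
apply: filterS2 dy dy' => t H H' tI.
by apply: is_deriveD; [exact: H|exact: H'].
Qed.

Lemma lip_primitiveM a b v y v' y' :
  lip_primitive a b v y -> lip_primitive a b v' y' ->
  lip_primitive a b (fun t => y t * v' t + y' t * v t) (fun t => y t * y' t).
Proof.
move=> Hy Hy'; split.
  have [K K0 yK] := lip_primitive_lip Hy.
  have [K' K0' yK'] := lip_primitive_lip Hy'.
  have [M M0 yM] := lip_primitive_bounded Hy.
  have [M' M0' yM'] := lip_primitive_bounded Hy'.
  exists (M * K' + M' * K) => s t sI tI.
  have -> : y s * y' s - y t * y' t =
    y s * (y' s - y' t) + y' t * (y s - y t) by ring.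
  rewrite mulrDl (le_trans (ler_normD _ _))// !normrM -!mulrA.
  by rewrite lerD// ler_pM ?yM ?yM' ?yK ?yK'.
case: Hy Hy' => [_ dy] [_ dy'].
apply: filterS2 dy dy' => t H H' tI.
by apply: is_deriveM; [exact: H|exact: H'].
Qed.

Lemma lip_primitiveZ a b k v y : lip_primitive a b v y ->
  lip_primitive a b (fun t => k * v t) (fun t => k * y t).
Proof.
move=> [[K yK] dy]; split.
  exists (`|k| * K) => s t sI tI; rewrite -mulrBr normrM -mulrA.
  by rewrite ler_wpM2l// yK.
by apply: filterS dy => t H tI; apply: is_deriveZ; exact: H.
Qed.

Lemma lip_primitiveB a b v y v' y' :
  lip_primitive a b v y -> lip_primitive a b v' y' ->
  lip_primitive a b (fun t => v t - v' t) (fun t => y t - y' t).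
Proof.
move=> Hy /(lip_primitiveZ (-1)) Hy'.
have := lip_primitiveD Hy Hy'.
by congr lip_primitive; apply/funext => t; rewrite mulN1r.
Qed.

Lemma lip_primitive_sum (I : finType) a b (v y : I -> R -> R) :
  (forall i, lip_primitive a b (v i) (y i)) ->
  lip_primitive a b (fun t => \sum_i v i t) (fun t => \sum_i y i t).
Proof.
move=> H; elim: (index_enum I) => [|i s IH].
  have := lip_primitive_cst a b 0.
  by congr lip_primitive; apply/funext => t; rewrite big_nil.
have := lip_primitiveD (H i) IH.
by congr lip_primitive; apply/funext => t; rewrite big_cons.
Qed.

Lemma eq_lip_primitive a b v y v' y' :
  (forall t, a <= t <= b -> v t = v' t) -> (forall t, a <= t <= b -> y t = y' t) ->
  lip_primitive a b v y -> lip_primitive a b v' y'.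
Proof.
move=> vv' yy' [[K yK] dy]; split.
  by exists K => s t sI tI; rewrite -!yy'//; exact: yK.
apply: filterS dy => t H tI.
have tI' : a <= t <= b by case/andP: tI => ? ?; rewrite !ltW.
rewrite -vv'//; apply: near_eq_is_derive (H tI).
near=> s; apply: yy'.
have : s \in `]a, b[ by near: s; apply: near_in_itvoo; rewrite in_itv.
by rewrite in_itv/= => /andP[? ?]; rewrite !ltW.
Unshelve. all: by end_near. Qed.

(** Null sets are preserved by affine maps: the image of Lebesgue measure, scaled by
    k, gives the right length to intervals, so it is Lebesgue measure. *)
Lemma ae_affine (P : R -> Prop) (k c : R) : 0 < k ->
  {ae mu, forall t, P t} -> {ae mu, forall t, P (k * t + c)}.
Proof.
move=> k0 [N [mN N0 PN]].
pose phi := fun t : R => k * t + c.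
have mphi : measurable_fun [set: measurableTypeR R] (phi : _ -> measurableTypeR R).
  by apply: measurable_funD => //; exact: measurable_funM.
pose pf : {measure set (measurableTypeR R) -> \bar R} :=
  measure_function_pushforward__canonical__measure_function_Measure mu mphi.
pose nu := mscale (NngNum (ltW k0)) pf.
have nuE : forall A, measurable A -> mu A = nu A.
  apply: lebesgue_measure_unique => X /ocitvP[->|[[x y] /= xy ->]].
    by rewrite !measure0.
  rewrite /nu /mscale/= /pushforward.
  have -> : phi @^-1` `]x, y] = `](x - c) / k, (y - c) / k]%classic.
    apply/seteqP; split => t /=; rewrite !in_itv/= /phi.
      by rewrite ltr_pdivrMr// ler_pdivlMr// ltrBlDr lerBrDr mulrC.
    by rewrite ltr_pdivrMr// ler_pdivlMr// ltrBlDr lerBrDr mulrC.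
  rewrite !lebesgue_measure_itv/= !lte_fin xy.
  rewrite ltr_pM2r ?invr_gt0// ltrD2r xy -!EFinB -EFinM; congr EFin.
  by field; rewrite gt_eqF.
exists (phi @^-1` N); split.
- by rewrite -[_ @^-1` _]setTI; exact: (mphi measurableT N mN).
- move: N0; rewrite nuE// /nu /mscale/= /pushforward => /eqP.
  by rewrite mule_eq0 eqe gt_eqF//= => /eqP.
- by move=> t /= H; apply: PN.
Qed.

Lemma lip_primitive_affine a b k c v y : 0 < k ->
  lip_primitive (k * a + c) (k * b + c) v y ->
  lip_primitive a b (fun t => k * v (k * t + c)) (fun t => y (k * t + c)).
Proof.
move=> k0 [[K yK] dy].
have I t : a <= t <= b -> k * a + c <= k * t + c <= k * b + c.
  by rewrite !lerD2r !ler_pM2l.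
split.
  exists (K * k) => s t /I sI /I tI; apply: (le_trans (yK _ _ sI tI)).
  by rewrite opprD addrACA subrr addr0 -mulrBr normrM (gtr0_norm k0) mulrA.
apply: filterS (ae_affine c k0 dy) => t H tI.
have {}H : is_derive (k * t + c) 1 y (v (k * t + c)).
  by apply: H; rewrite !ltrD2r !ltr_pM2l.
have Hk : is_derive t 1 (fun t => k * t + c) k.
  rewrite -[X in is_derive _ _ _ X]addr0; apply: is_deriveD.
  rewrite -[X in is_derive _ _ _ X]mulr1.
  exact: (@is_deriveZ _ _ _ id k).
rewrite [X in is_derive _ _ _ X]mulrC.
exact: (@is_derive1_comp _ y (fun t => k * t + c) t _ _ H Hk).
Qed.

(** The absolute increment of y from a satisfies the hypotheses of Gronwall's
    inequality with K = 0 and eps = M, and the bad times have measure 0. *)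
Lemma lip_primitive_mvt a b M v y : a <= b -> 0 <= M -> lip_primitive a b v y ->
  (forall t, a <= t <= b -> `|v t| <= M) -> `|y b - y a| <= M * (b - a).
Proof.
move=> ab M0 Hy vM.
have [K K0 yK] := lip_primitive_lip Hy.
have [_ [E [mE E0 dE]]] := Hy.
have := @ae_gronwall R a b 0 M K 0 (fun t => `|y t - y a|) E ab (lexx _) M0 K0 (lexx _) mE.
rewrite E0 mul0r expR0 mul1r mulr0 addr0 subrr normr0 add0r; apply => //.
- move=> s t as_ st tb; apply: (le_trans (ler_norm _)).
  apply: (le_trans (ler_dist_dist _ _)).
  have -> : y t - y a - (y s - y a) = y t - y s by ring.
  rewrite -[in leRHS](@ger0_norm _ (t - s)) ?subr_ge0//.
  by apply: yK; rewrite ?as_ ?tb ?(le_trans as_) ?(le_trans st).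
- move=> t tI nE eta eta0.
  have dy : is_derive t 1 y (v t).
    by apply: contrapT => ndy; apply: nE; apply: dE => /= /(_ tI).
  near=> h.
  have h0 : 0 < h by near: h; exact: nbhs_right_gt.
  have : `|y (t + h) - y t - h * v t| <= eta * h.
    by near: h; exact: is_derive_near.
  have -> : y (t + h) - y a = (y (t + h) - y t - h * v t) + (y t - y a) + h * v t by ring.
  move=> le1; rewrite mul0r add0r.
  apply: (le_trans (ler_normD _ _)).
  rewrite normrM (gtr0_norm h0).
  have : `|v t| <= M by apply: vM; case/andP: tI => ? ?; rewrite !ltW.
  rewrite -(ler_pM2l h0).
  have := ler_normD (y (t + h) - y t - h * v t) (y t - y a).
  by lra.
Unshelve. all: by end_near. Qed.

End LipPrimitive.

(** * Fundamental theorem of calculus for Lipschitz functions *)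

Section LipPrimitiveIntegral.
#[local] Existing Instance lebesgue_ae_filter.
Context {R : realType}.
Local Notation mu := (@lebesgue_measure R).
Local Notation cmu := (@completed_lebesgue_measure R).
Local Notation cara := (caratheodory_type (@wlength R idfun)^*%mu).
Implicit Types a b : R.

Lemma lip_primitive_unique a b v y z : a <= b ->
  lip_primitive a b v y -> lip_primitive a b v z ->
  forall t, a <= t <= b -> y t - y a = z t - z a.
Proof.
move=> ab Hy Hz t /andP[at_ tb].
have := lip_primitive_itv (lexx a) tb (lip_primitiveB Hy Hz).
move=> /(lip_primitive_mvt at_ (lexx 0)) H.
have : `|y t - z t - (y a - z a)| <= 0 * (t - a).
  by apply: H => s _; rewrite subrr normr0.
rewrite mul0r normr_le0 => /eqP.
by lra.
Qed.

Lemma is_primitive_lip a b M v y : a < b ->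
  is_primitive `[a, b] v y -> (forall t, a <= t <= b -> `|v t| <= M) ->
  lip_primitive a b v y.
Proof.
move=> ab yv vM; split; last by have [] := is_primitive_ae_derive ab yv.
exists M => s t.
wlog st : s t / s <= t => [H sI tI|].
  have [st|/ltW ts] := leP s t; first exact: H.
  by rewrite distrC [`|s - t|]distrC; exact: H.
move=> sI tI.
have [iv ->] : _ /\ _ := yv s t sI tI st.
rewrite opprD addrA subrr sub0r normrN distrC [`|t - s|]ger0_norm ?subr_ge0//.
apply: completed_Rintegral_le => // r /andP[sr rt].
case/andP: sI tI => as_ sb /andP[at_ tb].
by apply: vM; rewrite (le_trans as_)//= (le_trans rt).
Qed.

Lemma integrable_set1 (a : R) (v : R -> R) : cmu.-integrable `[a, a] (EFin \o v).
Proof.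
have mI : measurable (`[a, a]%classic : set cara).
  exact: (borel_cara (measurable_itv `[a, a])).
have -> : `[a, a]%classic = [set a].
  by rewrite set_itv1.
rewrite set_itv1 in mI.
apply: (eq_integrable mI (cst (v a)%:E)).
  by move=> x /set_mem/= ->.
apply/integrableP; split; first exact: (measurable_cst (v a)%:E).
rewrite /= integral_cst//.
rewrite [X in (_ * X)%E](_ : _ = 0%E) ?mule0//.
by have := completed_itv (lexx a); rewrite subrr set_itv1.
Qed.

(** Fundamental theorem of calculus. Almost everywhere, v is the limit of the
    difference quotients q_m of y, which are continuous and bounded by the Lipschitz
    constant K; so v is measurable, bounded and integrable. Its integral V is then
    another function with derivative v, and [lip_primitive_unique] identifies the
    increments of V and y. *)
Lemma lip_primitive_is_primitive a b v y :
  lip_primitive a b v y -> is_primitive `[a, b] v y.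
Proof.
move=> H c d; rewrite /= !in_itv/= => /andP[ac cb] /andP[ad db] cd.
have {ac db cb ad}{}H : lip_primitive c d v y by exact: lip_primitive_itv H.
move: cd; rewrite le_eqVlt => /predU1P[<-|cd].
  have iv := integrable_set1 c v; split => //.
  have := completed_Rintegral_itvD (lexx c) (lexx c) iv.
  set I := Rintegral _ _ _; lra.
have [K K0 yK] := lip_primitive_lip H.
have [_ [N [mN N0 dN]]] := H.
(* D is the set of times in ]c, d[ at which v t is known to be the derivative. *)
pose D := `]c, d[%classic `\` N.
have mD : measurable D by apply: measurableD => //; exact: measurable_itv.
have DI t : D t -> c < t < d by move=> [/=]; rewrite in_itv.
have dv t : D t -> is_derive t 1 y (v t).
  move=> Dt; apply: contrapT => nd; case: (Dt) => _; apply; apply: dN => /= H'.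
  by apply: nd; apply: H'; exact: DI.
pose Y t := y (clamp c d t).
have clI t : c <= clamp c d t <= d by apply: clamp_itv; exact: ltW.
have YK s t : `|Y s - Y t| <= K * `|s - t|.
  by apply: (le_trans (yK _ _ (clI s) (clI t))); rewrite ler_wpM2l// clamp_lip.
have cY : continuous Y by exact: lipschitz_continuous K0 YK.
pose q (m : nat) t := m.+1%:R * (Y (t + m.+1%:R^-1) - Y t).
have mq m : measurable_fun [set: R] (q m).
  apply: continuous_measurable_fun => t; apply: cvgM; first exact: cvg_cst.
  apply: cvgB; last exact: cY.
  have shift : (x + m.+1%:R^-1) @[x --> t] --> t + m.+1%:R^-1.
    by apply: cvgD; [exact: cvg_id|exact: cvg_cst].
  exact: (cvg_comp _ _ shift (cY _)).
have qK m t : `|q m t| <= K.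
  rewrite /q normrM; have m0 : 0 < m.+1%:R :> R by rewrite ltr0n.
  apply: (le_trans (ler_wpM2l _ (YK _ _))) => //.
  rewrite [t + _]addrC addrK mulrCA ger0_norm// ger0_norm ?invr_ge0//.
  by rewrite divff ?mulr1// gt_eqF.
have qv t : D t -> q ^~ t @ \oo --> v t.
  move=> Dt; have /andP[ct td] := DI _ Dt.
  have := dv _ Dt => -[dy dyE].
  have H1 : h^-1 *: (y (h *: 1 + t) - y t) @[h --> 0^'] --> v t.
    by rewrite -dyE; exact: dy.
  have /cvg_at_rightP/(_ (fun m => m.+1%:R^-1)) H2 := cvg_dnbhs_at_right H1.
  have n0 n : 0 < n.+1%:R^-1 :> R by rewrite invr_gt0 ltr0n.
  have {}H2 := H2 (conj n0 cvg_harmonic).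
  apply: cvg_trans H2; apply: near_eq_cvg; near=> m.
  rewrite /= invrK -[_ *: 1]/(_ * 1) mulr1 -[_ *: _]/(_ * _) /q /Y.
  have tm : t + m.+1%:R^-1 <= d.
    rewrite -lerBrDl ltW//; near: m.
    have dt0 : 0 < d - t by rewrite subr_gt0.
    exact: (near_infty_natSinv_lt (PosNum dt0)).
  rewrite clamp_id; last by rewrite tm andbT (le_trans (ltW ct))// lerDl invr_ge0.
  by rewrite clamp_id ?(ltW ct) ?(ltW td)// [_^-1 + t]addrC.
have vK t : D t -> `|v t| <= K.
  move=> Dt; have := qv _ Dt => /cvg_norm cn.
  by rewrite -(cvg_lim _ cn)//; apply: limr_le; [exact: cvgP cn|near=> m; exact: qK].
pose v' := v \_ D.
have v'K t : `|v' t| <= K.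
  by rewrite /v' patchE; case: ifPn => [/set_mem/vK//|_]; rewrite normr0.
have mv' : measurable_fun [set: R] v'.
  apply/(measurable_restrictT _ mD); apply: (measurable_fun_cvg _ qv) => m.
  exact: measurable_funTS.
have iv' : mu.-integrable `[c, d] (EFin \o v').
  apply: measurable_bounded_integrable => //.
  - by change (cmu `[c, d]%classic < +oo)%E; rewrite completed_itv ?ltry// ltW.
  - exact: measurable_funTS.
  - exists K; split; first exact: num_real.
    by move=> M KM t _; exact: (le_trans (v'K t) (ltW KM)).
have civ' := integrable_cara (measurable_itv _) iv'.
have mI : measurable (`[c, d]%classic : set cara).
  exact: (borel_cara (measurable_itv `[c, d])).
have ncd r : mu.-negligible [set r].
  by exists [set r]; split => //; exact: lebesgue_measure_set1.
(* v' vanishes off D, which misses only null sets of [c, d]: N and the endpoints. *)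
have aeN : {ae mu, forall t, t \in `[c, d] -> v' t = v t}.
  apply: (@negligibleS _ _ _ _ (N `|` [set c] `|` [set d])).
    move=> t /= H'; apply: contrapT => nN; apply: H'.
    rewrite in_itv/= => /andP[ct td]; rewrite /v' patchE mem_set//.
    split; last by move=> Nt; apply: nN; left; left.
    rewrite /= in_itv/= !lt_neqAle ct td !andbT; apply/andP; split; apply/eqP.
      by move=> ctE; apply: nN; left; right.
    by move=> tdE; apply: nN; right.
  apply: negligibleU => //; apply: negligibleU => //.
  by exists N; split.
have aev E : E `<=` `[c, d] -> ae_eq cmu E (EFin \o v') (EFin \o v).
  move=> EI; apply: negligible_cara; apply: negligibleS aeN => t /= H' H2.
  by apply: H' => /EI/= /H2 ->.
have mv : measurable_fun (`[c, d] : set cara) (EFin \o v).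
  apply: (ae_measurable_fun (@completed_lebesgue_measure_is_complete R) (aev _ (@subset_refl _ _))).
  by move/integrableP : civ' => [].
have IE : \int[cmu]_(s in `[c, d]) v s = \int[cmu]_(s in `[c, d]) v' s.
  congr fine; apply: ae_eq_integral; [exact: mI|exact: mv| |].
    by move/integrableP : civ' => [].
  by symmetry; exact: aev.
have iv : cmu.-integrable `[c, d] (EFin \o v).
  apply/integrableP; split => //.
  move/integrableP : civ' => [mv2]; congr (_ < _)%E.
  apply: ge0_ae_eq_integral.
  - exact: mI.
  - exact: measurableT_comp.
  - exact: measurableT_comp.
  - by move=> x _; exact: abse_ge0.
  - by move=> x _; exact: abse_ge0.
  - by apply: ae_eq_abse; exact: aev.
split => //.
pose V t := \int[cmu]_(s in `[c, t]) v' s.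
have iv'S r s : c <= r -> s <= d -> cmu.-integrable `[r, s] (EFin \o v').
  move=> cr sd; have mI2 : measurable (`[r, s]%classic : set cara).
    exact: (borel_cara (measurable_itv `[r, s])).
  apply: integrableS civ' => //.
  by apply: subset_itv; rewrite bnd_simp.
have VV : is_primitive `[c, d] v' V.
  move=> r s; rewrite /= !in_itv/= => /andP[cr rd] /andP[cs sd] rs.
  split; first exact: iv'S.
  apply: completed_Rintegral_itvD => //; exact: iv'S.
have HV : lip_primitive c d v' V by apply: (is_primitive_lip cd VV).
have HV' : lip_primitive c d v V.
  case: HV => [VL dV]; split => //.
  apply: filterS2 dV aeN => t dV vt /[dup] /andP[ct td] /dV.
  by rewrite vt// in_itv/= !ltW.
have := lip_primitive_unique (ltW cd) H HV' (t := d).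
rewrite lexx ltW// => /(_ isT).
have V0 : V c = 0.
  have := completed_Rintegral_itvD (lexx c) (lexx c) (iv'S _ _ (lexx c) (ltW cd)).
  by rewrite -/(V c); clear; lra.
by rewrite V0 subr0 IE -/(V d); clear; lra.
Unshelve. all: by end_near. Qed.

Lemma primitive_exists (v : R -> R) :
  (forall a b, cmu.-integrable `[a, b] (EFin \o v)) ->
  exists V : R -> R, V 0 = 0 /\ is_primitive setT v V.
Proof.
move=> iv.
pose I a b := \int[cmu]_(s in `[a, b]) v s.
have ID a b c : a <= b -> b <= c -> I a c = I a b + I b c.
  by move=> ab bc; exact: completed_Rintegral_itvD.
have I0 a : I a a = 0 by have := ID _ _ _ (lexx a) (lexx a); lra.
have Ige a b : b < a -> I a b = 0.
  by move=> ba; rewrite /I set_itv_ge ?Rintegral_set0// bnd_simp -ltNge.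
exists (fun t => I 0 t - I t 0); split; first by rewrite subrr.
move=> a b _ _ ab; split; first exact: iv.
rewrite -/(I a b).
have [a0|a0] := leP 0 a.
  have b0 := le_trans a0 ab.
  have E c : 0 <= c -> I c 0 = 0.
    by rewrite le_eqVlt => /predU1P[<-//|/Ige].
  by rewrite !E// (ID 0 a b)//; ring.
have [b0|b0] := leP 0 b.
  rewrite (Ige 0 a)// (ID a 0 b) ?(ltW a0)//.
  have -> : I b 0 = 0 by move: b0; rewrite le_eqVlt => /predU1P[<-//|/Ige].
  ring.
by rewrite !(Ige 0)// (ID a b 0) ?(ltW b0)//; ring.
Qed.

End LipPrimitiveIntegral.

(** * Translating a path out of a null set *)

Section NullSets.
Context {R : realType}.
Local Notation mu := (@lebesgue_measure R).

(** One coordinate of the Fubini argument. The S k are the times at which the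
    coordinates treated before lie in the k-th box, [al k, be k] is the side of that
    box in the present coordinate xi, and c k is the volume of the remaining sides.
    Averaged over eta in [0, rho], the time that xi + eta spends in [al k, be k] is
    at most (be k - al k) / rho times the measure of S k. The weighted sum thus has
    mean at most M / rho, and cannot exceed twice this bound for all eta. *)
Lemma shift_coordinate (S : nat -> set R) (c al be : nat -> R) (xi : R -> R)
    (rho M : R) :
  0 < rho -> 0 < M -> measurable_fun [set: R] xi ->
  (forall k, measurable (S k)) -> (forall k, 0 <= c k) ->
  (forall k, al k <= be k) ->
  (\sum_(0 <= k <oo) ((c k * (be k - al k))%:E * mu (S k)) <= M%:E)%E ->
  exists2 eta, 0 <= eta <= rho &
  (\sum_(0 <= k <oo) ((c k)%:E *
     mu (S k `&` [set s | (al k <= xi s + eta <= be k)%R])) <= (2 * M / rho)%:E)%E.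
Proof.
move=> rho0 M0 mxi mS c0 albe sumM; apply: contrapT => noeta.
pose A k : set (measurableTypeR R * measurableTypeR R) :=
  [set z | 0 <= z.1 <= rho /\ S k z.2 /\ al k <= xi z.2 + z.1 <= be k].
have mA k : measurable (A k).
  have -> : A k = (fst @^-1` `[0, rho]%classic) `&` ((snd @^-1` S k) `&`
      ((fun z => xi z.2 + z.1) @^-1` `[al k, be k]%classic)).
    by apply/seteqP; split => z /=; rewrite /A/= !in_itv.
  apply: measurableI; last apply: measurableI.
  - by rewrite -[X in measurable X]setTI; exact: (measurable_fst measurableT _ (measurable_itv `[0, rho])).
  - by rewrite -[X in measurable X]setTI; exact: (measurable_snd measurableT _ (mS k)).
  - rewrite -[X in measurable X]setTI.
    have mf : measurable_fun [set: measurableTypeR R * measurableTypeR R]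
        ((fun z => xi z.2 + z.1) : _ -> R).
      apply: measurable_funD; last exact: measurable_fst.
      exact: (measurableT_comp mxi measurable_snd).
    exact: (mf measurableT _ (measurable_itv `[al k, be k])).
have mind E : measurable E ->
    measurable_fun [set: measurableTypeR R] (fun s => (\1_E s)%:E : \bar R).
  move=> mE; apply/measurable_EFinP; exact: (@measurable_indic _ (measurableTypeR R) R setT E mE).
pose F k eta := mu (xsection (A k) eta).
have mF k : measurable_fun [set: measurableTypeR R] (F k).
  exact: (measurable_fun_xsection mu (mA k)).
have FE k eta : 0 <= eta <= rho ->
    F k eta = mu (S k `&` [set s | (al k <= xi s + eta <= be k)%R]).
  move=> eta_rho; rewrite /F; congr mu; apply/seteqP; split => s.
    by rewrite /xsection/= => /set_mem[_ []].
  by move=> [Sks /= ?]; rewrite /xsection/=; apply/mem_set.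
(* For fixed s the set of admissible eta is an interval of length be k - al k. *)
have intF k : (\int[mu]_eta F k eta <= (be k - al k)%:E * mu (S k))%E.
  have -> : (\int[mu]_eta F k eta = \int[mu]_s mu (ysection (A k) s))%E.
    have := indic_fubini_tonelli mu mu (mA k).
    have -> := indic_fubini_tonelli_GE mu (mA k).
    by have -> := indic_fubini_tonelli_FE mu (mA k).
  have -> : mu (S k) = (\int[mu]_s (\1_(S k) s)%:E)%E.
    by rewrite integral_indic// ?setIT//; exact: mS.
  rewrite -ge0_integralZl//=; last 2 first.
  - apply: mind; try exact: mS; try exact: measurable_itv.
  - by rewrite lee_fin subr_ge0.
  apply: ge0_le_integral => //.
  - exact: (measurable_fun_ysection mu (mA k)).
  - by apply: emeasurable_funM => //; apply: mind; try exact: mS; try exact: measurable_itv.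
  move=> s _; rewrite indicE; have [/set_mem Ss|nSs] := boolP (s \in S k).
    rewrite mule1; apply: (@le_trans _ _ (mu `[al k - xi s, be k - xi s])).
      apply: le_measure; rewrite ?inE.
      - exact: measurable_ysection.
      - exact: measurable_itv.
      - move=> eta; rewrite /ysection/= => /set_mem[_ [_ /= /andP[? ?]]].
        by rewrite in_itv/=; apply/andP; split; lra.
    rewrite lebesgue_measure_itv/= lte_fin; case: ifPn => _.
      by rewrite -EFinB lee_fin; lra.
    by rewrite lee_fin subr_ge0.
  rewrite mule0 (_ : ysection _ _ = set0) ?measure0//.
  apply/seteqP; split => // eta; rewrite /ysection/= => /set_mem[_ [/= Ss _]].
  by move: nSs; rewrite mem_set.
have cF_ge0 k eta : (0 <= (c k)%:E * F k eta)%E by rewrite mule_ge0// lee_fin.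
have mcF k : measurable_fun [set: measurableTypeR R] (fun eta => (c k)%:E * F k eta)%E.
  by apply: emeasurable_funM => //; exact: measurable_cst.
pose G eta := (\sum_(0 <= k <oo) ((c k)%:E * F k eta))%E.
have intG : (\int[mu]_eta G eta <= M%:E)%E.
  rewrite integral_nneseries//.
  apply: le_trans sumM; apply: lee_nneseries => k _.
    by move=> *; apply: integral_ge0.
  rewrite ge0_integralZl//; last by rewrite lee_fin.
  by rewrite EFinM -muleA lee_pmul// ?lee_fin// integral_ge0.
have : (\int[mu]_eta ((2 * M / rho)%:E * (\1_(`[0, rho]) eta)%:E) <= \int[mu]_eta G eta)%E.
  apply: ge0_le_integral => //.
  - by move=> eta _; rewrite mule_ge0// lee_fin// divr_ge0// ?mulr_ge0// ltW.
  - by apply: emeasurable_funM => //; apply: mind; try exact: mS; try exact: measurable_itv.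
  - apply: ge0_emeasurable_sum => [k eta _ _|k _]; first exact: cF_ge0.
    exact: mcF.
  move=> eta _; rewrite indicE; have [/set_mem Ieta|] := boolP (eta \in _).
    rewrite mule1; rewrite leNgt; apply/negP => lt; apply: noeta.
    rewrite /= in_itv/= in Ieta; exists eta => //.
    apply: le_trans (ltW lt); rewrite le_eqVlt; apply/orP; left; apply/eqP.
    by apply: eq_eseriesr => k _; rewrite FE.
  rewrite mule0 => _; apply: nneseries_ge0 => k _ _.
  by rewrite mule_ge0// lee_fin.
rewrite ge0_integralZl//; last 2 first.
- by apply: mind; try exact: mS; try exact: measurable_itv.
- by rewrite lee_fin divr_ge0// ?mulr_ge0// ltW.
have -> : (\int[mu]_x (\1_(`[0, rho]) x)%:E = rho%:E)%E.
  rewrite (integral_indic mu measurableT (measurable_itv `[0, rho])) setIT.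
  by have := lebesgue_measure_itv `[0, rho]; rewrite /= lte_fin rho0 -EFinB subr0.
rewrite -EFinM.
rewrite divfK ?gt_eqF// => /le_trans/(_ intG); rewrite lee_fin; lra.
Qed.

(** A path spends little time in a suitable small translate of a null set. Cover the
    null set by boxes of small total volume e1 and choose the coordinates of the
    translation y one after the other. After m coordinates are fixed, S m y k is the
    set of times at which the first m coordinates of x + y lie in the k-th box, and
    c m k the volume of the box in the other coordinates. Every choice multiplies the
    weighted total time by at most q = 2 / rho, so e1 is taken to be
    e / (q^n (b - a)); when m = n the weights are 1. *)
Lemma null_translate n (Z : set 'rV[R]_n) (x : R -> 'rV[R]_n) (a b rho e : R) :
  lebesgue_null Z -> (forall i, measurable_fun [set: R] (fun s => x s 0 i)) ->
  a < b -> 0 < rho -> 0 < e ->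
  exists2 y : 'rV[R]_n, (forall i, 0 <= y 0 i <= rho) &
  exists E : set R, [/\ measurable E, (mu E <= e%:E)%E &
    forall s, a <= s <= b -> Z (x s + y) -> E s].
Proof.
move=> Z0 mx ab rho0 e0.
have ba0 : 0 < b - a by rewrite subr_gt0.
pose q := 2 / rho.
have q0 : 0 < q by rewrite divr_gt0.
pose e1 := e / (q ^+ n * (b - a)).
have e10 : 0 < e1 by rewrite divr_gt0// mulr_gt0// exprn_gt0.
have [al [be [albe Zcov sumvol]]] := Z0 _ e10.
pose S m (y : 'rV[R]_n) k := `[a, b]%classic `&`
  \bigcap_(i in [set i : 'I_n | (i < m)%N])
    [set s | al k 0 i <= x s 0 i + y 0 i <= be k 0 i].
have mS m y k : measurable (S m y k).
  apply: measurableI; first exact: measurable_itv.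
  apply: fin_bigcap_measurable => // i _.
  have mxi : measurable_fun [set: R] (fun s => x s 0 i + y 0 i).
    by apply: measurable_funD => //; exact: mx.
  have := mxi measurableT _ (measurable_itv `[al k 0 i, be k 0 i]).
  by rewrite setTI; congr measurable; apply/seteqP; split => s /=; rewrite in_itv.
pose c m k := \prod_(i < n | (m <= i)%N) (be k 0 i - al k 0 i).
have c0 m k : 0 <= c m k.
  by apply: prodr_ge0 => i _; rewrite subr_ge0.
have step m : (m <= n)%N -> exists2 y : 'rV[R]_n, (forall i, 0 <= y 0 i <= rho) &
    (\sum_(0 <= k <oo) ((c m k)%:E * mu (S m y k)) <= (q ^+ m * (e1 * (b - a)))%:E)%E.
  elim: m => [_|m IH mn].
    exists 0; first by move=> i; rewrite mxE lexx ltW.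
    have muab : mu `[a, b] = (b - a)%:E.
      by rewrite lebesgue_measure_itv/= lte_fin ab EFinB.
    have muS k : (mu (S 0%N 0%R k) <= (b - a)%:E)%E.
      rewrite -muab; apply: le_measure; rewrite ?inE//.
      - exact: mS.
      - exact: subIsetl.
    rewrite expr0 mul1r EFinM.
    apply: (@le_trans _ _ (\sum_(0 <= k <oo) ((c 0%N k)%:E * (b - a)%:E))%E).
      apply: lee_nneseries => k _; first by move=> *; rewrite mule_ge0// lee_fin.
      by rewrite lee_pmul// lee_fin.
    under eq_eseriesr do rewrite muleC.
    rewrite nneseriesZl; last by move=> k _; rewrite lee_fin.
    by rewrite muleC lee_pmul2r// lte_fin.
  have [y yrho sumy] := IH (ltnW mn).
  pose i0 := Ordinal mn.
  have cE k : c m k = c m.+1 k * (be k 0 i0 - al k 0 i0).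
    rewrite /c (bigD1 i0)//= mulrC; congr (_ * _).
    apply: eq_bigl => i; rewrite ltn_neqAle andbC; congr (_ && _).
    by rewrite eq_sym.
  have M0 : 0 < q ^+ m * (e1 * (b - a)) by rewrite mulr_gt0 ?exprn_gt0// mulr_gt0.
  have := @shift_coordinate (S m y) (c m.+1) (fun k => al k 0 i0) (fun k => be k 0 i0)
    (fun s => x s 0 i0) rho _ rho0 M0 (mx i0) (mS m y) (c0 m.+1) (fun k => albe k i0).
  case.
    by under eq_eseriesr do rewrite -cE.
  move=> eta eta_rho sume.
  exists (\row_i (if i == i0 then eta else y 0 i)).
    by move=> i; rewrite mxE; case: ifP.
  have -> : q ^+ m.+1 * (e1 * (b - a)) = 2 * (q ^+ m * (e1 * (b - a))) / rho.
    by rewrite exprS /q; ring.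
  apply: le_trans sume; apply: lee_nneseries => k _.
    by move=> *; rewrite mule_ge0// lee_fin.
  rewrite lee_pmul ?lee_fin//; apply: le_measure; rewrite ?inE.
  - exact: mS.
  - have := mS m.+1 (\row_i (if i == i0 then eta else y 0 i)) k.
    congr measurable; apply/seteqP; split => s.
      move=> [Is Hs]; split.
        split => // i /= im; have := Hs i; rewrite /= mxE.
        rewrite ifN; first by apply; exact: ltnW.
        by apply/eqP => ii; move: im; rewrite ii/= ltnn.
      by have /= := Hs i0 (ltnSn _); rewrite mxE eqxx.
    move=> [[Is Hs] /= H0]; split => // i /=; rewrite ltnS leq_eqVlt mxE.
    case: ifPn => [/eqP -> //|ii /predU1P[im|im]].
      by move: ii; rewrite -val_eqE/= im eqxx.
    exact: Hs.
  - move=> s [Is Hs]; split.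
      split => // i /= im; have := Hs i; rewrite /= mxE.
      rewrite ifN; first by apply; exact: ltnW.
      by apply/eqP => ii; move: im; rewrite ii/= ltnn.
    by have /= := Hs i0 (ltnSn _); rewrite mxE eqxx.
have [y yrho sumy] := step n (leqnn n).
exists y => //; exists (\bigcup_k S n y k); split.
- by apply: bigcupT_measurable => k; exact: mS.
- apply: le_trans (_ : (\sum_(0 <= k <oo) mu (S n y k) <= e%:E)%E).
    have mU : measurable (\bigcup_k S n y k).
      by apply: bigcupT_measurable => k; exact: mS.
    exact: (measure_sigma_subadditive mu (fun k => mS n y k) mU).
  move: sumy.
  have -> : q ^+ n * (e1 * (b - a)) = e.
    by rewrite /e1; field; rewrite !gt_eqF// exprn_gt0.
  under eq_eseriesr => k _.
    rewrite (_ : c n k = 1) ?mul1e; last first.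
      by rewrite /c big_pred0// => i; rewrite leqNgt ltn_ord.
    over.
  by [].
- move=> s sI /Zcov[k _ /= Hk]; exists k => //; split; first by rewrite /= in_itv.
  by move=> i _ /=; have := Hk i; rewrite mxE.
Qed.

Lemma lebesgue_nullU n (A B : set 'rV[R]_n) :
  lebesgue_null A -> lebesgue_null B -> lebesgue_null (A `|` B).
Proof.
move=> A0 B0 e e0.
have e20 : 0 < e / 2 by rewrite divr_gt0.
have [a1 [b1 [ab1 A1 s1]]] := A0 _ e20.
have [a2 [b2 [ab2 B2 s2]]] := B0 _ e20.
pose mix (u v : nat -> 'rV[R]_n) k := if odd k then v k./2 else u k./2.
exists (mix a1 a2), (mix b1 b2); split.
- by move=> k i; rewrite /mix; case: ifP.
- move=> x [/A1[k _ Hk]|/B2[k _ Hk]].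
    by exists k.*2 => //=; rewrite /mix odd_double doubleK.
  by exists k.*2.+1 => //=; rewrite /mix/= odd_double/= uphalf_double.
pose vol (u v : nat -> 'rV[R]_n) k := (\prod_(i < n) (v k 0 i - u k 0 i))%:E : \bar R.
have vol0 (u v : nat -> 'rV[R]_n) k : (forall k i, u k 0 i <= v k 0 i) -> (0 <= vol u v k)%E.
  by move=> uv; rewrite lee_fin prodr_ge0// => i _; rewrite subr_ge0.
have mixab k i : mix a1 a2 k 0 i <= mix b1 b2 k 0 i.
  by rewrite /mix; case: ifP.
apply: lime_le.
  by apply: is_cvg_nneseries => k _ _; exact: vol0.
apply: nearW => N.
have part (u v : nat -> 'rV[R]_n) M r : (forall k i, u k 0 i <= v k 0 i) ->
    (\sum_(0 <= k <oo) vol u v k <= r)%E -> (\sum_(0 <= k < M) vol u v k <= r)%E.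
  move=> uv; apply: le_trans; apply: nneseries_lim_ge => k _ _; exact: vol0.
apply: (@le_trans _ _ (\sum_(0 <= k < N.*2) vol (mix a1 a2) (mix b1 b2) k)%E).
  rewrite (@big_cat_nat _ _ _ N 0 N.*2)//=; last by rewrite -addnn leq_addr.
  by rewrite leeDl// sume_ge0// => k _; exact: vol0.
have -> : (\sum_(0 <= k < N.*2) vol (mix a1 a2) (mix b1 b2) k =
   \sum_(0 <= k < N) vol a1 b1 k + \sum_(0 <= k < N) vol a2 b2 k)%E.
  elim: N => [|N IH]; first by rewrite !big_geq// adde0.
  rewrite doubleS !big_nat_recr//= IH /vol /mix/= odd_double/= doubleK uphalf_double.
  by rewrite -addeA addeACA; congr (_ + _)%E; rewrite addeA.
rewrite [e]splitr EFinD leeD//; exact: part.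
Qed.

End NullSets.

(** * Maximum norm and Euclidean norm of row vectors *)

Section RowNorms.
Context {R : realType} {n : nat}.
Implicit Types x : 'rV[R]_n.

Lemma row_norm_ge x i : `|x 0 i| <= `|x|.
Proof.
rewrite /Num.Def.normr/= mx_normrE.
by apply: le_trans (le_bigmax _ _ (0, i)) => /=.
Qed.

Lemma row_norm_le x (r : R) : 0 <= r -> (forall i, `|x 0 i| <= r) -> `|x| <= r.
Proof.
move=> r0 xr; rewrite /Num.Def.normr/= mx_normrE.
by apply/bigmax_leP; split => //= -[i j] _ /=; rewrite ord1.
Qed.

Lemma norm_le_enorm x : `|x| <= enorm x.
Proof.
apply: row_norm_le => [|i]; first exact: sqrtr_ge0.
rewrite -sqrtr_sqr ler_wsqrtr// (bigD1 i)//= lerDl.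
by apply: sumr_ge0 => j _; exact: sqr_ge0.
Qed.

Lemma enorm_le_norm x : enorm x <= Num.sqrt n%:R * `|x|.
Proof.
have -> : Num.sqrt n%:R * `|x| = Num.sqrt (n%:R * `|x| ^+ 2).
  by rewrite sqrtrM ?ler0n// sqrtr_sqr normr_id.
rewrite ler_wsqrtr//.
have -> : n%:R * `|x| ^+ 2 = \sum_(i < n) `|x| ^+ 2.
  by rewrite sumr_const card_ord mulr_natl.
apply: ler_sum => i _; rewrite -[x 0 i ^+ 2]real_normK ?num_real//.
by rewrite ler_pXn2r ?nnegrE// row_norm_ge.
Qed.

Lemma continuous_coord (f : R -> 'rV[R]_n) k : continuous f ->
  continuous (fun t => f t 0 k).
Proof.
move=> cf t; apply: (@continuous_comp _ _ _ f (fun M : 'rV[R]_n => M 0 k)).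
  exact: cf.
exact: coord_continuous.
Qed.

End RowNorms.

(** * Lipschitz fields and their increments *)

Section Fields.
Context {R : realType} {n : nat}.
Local Notation mu := (@lebesgue_measure R).
Local Notation field := (R -> 'rV[R]_n -> 'rV[R]_n).
Implicit Types (g h : field).

(** The property required of regular fields, but for the maximum norm, which is the
    norm of the topology on row vectors. *)
Definition lipschitz_field (K : R) g : Prop :=
  [/\ (forall x, continuous (g^~ x)),
      (forall t x y, `|g t x - g t y| <= K * `|x - y|)
    & (forall t, g t 0 = 0)].

Lemma regular_lipschitz L g : 0 <= L -> regular_field L g ->
  lipschitz_field (L * Num.sqrt n%:R) g.
Proof.
move=> L0 [gc gL g0]; split => // t x y.
rewrite (le_trans (norm_le_enorm _))// (le_trans (gL _ _ _))//.
by rewrite -mulrA ler_wpM2l// enorm_le_norm.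
Qed.

Lemma lipschitz_field_norm K g t x : lipschitz_field K g -> `|g t x| <= K * `|x|.
Proof. by move=> [_ gL g0]; have := gL t x 0; rewrite g0 !subr0. Qed.

Lemma lipschitz_field_continuous K g (x : R -> 'rV[R]_n) : 0 <= K ->
  lipschitz_field K g -> continuous x -> continuous (fun t => g t (x t)).
Proof.
move=> K0 [gc gL _] xc t; apply/cvgrPdist_le => e e0.
have e20 : 0 < e / 2 by rewrite divr_gt0.
have eK0 : 0 < e / 2 / (K + 1) by rewrite divr_gt0// ltr_wpDl.
near=> s.
have -> : g t (x t) - g s (x s) = (g t (x t) - g s (x t)) + (g s (x t) - g s (x s)).
  by rewrite addrA subrK.
rewrite (le_trans (ler_normD _ _))// [e]splitr lerD//.
  near: s; apply: cvgr_dist_le; last by [].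
  exact: (gc (x t)).
rewrite (le_trans (gL _ _ _))//.
have : `|x t - x s| <= e / 2 / (K + 1).
  by near: s; apply: cvgr_dist_le => //; exact: xc.
move=> /(ler_wpM2l K0)/le_trans; apply.
by rewrite mulrA ler_pdivrMr ?ltr_wpDl// mulrC ler_pM2l// lerDl.
Unshelve. all: by end_near. Qed.

Lemma is_derive_near_dir (V W : normedModType R) (z v : V) (g : V -> W) (d : W) :
  is_derive z v g d -> forall eta : R, 0 < eta ->
  \forall h \near 0^'+, `|g (h *: v + z) - g z - h *: d| <= eta * h.
Proof.
move=> [dg dgv] eta eta0.
have H : h^-1 *: (g (h *: v + z) - g z) @[h --> 0^'] --> d.
  by rewrite -dgv; exact: dg.
have /cvgrPdist_le/(_ _ eta0) {}H := cvg_dnbhs_at_right H.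
near=> h.
have h0 : 0 < h by near: h; exact: nbhs_right_gt.
have le : `|d - h^-1 *: (g (h *: v + z) - g z)| <= eta by near: h.
have -> : g (h *: v + z) - g z - h *: d = - (h *: (d - h^-1 *: (g (h *: v + z) - g z))).
  by rewrite scalerBr scalerA divff ?gt_eqF// scale1r opprB.
by rewrite normrN normrZ (gtr0_norm h0) [leRHS]mulrC ler_pM2l.
Unshelve. all: by end_near. Qed.

(** Take a constant path in [null_translate]: it cannot spend time 1 in the null set
    if the bound on that time is 1/2. *)
Lemma almost_every_dense (P : set 'rV[R]_n) (x : 'rV[R]_n) (rho : R) :
  almost_every P -> 0 < rho -> exists2 y, P (x + y) & `|y| <= rho.
Proof.
move=> aeP rho0.
have e0 : 0 < (1 / 2 : R) by rewrite divr_gt0.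
have [y yrho [E [mE Ee EZ]]] := null_translate (x := fun=> x) aeP
  (fun i => measurable_cst _) (@ltr01 R) rho0 e0.
exists y; last first.
  apply: row_norm_le => [|i]; first exact: ltW.
  by have /andP[y0 yr] := yrho i; rewrite ger0_norm.
apply: contrapT => nP.
have : (mu `[0%R, 1%R] <= mu E)%E.
  apply: le_measure; rewrite ?inE//.
  by move=> s; rewrite /= in_itv/= => s01; exact: (EZ s).
rewrite lebesgue_measure_itv/= lte_fin ltr01 sube0 => /le_trans/(_ Ee).
by rewrite lee_fin; lra.
Qed.

(** Mean value inequality in time, at every x, although the time derivative is known
    only at almost every x: it holds at points x + y arbitrarily close to x, and both
    fields are continuous in x. *)
Lemma partial1_increment K g g1 (x q : 'rV[R]_n) (s t eta : R) :
  0 <= K -> lipschitz_field K g -> lipschitz_field K g1 -> is_partial1 g g1 ->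
  s <= t -> (forall r, s <= r <= t -> `|g1 r x - q| <= eta) ->
  `|g t x - g s x - (t - s) *: q| <= eta * (t - s).
Proof.
move=> K0 [gc gL _] [g1c g1L _] dg st g1q.
have eta0 : 0 <= eta by apply: le_trans (g1q s _); rewrite ?lexx ?st.
have ts0 : 0 <= t - s by rewrite subr_ge0.
apply/ler_addgt0Pr => d d0.
pose C := K * (t - s) + 2 * K.
have C0 : 0 <= C by rewrite addr_ge0 ?mulr_ge0.
have rho0 : 0 < d / (C + 1) by rewrite divr_gt0// ltr_wpDl.
have rhoC : d / (C + 1) * C <= d.
  by rewrite mulrAC ler_pdivrMr ?ltr_wpDl// ler_pM2l// lerDl.
have [y dgz yrho] := almost_every_dense x dg rho0.
set z := x + y in dgz.
have zx : `|z - x| <= d / (C + 1) by rewrite /z addrC addKr.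
have H : `|g t z - g s z - (t - s) *: q| <= (eta + K * (d / (C + 1))) * (t - s).
  have e0 : 0 <= eta + K * (d / (C + 1)) by rewrite addr_ge0// mulr_ge0// ltW.
  apply: row_norm_le => [|k]; first by rewrite mulr_ge0.
  move: st; rewrite le_eqVlt => /predU1P[<-|st].
    by rewrite !subrr scale0r subrr mxE normr0 mulr0.
  have dk r : is_derive r (1 : R) (fun r => g r z 0 k) (g1 r z 0 k).
    have [/derivable_mxP dgr dE] := dgz r.
    have := derivableP (dgr 0 k).
    by rewrite -dE derive_mx ?mxE//; apply/derivable_mxP.
  have [|c cI cE] := @MVT R (fun r => g r z 0 k) (fun r => g1 r z 0 k) s t st (fun r _ => dk r).
    apply: continuous_subspaceT => r.
    have [dr _] := dk r.
    by apply: differentiable_continuous; exact/derivable1_diffP.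
  have -> : (g t z - g s z - (t - s) *: q) 0 k = (g1 c z - q) 0 k * (t - s).
    by rewrite !mxE/= cE; ring.
  rewrite normrM (ger0_norm ts0) ler_wpM2r//.
  rewrite (le_trans (row_norm_ge _ _))//.
  have -> : g1 c z - q = (g1 c x - q) + (g1 c z - g1 c x) by rewrite [RHS]addrC addrA subrK.
  rewrite (le_trans (ler_normD _ _))// lerD ?g1q//.
    by move: cI; rewrite in_itv/= => /andP[? ?]; rewrite !ltW.
  by rewrite (le_trans (g1L _ _ _))// ler_wpM2l.
have -> : g t x - g s x - (t - s) *: q =
   (g t z - g s z - (t - s) *: q) + (g s z - g s x) - (g t z - g t x).
  by apply/rowP => k; rewrite !mxE; ring.
rewrite (le_trans (ler_normB _ _))//.
have b1 : `|g s z - g s x| <= K * (d / (C + 1)).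
  by rewrite (le_trans (gL _ _ _))// ler_wpM2l.
have b2 : `|g t z - g t x| <= K * (d / (C + 1)).
  by rewrite (le_trans (gL _ _ _))// ler_wpM2l.
have := ler_normD (g t z - g s z - (t - s) *: q) (g s z - g s x).
have : d / (C + 1) * (K * (t - s) + 2 * K) <= d by exact: rhoC.
move: H b1 b2; set u := d / _.
by nra.
Qed.

End Fields.

(** * Chain rule along trajectories *)

Section ChainRule.
#[local] Existing Instance lebesgue_ae_filter.
Context {R : realType} {n : nat}.
Local Notation mu := (@lebesgue_measure R).
Local Notation cmu := (@completed_lebesgue_measure R).
Local Notation cara := (caratheodory_type (@wlength R idfun)^*%mu).
Local Notation field := (R -> 'rV[R]_n -> 'rV[R]_n).

Lemma lip_primitive_exists (a b M : R) (v : R -> R) : a < b ->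
  measurable_fun (`[a, b] : set cara) (v : cara -> R) ->
  (forall t, a <= t <= b -> `|v t| <= M) -> exists V, lip_primitive a b v V.
Proof.
move=> ab mv vM.
have mI c d : measurable (`[c, d]%classic : set cara).
  exact: (borel_cara (measurable_itv `[c, d])).
have iv : cmu.-integrable `[a, b] (EFin \o v).
  apply: measurable_bounded_integrable => //.
    by rewrite [X in (X < _)%E](_ : _ = (b - a)%:E) ?ltry//; exact: completed_itv (ltW ab).
  exists M; split; first exact: num_real.
  move=> M' MM' t /=; rewrite in_itv/= => tI.
  exact: le_trans (vM _ tI) (ltW MM').
pose V t := \int[cmu]_(s in `[a, t]) v s.
exists V; apply: (is_primitive_lip ab _ vM).
have ivS r s : a <= r -> s <= b -> cmu.-integrable `[r, s] (EFin \o v).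
  move=> ar sb; apply: integrableS iv => //.
  by apply: subset_itv; rewrite bnd_simp.
move=> r s; rewrite /= !in_itv/= => /andP[ar rb] /andP[as_ sb] rs.
split; first exact: ivS.
by apply: completed_Rintegral_itvD => //; exact: ivS.
Qed.

Lemma lip_primitive_measurable (a b : R) v y : a <= b -> lip_primitive a b v y ->
  measurable_fun (`[a, b] : set cara) (v : cara -> R).
Proof.
move=> ab /lip_primitive_is_primitive yv.
have [] : _ /\ _ := yv a b _ _ ab; rewrite /= ?in_itv/= ?lexx ?ab//.
by move=> /integrableP[/measurable_EFinP].
Qed.

Lemma lip_primitive_row (a b : R) (v x : R -> 'rV[R]_n) :
  (forall k, lip_primitive a b (fun t => v t 0 k) (fun t => x t 0 k)) ->
  exists2 K, 0 <= K &
    forall s t, a <= s <= b -> a <= t <= b -> `|x s - x t| <= K * `|s - t|.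
Proof.
move=> Hx.
have /choice[K HK] : forall k, exists K, 0 <= K /\ forall s t, a <= s <= b ->
    a <= t <= b -> `|x s 0 k - x t 0 k| <= K * `|s - t|.
  by move=> k; have [K K0 xK] := lip_primitive_lip (Hx k); exists K.
have K0 k : 0 <= K k by have [] := HK k.
exists (\sum_k K k); first by apply: sumr_ge0.
move=> s t sI tI; apply: row_norm_le => [|k].
  by rewrite mulr_ge0// sumr_ge0.
have [_ /(_ _ _ sI tI)] := HK k; rewrite !mxE => /le_trans; apply.
by rewrite ler_wpM2r// (bigD1 k)//= lerDl sumr_ge0.
Qed.

Lemma lebesgue_null_bigU (I : finType) (A : I -> set 'rV[R]_n) (B : set 'rV[R]_n) :
  lebesgue_null B -> (forall i, lebesgue_null (A i)) ->
  lebesgue_null (B `|` [set x | exists i, A i x]).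
Proof.
move=> B0 A0.
have : lebesgue_null (B `|` [set x | exists2 i, i \in enum I & A i x]).
  elim: (enum I) => [|i s IH].
    by rewrite (_ : [set x | _] = set0) ?setU0// -subset0 => x [].
  have := lebesgue_nullU IH (A0 i); congr lebesgue_null; apply/seteqP; split => x.
    move=> [[Bx|[j js Aj]]|Ai]; [by left|right; exists j|right; exists i] => //.
      by rewrite inE js orbT.
    by rewrite inE eqxx.
  move=> [Bx|[j]]; first by left; left.
  by rewrite inE => /predU1P[->|js] Aj; [right|left; right; exists j].
congr lebesgue_null; congr setU; apply/seteqP; split => x [i].
  by exists i.
by move=> Ai; exists i => //; rewrite mem_enum.
Qed.

Lemma near_right_row (x : R -> 'rV[R]_n) (t : R) (v : 'rV[R]_n) :
  (forall k, is_derive t (1 : R) (fun s => x s 0 k) (v 0 k)) ->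
  forall eta : R, 0 < eta ->
  \forall h \near 0^'+, `|x (t + h) - x t - h *: v| <= eta * h.
Proof.
move=> dx eta eta0.
have : \forall h \near 0^'+, forall k, `|x (t + h) 0 k - x t 0 k - h * v 0 k| <= eta * h.
  apply: filter_forall => k; exact: (is_derive_near (dx k) eta0).
move=> H; near=> h.
have h0 : 0 < h by near: h; exact: nbhs_right_gt.
apply: row_norm_le => [|k]; first by rewrite mulr_ge0// ltW.
by rewrite !mxE; move: k; near: h.
Unshelve. all: by end_near. Qed.

Lemma sum_norm_le (I : finType) (F : I -> R) (M : R) :
  (forall i, `|F i| <= M) -> `|\sum_i F i| <= #|I|%:R * M.
Proof.
move=> FM; rewrite (le_trans (ler_norm_sum _ _ _))//.
rewrite (le_trans (ler_sum _ (fun i _ => FM i)))//.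
by rewrite sumr_const mulr_natl.
Qed.

(** The derivative of g along a trajectory of x' = sum_i c_i h_i(t, x) is the expected
    one, even if the trajectory lies in the null set where g is not differentiable.
    Let V be a primitive of the expected derivative v, and set
    D y t = g t (x t + y) - V t for a small translation y given by [null_translate].
    Outside a set of times of measure e, the derivative of D y is the difference of
    the expected derivatives at x t + y and at x t, which is O(|y|) because all
    these fields are Lipschitz; on the bad times D y still has slope at most Lam.
    Hence D y is constant up to O(|y|) + Lam e by [ae_gronwall], and letting y and e
    tend to 0, D 0 is constant. *)
Lemma chain_rule (I : finType) (K M a b : R) (g g1 : field) (h Lhg : I -> field)
    (c C : I -> R -> R) (x : R -> 'rV[R]_n) :
  0 <= K -> 0 <= M -> a < b ->
  lipschitz_field K g -> lipschitz_field K g1 ->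
  (forall i, lipschitz_field K (h i)) -> (forall i, lipschitz_field K (Lhg i)) ->
  is_partial1 g g1 -> (forall i, is_lie_derivative (h i) g (Lhg i)) ->
  (forall i, lip_primitive a b (c i) (C i)) ->
  (forall i t, a <= t <= b -> `|c i t| <= M) ->
  (forall k, lip_primitive a b (fun t => \sum_i c i t * h i t (x t) 0 k)
     (fun t => x t 0 k)) ->
  forall k, lip_primitive a b
    (fun t => g1 t (x t) 0 k + \sum_i c i t * Lhg i t (x t) 0 k)
    (fun t => g t (x t) 0 k).
Proof.
move=> K0 M0 ab lg lg1 lh lL dg dL HC cM Hx k.
have ab' := ltW ab.
pose xd t : 'rV[R]_n := \row_k \sum_i c i t * h i t (x t) 0 k.
have Hx' : forall k, lip_primitive a b (fun t => xd t 0 k) (fun t => x t 0 k).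
  by move=> j; apply: eq_lip_primitive (Hx j) => // t _; rewrite mxE.
have [Kx Kx0 xK] := lip_primitive_row Hx'.
(* Extending the trajectory by its end values makes it continuous on the line. *)
pose X t := x (clamp a b t).
have XE t : a <= t <= b -> X t = x t by move=> tI; rewrite /X clamp_id.
have XK s t : `|X s - X t| <= Kx * `|s - t|.
  apply: (le_trans (xK _ _ (clamp_itv _ ab') (clamp_itv _ ab'))).
  by rewrite ler_wpM2l// clamp_lip.
have cX : continuous X by exact: lipschitz_continuous Kx0 XK.
have mX i : measurable_fun [set: R] (fun s => X s 0 i).
  by apply: continuous_measurable_fun; exact: continuous_coord cX.
pose Mx := `|x a| + Kx * (b - a).
have Mx0 : 0 <= Mx by rewrite addr_ge0// mulr_ge0// subr_ge0.
have XMx t : `|X t| <= Mx.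
  have tI := clamp_itv t ab'.
  have aI : a <= a <= b by rewrite lexx ab'.
  have -> : X t = x a + (X t - x a) by rewrite addrC subrK.
  rewrite (le_trans (ler_normD _ _))// lerD2l.
  apply: (le_trans (xK _ _ tI aI)); rewrite ler_wpM2l//.
  by case/andP: tI => ? ?; rewrite ger0_norm ?subr_ge0// lerD2r.
pose v t := g1 t (X t) 0 k + \sum_i c i t * Lhg i t (X t) 0 k.
have compM f t : lipschitz_field K f -> `|f t (X t) 0 k| <= K * Mx.
  move=> lf; rewrite (le_trans (row_norm_ge _ _))//.
  by rewrite (le_trans (lipschitz_field_norm _ _ lf))// ler_wpM2l.
have cmp f : lipschitz_field K f -> continuous (fun t => f t (X t) 0 k).
  by move=> lf; apply: (@continuous_coord _ _ (fun t => f t (X t))); exact: lipschitz_field_continuous lf cX.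
have mI : measurable (`[a, b]%classic : set cara).
  exact: (borel_cara (measurable_itv `[a, b])).
have mcomp f : lipschitz_field K f ->
    measurable_fun (`[a, b] : set cara) ((fun t => f t (X t) 0 k) : cara -> R).
  move=> lf; apply: (measurable_fun_cara (measurable_itv `[a, b])).
  by apply: measurable_funTS; apply: continuous_measurable_fun; exact: cmp.
have mv : measurable_fun (`[a, b] : set cara) (v : cara -> R).
  apply: measurable_funD; first exact: mcomp.
  apply: measurable_sum => i; apply: measurable_funM; last exact: mcomp.
  exact: lip_primitive_measurable (HC i).
have vM t : a <= t <= b -> `|v t| <= K * Mx + #|I|%:R * (M * (K * Mx)).
  move=> tI; rewrite (le_trans (ler_normD _ _))// lerD ?compM//.
  by apply: sum_norm_le => i; rewrite normrM ler_pM ?cM ?compM.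
have [V HV] := lip_primitive_exists ab mv vM.
suff main t1 : a <= t1 <= b -> g t1 (x t1) 0 k = V t1 + (g a (x a) 0 k - V a).
  have := lip_primitiveD HV (lip_primitive_cst a b (g a (x a) 0 k - V a)).
  apply: eq_lip_primitive => t tI; last by rewrite -main.
  by rewrite addr0 /v XE.
move=> t1I.
case/andP: (t1I); rewrite le_eqVlt => /predU1P[<- _|at1 t1b].
  by rewrite addrC subrK.
(* cst1 rho bounds the error caused by |y| <= rho in the derivative of D y, and Lam
   is a Lipschitz constant of D y: its three summands come from the time dependence
   of g, from the path, and from V. *)
pose cst1 := K + #|I|%:R * (M * K) * (K + 1).
have cst1_ge0 : 0 <= cst1.
  by rewrite addr_ge0// mulr_ge0 ?addr_ge0// mulr_ge0// mulr_ge0.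
have [KV KV0 VK] := lip_primitive_lip HV.
pose Lam := K * (Mx + 1) + K * Kx + KV.
have Lam0 : 0 <= Lam by rewrite /Lam !addr_ge0// mulr_ge0// addr_ge0.
pose D y t := g t (x t + y) 0 k - V t.
have key rho e : 0 < rho -> rho <= 1 -> 0 < e ->
    `|D 0 t1 - D 0 a| <= cst1 * rho * (t1 - a) + Lam * e + 2 * K * rho.
  move=> rho0 rho1 e0.
  have Znull := lebesgue_null_bigU dg dL.
  have [y yrho [E [mE Ee EZ]]] := null_translate Znull mX ab rho0 e0.
  have ynorm : `|y| <= rho.
    apply: row_norm_le => [|i]; first exact: ltW.
    by have /andP[y0 yr] := yrho i; rewrite ger0_norm.
  have aet : {ae mu, forall t, a < t < b ->
      (forall j, is_derive t (1 : R) (fun s => x s 0 j) (xd t 0 j)) /\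
      is_derive t (1 : R) V (v t)}.
    have aex : {ae mu, forall t, forall j, a < t < b ->
        is_derive t (1 : R) (fun s => x s 0 j) (xd t 0 j)}.
      by apply: filter_forall => j; have [] := Hx' j.
    by apply: filterS2 aex HV.2 => t H1 H2 tI; split; [move=> j; exact: H1|exact: H2].
  have [A [mA A0 subA]] := aet.
  pose E' := E `|` A.
  have mE' : measurable E' by exact: measurableU.
  have E'e : (mu E' <= e%:E)%E.
    apply: (le_trans (measureU2 mu mE mA)).
    by rewrite [X in (_ + X)%E](_ : _ = 0%E) ?adde0//; exact: A0.
  have cr0 : 0 <= cst1 * rho by rewrite mulr_ge0// ltW.
  have xt t : a <= t <= t1 -> a <= t <= b.
    by case/andP => -> /le_trans ->//; case/andP: t1I.
  pose N t := `|D y t - D y a|.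
  have lipN s t : a <= s -> s <= t -> t <= t1 -> N t - N s <= Lam * (t - s).
    move=> as_ st tt1.
    have tI : a <= t <= b by rewrite xt// tt1 (le_trans as_).
    have sI : a <= s <= b by rewrite xt// as_ (le_trans st).
    have ts0 : 0 <= t - s by rewrite subr_ge0.
    apply: (le_trans (ler_norm _)); apply: (le_trans (ler_dist_dist _ _)).
    have -> : D y t - D y a - (D y s - D y a) =
      (g t (x t + y) - g s (x t + y) - (t - s) *: 0) 0 k +
      (g s (x t + y) - g s (x s + y)) 0 k - (V t - V s).
      by rewrite /D !mxE; ring.
    have e1 : `|(g t (x t + y) - g s (x t + y) - (t - s) *: 0) 0 k| <= K * (Mx + 1) * (t - s).
      rewrite (le_trans (row_norm_ge _ _))//; apply: (partial1_increment K0 lg lg1 dg st).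
      move=> r _; rewrite subr0 (le_trans (lipschitz_field_norm _ _ lg1))// ler_wpM2l//.
      by rewrite (le_trans (ler_normD _ _))// lerD//; [rewrite -XE|exact: le_trans rho1].
    have e2 : `|(g s (x t + y) - g s (x s + y)) 0 k| <= K * Kx * (t - s).
      rewrite (le_trans (row_norm_ge _ _))//.
      have [_ gL _] := lg; rewrite (le_trans (gL _ _ _))//.
      rewrite opprD addrACA subrr addr0 -mulrA ler_wpM2l//.
      by rewrite (le_trans (xK _ _ tI sI))// ger0_norm.
    have e3 : `|V t - V s| <= KV * (t - s).
      by rewrite (le_trans (VK _ _ tI sI))// ger0_norm.
    rewrite (le_trans (ler_normB _ _))//.
    have := ler_normD ((g t (x t + y) - g s (x t + y) - (t - s) *: 0) 0 k)
      ((g s (x t + y) - g s (x s + y)) 0 k).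
    by rewrite /Lam !mulrDl; clear -e1 e2 e3; lra.
  have diniN t : a < t < t1 -> ~ E' t -> forall eta, 0 < eta ->
      \forall d \near 0^'+, N (t + d) <= N t + d * (0 * N t + cst1 * rho + eta).
    move=> tI nE' eta eta0.
    have atb : a < t < b by case/andP: tI => -> /lt_le_trans ->//; case/andP: t1I.
    have tI' : a <= t <= b by case/andP: atb => ? ?; rewrite !ltW.
    have [dxt dVt] : (forall j, is_derive t (1 : R) (fun s => x s 0 j) (xd t 0 j)) /\
        is_derive t (1 : R) V (v t).
      apply: contrapT => nd; apply: nE'; right; apply: subA => /= /(_ atb).
      exact: nd.
    set z := x t + y.
    have dgz i : differentiable (g t) z /\ Lhg i t z = 'd (g t) z (h i t z).
      apply: contrapT => nd; apply: nE'; left; apply: EZ => //; right; exists i => /=.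
      by rewrite XE// => /(_ t).
    pose xi := \sum_i c i t *: h i t z.
    pose Lxi := \sum_i c i t *: Lhg i t z.
    (* Differentiability of g t at z comes with each i; without any i the direction
       xi is 0. *)
    have dxi : is_derive z xi (g t) Lxi.
      have [i0 _|I0] := pickP (fun i : I => true).
        have [dg' _] := dgz i0.
        have := derivableP (@diff_derivable _ _ _ (g t) z xi dg').
        rewrite deriveE// /xi linear_sum/=; congr is_derive.
        by apply: eq_bigr => i _; rewrite linearZ/= (dgz i).2.
      rewrite /xi /Lxi !big_pred0//; exact: is_derive0.
    (* There are four errors of size eta1 d and one of size K eta1 d below, whence a
       fraction of eta with a margin. *)
    pose eta1 := eta / (K + 6).
    have K6 : 0 < K + 6 by rewrite ltr_wpDl.
    have eta10 : 0 < eta1 by rewrite divr_gt0.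
    have etaE : eta = eta1 * (K + 6) by rewrite /eta1 divfK// gt_eqF.
    have [_ gL _] := lg; have [g1c g1L _] := lg1.
    have g1near : \forall r \near t, `|g1 t z - g1 r z| <= eta1.
      by have /cvgrPdist_le := g1c z t; apply.
    have [r0 /= r00 g1r] := g1near.
    near=> d.
    have d0 : 0 < d by near: d; exact: nbhs_right_gt.
    have dr : d < r0 by near: d; exact: nbhs_right_lt.
    have dt1 : t + d <= b.
      have : d < b - t by near: d; apply: nbhs_right_lt; rewrite subr_gt0; case/andP: atb.
      by move=> ?; rewrite -lerBrDl ltW.
    have KKd : K * (Kx * d) <= eta1.
      have : d <= eta1 / (K * Kx + 1).
        near: d; apply: nbhs_right_le; rewrite divr_gt0// ltr_wpDl// mulr_ge0//.
      rewrite ler_pdivlMr ?ltr_wpDl ?mulr_ge0// => /(le_trans _); apply.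
      by rewrite mulrDr mulr1 mulrA [leLHS]mulrC lerDl ltW.
    have tdI : a <= t + d <= b.
      by rewrite dt1 andbT (le_trans (andP tI').1)// lerDl ltW.
    have dx : `|x (t + d) - x t - d *: xd t| <= eta1 * d.
      by near: d; exact: near_right_row.
    have dV : `|V (t + d) - V t - d * v t| <= eta1 * d.
      by near: d; exact: is_derive_near.
    have dgd : `|g t (d *: xi + z) - g t z - d *: Lxi| <= eta1 * d.
      by near: d; exact: is_derive_near_dir.
    pose w := x (t + d) + y.
    have xtd : `|x (t + d) - x t| <= Kx * d.
      by rewrite (le_trans (xK _ _ tdI tI'))// addrC addKr ger0_norm// ltW.
    have A4 : `|g (t + d) w - g t w - d *: g1 t z| <= (2 * eta1) * d.
      have ttd : t <= t + d by rewrite lerDl ltW.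
      have := @partial1_increment R n K g g1 w (g1 t z) t (t + d) (2 * eta1) K0 lg lg1 dg ttd.
      have -> : t + d - t = d by rewrite addrC addKr.
      apply.
      move=> r /andP[tr rd].
      have -> : g1 r w - g1 t z = (g1 r w - g1 r z) + (g1 r z - g1 t z).
        by rewrite addrA subrK.
      rewrite (le_trans (ler_normD _ _))// mulr2n mulrDl mul1r lerD//.
        rewrite (le_trans (g1L _ _ _))// (le_trans _ KKd)// ler_wpM2l//.
        by rewrite /w /z opprD addrACA subrr addr0.
      rewrite distrC; apply: g1r; rewrite /ball_/= distrC ger0_norm ?subr_ge0//.
      by rewrite (le_lt_trans _ dr)// lerBlDl.
    have hdiff i : `|h i t (x t) - h i t z| <= K * rho.
      have [_ hL _] := lh i; rewrite (le_trans (hL _ _ _))// ler_wpM2l//.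
      by rewrite /z opprD addrA subrr sub0r normrN.
    have Ldiff i : `|Lhg i t (x t) - Lhg i t z| <= K * rho.
      have [_ hL _] := lL i; rewrite (le_trans (hL _ _ _))// ler_wpM2l//.
      by rewrite /z opprD addrA subrr sub0r normrN.
    have xdxi : `|xd t - xi| <= #|I|%:R * (M * (K * rho)).
      have MK0 : 0 <= #|I|%:R * (M * (K * rho)).
        by rewrite !mulr_ge0// ltW.
      apply: row_norm_le => // j; rewrite /xi !mxE summxE -sumrB.
      apply: sum_norm_le => i; rewrite mxE -mulrBr normrM ler_pM ?cM//.
      by have := hdiff i; apply: le_trans; have := row_norm_ge (h i t (x t) - h i t z) j; rewrite !mxE.
    have A5 : `|g t w - g t (d *: xi + z)| <= K * (eta1 * d + d * (#|I|%:R * (M * (K * rho)))).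
      rewrite (le_trans (gL _ _ _))// ler_wpM2l//.
      have -> : w - (d *: xi + z) = (x (t + d) - x t - d *: xd t) + d *: (xd t - xi).
        by apply/rowP => j; rewrite /w /z !mxE; ring.
      rewrite (le_trans (ler_normD _ _))// lerD// normrZ gtr0_norm// ler_pM2l//.
    have vdiff : `|g1 t z 0 k + Lxi 0 k - v t| <= K * rho + #|I|%:R * (M * (K * rho)).
      have -> : g1 t z 0 k + Lxi 0 k - v t =
          (g1 t z - g1 t (x t)) 0 k + \sum_i c i t * (Lhg i t z - Lhg i t (x t)) 0 k.
        rewrite /v XE// /Lxi summxE !mxE.
        have -> : \sum_i c i t * (Lhg i t z - Lhg i t (x t)) 0 k =
          \sum_i (c i t *: Lhg i t z) 0 k - \sum_i c i t * Lhg i t (x t) 0 k.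
          by rewrite -sumrB; apply: eq_bigr => i _; rewrite !mxE; ring.
        by ring.
      rewrite (le_trans (ler_normD _ _))// lerD//.
        rewrite (le_trans (row_norm_ge _ _))// (le_trans (g1L _ _ _))// ler_wpM2l//.
        by rewrite /z addrC addKr.
      apply: sum_norm_le => i; rewrite normrM ler_pM ?cM//.
      by rewrite (le_trans (row_norm_ge _ _))// distrC.
    (* The increment of D y is telescoped through g t w, where w is the new position,
       and through the first order prediction d *: xi + z of w. *)
    have total : `|D y (t + d) - D y t| <= d * (cst1 * rho + eta).
      have -> : D y (t + d) - D y t =
         (g (t + d) w - g t w - d *: g1 t z) 0 k + (g t w - g t (d *: xi + z)) 0 k
         + (g t (d *: xi + z) - g t z - d *: Lxi) 0 k
         - (V (t + d) - V t - d * v t) + d * (g1 t z 0 k + Lxi 0 k - v t).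
        by rewrite /D -/w -/z !mxE; ring.
      have B1 := le_trans (row_norm_ge _ k) A4.
      have B2 := le_trans (row_norm_ge _ k) A5.
      have B3 := le_trans (row_norm_ge _ k) dgd.
      have B4 : `|d * (g1 t z 0 k + Lxi 0 k - v t)| <=
          d * (K * rho + #|I|%:R * (M * (K * rho))).
        by rewrite normrM gtr0_norm// ler_pM2l.
      have B5 : (K + 4) * eta1 * d <= eta * d.
        by rewrite etaE ler_pM2r// mulrC ler_pM2l// lerD2l ler_nat.
      rewrite (le_trans (ler_normD _ _))// (le_trans (lerD (ler_normB _ _) (lexx _)))//.
      rewrite (le_trans (lerD (lerD (ler_normD _ _) (lexx _)) (lexx _)))//.
      rewrite (le_trans (lerD (lerD (lerD (ler_normD _ _) (lexx _)) (lexx _)) (lexx _)))//.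
      rewrite (le_trans (lerD (lerD (lerD (lerD B1 B2) B3) dV) B4))//.
      have -> : d * (cst1 * rho + eta) = eta * d + d * (cst1 * rho) by ring.
      rewrite -lerBlDr; apply: le_trans B5; rewrite le_eqVlt; apply/orP; left.
      by apply/eqP; rewrite /cst1; ring.
    rewrite /N mul0r add0r -lerBlDl; apply: le_trans total.
    apply: (le_trans (ler_norm _)); apply: (le_trans (ler_dist_dist _ _)).
    have -> : D y (t + d) - D y a - (D y t - D y a) = D y (t + d) - D y t by ring.
    exact: lexx.
  have Na0 : 0 <= N a by rewrite normr_ge0.
  have := ae_gronwall (ltW at1) (lexx 0) cr0 Lam0 (ltW e0) mE' E'e Na0 lipN diniN.
  rewrite mul0r expR0 mul1r /N subrr normr0 add0r => H.
  have Dy t : `|D 0 t - D y t| <= K * rho.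
    have -> : D 0 t - D y t = (g t (x t + 0) - g t (x t + y)) 0 k.
      by rewrite /D !mxE; ring.
    rewrite (le_trans (row_norm_ge _ _))//.
    have [_ gL _] := lg; rewrite (le_trans (gL _ _ _))// ler_wpM2l//.
    by rewrite addr0 opprD addrA subrr sub0r normrN.
  have := Dy t1; have := Dy a.
  have -> : D 0 t1 - D 0 a = (D 0 t1 - D y t1) + (D y t1 - D y a) - (D 0 a - D y a) by ring.
  have := ler_normB (D 0 t1 - D y t1 + (D y t1 - D y a)) (D 0 a - D y a).
  have := ler_normD (D 0 t1 - D y t1) (D y t1 - D y a).
  by clear -H; lra.
have D0 : `|D 0 t1 - D 0 a| <= 0.
  apply/ler_addgt0Pr => d d0; rewrite add0r.
  pose B := cst1 * (t1 - a) + Lam + 2 * K.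
  have B0 : 0 <= B.
    have ta0 : 0 <= t1 - a by rewrite subr_ge0 ltW.
    by apply: addr_ge0; [apply: addr_ge0 => //|]; exact: mulr_ge0.
  pose r := Num.min 1 (d / (B + 1)).
  have r0 : 0 < r by rewrite lt_min ltr01 divr_gt0// ltr_wpDl.
  have r1 : r <= 1 by rewrite ge_min lexx.
  have rd : r * (B + 1) <= d.
    by rewrite -ler_pdivlMr ?ltr_wpDl// ge_min lexx orbT.
  apply: (le_trans (key r r r0 r1 r0)); apply: le_trans rd.
  by rewrite [leRHS]mulrDr mulr1 /B; lra.
move: D0; rewrite normr_le0 /D !addr0 => /eqP; lra.
Unshelve. all: by end_near. Qed.

End ChainRule.

(** * Periodic primitives of the inputs *)

Section PeriodicPrimitive.
Context {R : realType}.
Local Notation cmu := (@completed_lebesgue_measure R).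
Local Notation cara := (caratheodory_type (@wlength R idfun)^*%mu).

Lemma bounded_integrable (v : R -> R) (M : R) :
  lebesgue_measurable v -> (forall t, `|v t| <= M) ->
  forall a b, cmu.-integrable `[a, b] (EFin \o v).
Proof.
move=> mv vM a b.
have mI : measurable (`[a, b]%classic : set cara).
  exact: (borel_cara (measurable_itv `[a, b])).
apply: measurable_bounded_integrable => //.
- have [ab|ba] := leP a b; last first.
    by rewrite set_itv_ge ?measure0// bnd_simp -ltNge.
  by rewrite [X in (X < _)%E](_ : _ = (b - a)%:E) ?ltry//; exact: completed_itv.
- exact: measurable_funTS.
- exists M; split; first exact: num_real.
  by move=> M' MM' t _; exact: le_trans (vM t) (ltW MM').
Qed.

(** The primitive V is periodic because V (t + T) - V t has derivative 0 and vanishes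
    at 0, the integral over a period being 0. *)
Lemma periodic_primitive (v : R -> R) (M T : R) : 0 < T ->
  lebesgue_measurable v -> (forall t, `|v t| <= M) ->
  (forall t, v (t + T) = v t) ->
  \int[cmu]_(t in `[0, T]) v t = 0 ->
  exists V : R -> R, [/\ V 0 = 0, V T = 0,
    (forall a b, lip_primitive a b v V),
    (forall t, V (t + T) = V t) & continuous V /\ (forall t, `|V t| <= M * T)].
Proof.
move=> T0 mv vM vT int0.
have iv := bounded_integrable mv vM.
have [V [V0 VP]] := primitive_exists iv.
have LV a b : lip_primitive a b v V.
  apply: (@lip_primitive_itv _ a (Num.max b (a + 1))) => //; first by rewrite le_max lexx.
  apply: (is_primitive_lip (M := M)) => [||t _]; last exact: vM.
    by rewrite lt_max ltrDl ltr01 orbT.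
  by move=> c d _ _; exact: VP.
have VT : V T = 0.
  by have [_ ->] := VP 0 T I I (ltW T0); rewrite V0 int0 addr0.
have Vper t : V (t + T) = V t.
  pose A := `|t| + 1.
  have AA : - A <= A by rewrite /A; have := normr_ge0 t; lra.
  have L1 : lip_primitive (- A) A (fun s => v s) (fun s => V (s + T)).
    have := lip_primitive_affine (a := - A) (b := A) (c := T) ltr01 (LV _ _).
    by apply: eq_lip_primitive => s _; rewrite !mul1r.
  have tA : - A <= t <= A.
    by rewrite -ler_norml /A lerDl.
  have A0 : - A <= 0 <= A.
    by rewrite -ler_norml normr0 /A addr_ge0.
  have := lip_primitive_unique AA L1 (LV _ _) tA.
  have := lip_primitive_unique AA L1 (LV _ _) A0.
  rewrite add0r V0 VT; lra.
have Vnat t (m : nat) : V (t + m%:R * T) = V t.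
  elim: m => [|m IH]; first by rewrite mul0r addr0.
  by rewrite -natr1 mulrDl mul1r addrA Vper.
have Vint t (m : int) : V (t + m%:~R * T) = V t.
  case: m => m; first exact: Vnat.
  by rewrite NegzE mulrNz mulNr -[in LHS](Vnat _ m.+1) -pmulrn subrK.
have M0 : 0 <= M by apply: le_trans (vM 0).
have Vlip s t : `|V s - V t| <= M * `|s - t|.
  wlog st : s t / t <= s => [W|].
    have [st|/ltW ts] := leP t s; first exact: W.
    by rewrite distrC [`|s - t|]distrC; exact: W.
  have [_ ->] := VP t s I I st; rewrite addrC addKr [X in _ * X]ger0_norm ?subr_ge0//.
  exact: (completed_Rintegral_le st (iv _ _) (fun t _ => vM t)).
exists V; split => //; split => [|t].
  exact: lipschitz_continuous M0 Vlip.
have tE : t = (t - (Num.floor (t / T))%:~R * T) + (Num.floor (t / T))%:~R * T by rewrite subrK.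
rewrite tE Vint; set s := t - _.
have sI : 0 <= s <= T.
  rewrite /s subr_ge0 -ler_pdivlMr// ge_floor/= lerBlDr -[X in X + _]mul1r -mulrDl.
  rewrite -ler_pdivrMr// addrC -intrD1; exact/ltW/floorD1_gt.
case/andP: sI => s0 sT.
have := Vlip s 0; rewrite V0 !subr0 (ger0_norm s0) => /le_trans; apply.
by rewrite ler_wpM2l.
Qed.

End PeriodicPrimitive.

Section AveragingData.
Context {R : realType} {l : nat}.
Local Notation cmu := (@completed_lebesgue_measure R).

(** The sum W_ij + W_ji - U_i U_j is T-periodic with constant derivative
    - (A_ij + A_ji), whence the antisymmetry. In the double integral, the inner one
    is the primitive U_i, and the outer integrand u_j U_i is A_ij plus the derivative
    of W_ij, which does not contribute over a period. *)
Lemma averaging_data (u : 'I_l -> R -> R) : A1 u ->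
  exists (U : 'I_l -> R -> R) (W : 'I_l -> 'I_l -> R -> R) (A : 'I_l -> 'I_l -> R) (C : R),
  [/\ 0 <= C /\ (forall i a b, lip_primitive a b (u i) (U i)),
      (forall i j a b, lip_primitive a b (fun t => U i t * u j t - A i j) (W i j)),
      (forall i t, `|U i t| <= C) /\ (forall i j t, `|W i j t| <= C),
      (forall i j, A j i = - A i j) &
      (forall i j omega, 0 < omega ->
        double_integral u i j omega = 2 * pi / omega ^+ 2 * A i j)].
Proof.
move=> hA1; set T : R := 2 * pi.
have T0 : 0 < T by rewrite mulr_gt0// pi_gt0.
have T00 := ltW T0.
have TT0 : 0 <= (T + T) * T by rewrite mulr_ge0// addr_ge0.
have /choice[U HU] : forall i, exists Ui : R -> R, [/\ Ui 0 = 0, Ui T = 0,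
    (forall a b, lip_primitive a b (u i) Ui),
    (forall t, Ui (t + T) = Ui t) & continuous Ui /\ (forall t, `|Ui t| <= 1 * T)].
  by move=> i; have [mu_ u1 uT ui0] := hA1 i; exact: periodic_primitive.
have UT i t : `|U i t| <= T by have [_ _ _ _ [_ H]] := HU i; rewrite -[T]mul1r.
pose A i j := T^-1 * \int[cmu]_(t in `[0, T]) (U i t * u j t).
have mUu i j : lebesgue_measurable (fun t => U i t * u j t).
  have [mu_ _ _ _] := hA1 j.
  apply: measurable_funM; last exact: mu_.
  have [_ _ _ _ [cU _]] := HU i.
  apply: (measurable_fun_cara measurableT); exact: continuous_measurable_fun.
have Uu i j t : `|U i t * u j t| <= T.
  have [_ u1 _ _] := hA1 j.
  by rewrite normrM -[T]mulr1 ler_pM.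
have AT i j : `|A i j| <= T.
  rewrite /A normrM ger0_norm ?invr_ge0// -ler_pdivlMl ?invr_gt0// invrK mulrC.
  have := completed_Rintegral_le T00 (bounded_integrable (mUu i j) (Uu i j) 0 T)
    (fun t _ => Uu i j t).
  by rewrite subr0.
have /choice[W HW] : forall ij : 'I_l * 'I_l, exists Wij : R -> R, [/\ Wij 0 = 0, Wij T = 0,
    (forall a b, lip_primitive a b (fun t => U ij.1 t * u ij.2 t - A ij.1 ij.2) Wij),
    (forall t, Wij (t + T) = Wij t) &
    continuous Wij /\ (forall t, `|Wij t| <= (T + T) * T)].
  move=> [i j] /=; apply: periodic_primitive => //.
  - apply: measurable_funB; first exact: mUu.
    exact: measurable_cst.
  - by move=> t; rewrite (le_trans (ler_normB _ _))// lerD.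
  - move=> t; have [_ _ uT _] := hA1 j; have [_ _ _ UTt _] := HU i.
    by rewrite uT UTt.
  - rewrite RintegralB//=.
    + rewrite Rintegral_cst; last exact: (borel_cara (measurable_itv `[0, T])).
      rewrite [X in fine X](_ : _ = (T - 0)%:E); last exact: completed_itv.
      by rewrite /= subr0 /A mulrAC mulVf ?gt_eqF// mul1r subrr.
    + exact: (borel_cara (measurable_itv `[0, T])).
    + exact: (bounded_integrable (mUu i j) (Uu i j)).
    + exact: (bounded_integrable (M := `|A i j|) (measurable_cst (A i j))).
exists U, (fun i j => W (i, j)), A, (T + (T + T) * T); split.
- split; first by rewrite addr_ge0.
  by move=> i a b; have [_ _ H _ _] := HU i.
- by move=> i j a b; have [_ _ H _ _] := HW (i, j).
- split; first by move=> i t; rewrite (le_trans (UT i t))// lerDl.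
  move=> i j t; have [_ _ _ _ [_ H]] := HW (i, j).
  by rewrite (le_trans (H t))// lerDr.
- move=> i j.
  have [Ui0 UiT LUi _ _] := HU i; have [Uj0 UjT LUj _ _] := HU j.
  have [W0 WT LW _ _] := HW (i, j); have [W0' WT' LW' _ _] := HW (j, i).
  have L1 := lip_primitiveB (lip_primitiveD (LW 0 T) (LW' 0 T))
    (lip_primitiveM (LUi 0 T) (LUj 0 T)).
  have L2 := lip_primitiveZ (- (A i j + A j i)) (lip_primitive_id 0 T).
  have L1' : lip_primitive 0 T (fun t => - (A i j + A j i) * 1)
      (fun t => W (i, j) t + W (j, i) t - U i t * U j t).
    by apply: eq_lip_primitive L1 => // t _ /=; ring.
  have TI : 0 <= T <= T by rewrite lexx ltW.
  have := lip_primitive_unique (ltW T0) L1' L2 TI.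
  rewrite W0 WT W0' WT' UiT Uj0 UjT Ui0 => E.
  have /eqP : (A i j + A j i) * T = 0 by lra.
  by rewrite mulf_eq0 (gt_eqF T0) orbF => /eqP; lra.
- move=> i j omega w0; rewrite /double_integral.
  have [Ui0 UiT LUi _ _] := HU i; have [W0 WT LW _ _] := HW (i, j).
  have inner theta : 0 <= theta ->
      \int[cmu]_(tau in `[0, theta]) (u j (omega * theta) * u i (omega * tau)) =
      u j (omega * theta) * (omega^-1 * U i (omega * theta)).
    move=> th0.
    have := lip_primitiveZ (u j (omega * theta) * omega^-1)
      (lip_primitive_affine (a := 0) (b := theta) (c := 0) w0 (LUi _ _)).
    move=> /lip_primitive_is_primitive.
    move=> /(_ 0 theta); rewrite /= !in_itv/= !lexx th0 => /(_ isT isT isT)[_].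
    rewrite mulr0 !addr0 Ui0 mulr0 add0r => E.
    rewrite -mulrA in E; rewrite E; apply: eq_Rintegral => t _.
    by rewrite addr0; field; rewrite gt_eqF.
  have Tw0 : 0 <= T / omega by rewrite divr_ge0 ?ltW.
  transitivity (\int[cmu]_(theta in `[0, T / omega])
      (u j (omega * theta) * (omega^-1 * U i (omega * theta)))).
    apply: eq_Rintegral => t; rewrite inE/= in_itv/= => /andP[t0 _].
    exact: inner.
  have L1 := lip_primitiveZ (omega ^- 2)
      (lip_primitive_affine (a := 0) (b := T / omega) (c := 0) w0 (LW _ _)).
  have L2 := lip_primitiveZ (omega^-1 * A i j) (lip_primitive_id 0 (T / omega)).
  have := lip_primitiveD L1 L2.
  move=> /lip_primitive_is_primitive.
  move=> /(_ 0 (T / omega)); rewrite /= !in_itv/= !lexx Tw0 => /(_ isT isT isT)[_].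
  rewrite mulr0 !addr0 W0 !mulr0 !add0r.
  rewrite [omega * (T / omega)](_ : _ = T); last by field; rewrite gt_eqF.
  rewrite WT mulr0 add0r => E.
  rewrite [RHS](_ : _ = omega^-1 * A i j * (T / omega)); last by field; rewrite gt_eqF.
  rewrite E; apply: eq_Rintegral => t _.
  by rewrite addr0; field; rewrite gt_eqF.
Qed.

End AveragingData.

(** * Global solutions of Lipschitz systems *)

Section Picard.
Context {R : realType} {n : nat}.
Local Notation cmu := (@completed_lebesgue_measure R).
Local Notation field := (R -> 'rV[R]_n -> 'rV[R]_n).

Lemma lip_primitive_le (a b : R) v y w z : a <= b ->
  lip_primitive a b v y -> lip_primitive a b w z ->
  (forall t, a <= t <= b -> v t <= w t) -> y b - y a <= z b - z a.
Proof.
move=> ab /lip_primitive_is_primitive Hy /lip_primitive_is_primitive Hz vw.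
have aI : `[a, b]%classic a by rewrite /= in_itv/= lexx.
have bI : `[a, b]%classic b by rewrite /= in_itv/= lexx ab.
have [iv ->] := Hy _ _ aI bI ab; have [iw ->] := Hz _ _ aI bI ab.
rewrite addrC addKr addrC addKr; apply: le_Rintegral => //.
exact: (borel_cara (measurable_itv `[a, b])).
Qed.

Lemma lip_primitive_dist (a b : R) v y w z : a <= b ->
  lip_primitive a b v y -> lip_primitive a b w z ->
  (forall t, a <= t <= b -> `|v t| <= w t) -> `|y b - y a| <= z b - z a.
Proof.
move=> ab Hy Hz vw; rewrite ler_norml; apply/andP; split.
  rewrite lerNl.
  have := lip_primitive_le ab (lip_primitiveZ (-1) Hy) Hz.
  rewrite -mulrBr mulN1r; apply => t tI; rewrite mulN1r.
  by apply: le_trans (vw t tI); rewrite -normrN ler_norm.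
apply: lip_primitive_le ab Hy Hz _ => t tI.
exact: le_trans (ler_norm _) (vw t tI).
Qed.

Lemma lip_primitive_exp (a b k t0 : R) : 0 <= k ->
  lip_primitive a b (fun s => k * expR (k * (s - t0))) (fun s => expR (k * (s - t0))).
Proof.
move=> k0; split.
  exists (expR (k * (b - t0)) * k) => s t.
  wlog st : s t / t <= s => [W sI tI|sI tI].
    have [st|/ltW ts] := leP s t; last exact: W.
    by rewrite distrC [`|s - t|]distrC; exact: W.
  have kst : 0 <= k * (s - t) by rewrite mulr_ge0// subr_ge0.
  have -> : expR (k * (t - t0)) = expR (k * (s - t0)) * expR (- (k * (s - t))).
    by rewrite -expRD; congr expR; ring.
  rewrite -[X in X - _]mulr1 -mulrBr normrM ger0_norm ?expR_ge0// -mulrA.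
  apply: ler_pM; rewrite ?expR_ge0//.
    by rewrite ler_expR ler_wpM2l// lerD2r; case/andP: sI.
  have := expR_ge1Dx (- (k * (s - t))).
  have : expR (- (k * (s - t))) <= 1 by rewrite -expR0 ler_expR oppr_le0.
  move=> e1 e2; rewrite ger0_norm ?subr_ge0// ger0_norm ?subr_ge0//; lra.
apply: aeW => t _.
have d1 : is_derive t (1 : R) (fun s => k * (s - t0)) k.
  rewrite -[X in is_derive _ _ _ X]mulr1; apply: is_deriveZ.
  rewrite -[X in is_derive _ _ _ X]subr0; exact: is_deriveB.
rewrite [X in is_derive _ _ _ X]mulrC.
exact: (is_derive1_comp (is_derive_expR _) d1).
Qed.

Lemma continuous_locally_bounded (v : R -> R) (a b : R) : continuous v ->
  exists M, forall t, a <= t <= b -> `|v t| <= M.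
Proof.
move=> cv.
have [ab|ba] := leP a b; last first.
  by exists 0 => t /andP[at_ tb]; have := le_trans at_ tb; rewrite leNgt ba.
have cn : {within `[a, b], continuous (fun t => `|v t|)}.
  apply: continuous_subspaceT => t; apply: cvg_norm; exact: cv.
have [c _ H] := EVT_max ab cn.
by exists `|v c| => t tI; apply: H; rewrite in_itv.
Qed.

Lemma lip_primitive_continuous (v y : R -> R) :
  (forall a b, lip_primitive a b v y) -> continuous y.
Proof.
move=> Hy t; have [K K0 yK] := lip_primitive_lip (Hy (t - 1) (t + 1)).
apply/cvgrPdist_le => e e0; near=> s.
have tI : t - 1 <= t <= t + 1 by rewrite gerBl lerDl ler01.
have sI : t - 1 <= s <= t + 1.
  have : `|t - s| <= 1 by near: s; apply: cvgr_dist_le => //; exact: cvg_id.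
  by rewrite ler_norml => /andP[? ?]; lra.
apply: (le_trans (yK _ _ tI sI)).
have : `|t - s| <= e / (K + 1).
  near: s; apply: cvgr_dist_le; last by rewrite divr_gt0// ltr_wpDl.
  exact: cvg_id.
move=> /(ler_wpM2l K0)/le_trans; apply.
by rewrite mulrA ler_pdivrMr ?ltr_wpDl// mulrC ler_pM2l// lerDl.
Unshelve. all: by end_near. Qed.

Lemma continuous_primitive (v : R -> R) : continuous v ->
  exists2 V : R -> R, continuous V & forall a b, lip_primitive a b v V.
Proof.
move=> cv.
have iv a b : cmu.-integrable `[a, b] (EFin \o v).
  apply: (integrable_cara (measurable_itv _)).
  apply: continuous_compact_integrable; first exact: segment_compact.
  exact: continuous_subspaceT.
have [V [_ VP]] := primitive_exists iv.
have LV a b : lip_primitive a b v V.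
  apply: (@lip_primitive_itv _ a (Num.max b (a + 1))) => //; first by rewrite le_max lexx.
  have [M vM] := continuous_locally_bounded a (Num.max b (a + 1)) cv.
  apply: (is_primitive_lip _ _ vM); first by rewrite lt_max ltrDl ltr01 orbT.
  by move=> c d _ _; exact: VP.
by exists V => //; exact: lip_primitive_continuous LV.
Qed.

(** The limit is squeezed between the nondecreasing lower bounds a_m - 2 C / 2^m and
    the nonincreasing upper bounds a_m + 2 C / 2^m. *)
Lemma geometric_limit (a : nat -> R) (C : R) :
  (forall m, `|a m.+1 - a m| <= C / 2 ^+ m) ->
  exists l, forall m, `|l - a m| <= 2 * C / 2 ^+ m.
Proof.
move=> aC.
pose lo m := a m - 2 * C / 2 ^+ m; pose up m := a m + 2 * C / 2 ^+ m.
have C0 : 0 <= C by have := aC 0%N; rewrite expr0 divr1; exact: le_trans.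
have half m : 2 * C / 2 ^+ m.+1 = C / 2 ^+ m.
  by rewrite exprS; field; rewrite expf_neq0.
have dbl m : 2 * C / 2 ^+ m = C / 2 ^+ m + C / 2 ^+ m by ring.
have loS m : lo m <= lo m.+1.
  by rewrite /lo half dbl; have := aC m; rewrite ler_norml => /andP[? ?]; lra.
have upS m : up m.+1 <= up m.
  by rewrite /up half dbl; have := aC m; rewrite ler_norml => /andP[? ?]; lra.
have lomono m p : (m <= p)%N -> lo m <= lo p.
  by move=> mp; apply: (homo_leq (@lexx _ R) (@le_trans _ R)) mp => i; exact: loS.
have upmono m p : (m <= p)%N -> up p <= up m.
  elim: p => [|p IH]; first by rewrite leqn0 => /eqP ->.
  rewrite leq_eqVlt => /predU1P[->//|]; rewrite ltnS => /IH; exact: le_trans (upS _).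
have loup m p : lo m <= up p.
  apply: (le_trans (lomono _ _ (leq_maxl m p))).
  apply: (le_trans _ (upmono _ _ (leq_maxr m p))).
  rewrite /lo /up lerD2l; have : 0 <= 2 * C / 2 ^+ maxn m p.
    by rewrite divr_ge0 ?mulr_ge0// exprn_ge0.
  by lra.
have hs : has_sup (range lo).
  by split; [exists (lo 0%N); exists 0%N|exists (up 0%N) => _ [m _ <-]; exact: loup].
exists (sup (range lo)) => m; rewrite ler_norml; apply/andP; split.
  have : lo m <= sup (range lo) by apply: sup_upper_bound => //; exists m.
  by rewrite /lo; lra.
have : sup (range lo) <= up m.
  by apply: ge_sup => [|_ [p _ <-]]; [exists (lo 0%N); exists 0%N|exact: loup].
by rewrite /up; lra.
Qed.

Lemma continuous_rowP (f : R -> 'rV[R]_n) :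
  (forall k, continuous (fun t => f t 0 k)) -> continuous f.
Proof.
move=> cf t; apply/cvgrPdist_le => e e0.
have H : \forall s \near t, forall k, `|f t 0 k - f s 0 k| <= e.
  have Hk k : \forall s \near t, `|f t 0 k - f s 0 k| <= e.
    by have /cvgrPdist_le := cf k t; apply.
  exact: filter_forall Hk.
near=> s; apply: row_norm_le => [|k]; first exact: ltW.
by rewrite !mxE; move: k; near: s.
Unshelve. all: by end_near. Qed.

Lemma continuous_maxl (t0 : R) : continuous (fun t : R => Num.max t t0).
Proof.
apply: (@lipschitz_continuous _ R^o R^o 1) => // s t; rewrite mul1r.
rewrite /Num.max; case: ifPn; case: ifPn; rewrite -?leNgt => h1 h2 //.
- by rewrite subrr normr0.
- rewrite !ler0_norm; lra.
- rewrite !ger0_norm; lra.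
Qed.

(** The iterate is frozen before t0, which keeps it continuous on the line. *)
Lemma picard_step (F : field) (K t0 : R) (x0 : 'rV[R]_n) (z : R -> 'rV[R]_n) :
  0 <= K -> lipschitz_field K F -> continuous z ->
  exists z' : R -> 'rV[R]_n, [/\ continuous z', z' t0 = x0,
    (forall t, z' t = z' (Num.max t t0)) &
    forall b k, lip_primitive t0 b (fun s => F s (z s) 0 k) (fun s => z' s 0 k)].
Proof.
move=> K0 lF cz.
have /choice[V HV] : forall k, exists V : R -> R, continuous V /\
    forall a b, lip_primitive a b (fun s => F s (z s) 0 k) V.
  move=> k; have [|V cV LV] := @continuous_primitive (fun s => F s (z s) 0 k).
    by apply: (@continuous_coord _ _ (fun s => F s (z s))); exact: lipschitz_field_continuous lF cz.
  by exists V.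
exists (fun t => \row_k (x0 0 k + (V k (Num.max t t0) - V k t0))); split.
- apply: continuous_rowP => k.
  have -> : (fun t => (\row_j (x0 0 j + (V j (Num.max t t0) - V j t0))) 0 k) =
      (fun t => x0 0 k + (V k (Num.max t t0) - V k t0)).
    by apply/funext => t; rewrite mxE.
  move=> t; apply: cvgD; first exact: cvg_cst.
  apply: cvgB; last exact: cvg_cst.
  apply: (@continuous_comp _ _ _ (fun t => Num.max t t0) (V k)).
    exact: continuous_maxl.
  by have [cV _] := HV k; exact: cV.
- by apply/rowP => k; rewrite mxE maxxx subrr addr0.
- by move=> t; apply/rowP => k; rewrite !mxE -maxA maxxx.
- move=> b k; have [_ LV] := HV k.
  have := lip_primitiveD (LV t0 b) (lip_primitive_cst t0 b (x0 0 k - V k t0)).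
  apply: eq_lip_primitive => t /andP[tt0 tb]; first by rewrite addr0.
  by rewrite mxE max_l//; ring.
Qed.

Lemma lip_primitive_row_dist (a b : R) (v x : R -> 'rV[R]_n) w z : a <= b ->
  (forall k, lip_primitive a b (fun t => v t 0 k) (fun t => x t 0 k)) ->
  lip_primitive a b w z ->
  (forall t, a <= t <= b -> `|v t| <= w t) -> z a <= z b -> `|x b - x a| <= z b - z a.
Proof.
move=> ab Hx Hz vw zab; apply: row_norm_le => [|k]; first by rewrite subr_ge0.
rewrite !mxE; apply: (lip_primitive_dist ab (Hx k) Hz) => t tI.
exact: le_trans (row_norm_ge _ _) (vw t tI).
Qed.

(** Picard iteration on the whole half-line. With the weight
    e t = e^(2 (K + 1) (t - t0)), integrating the Lipschitz bound gains a factor 1/2,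
    so the iterates form a geometric sequence at every time. Their limit y is
    Lipschitz on bounded intervals, like the iterates, hence it has itself a Picard
    image Y; and Y is also the limit of the iterates, so y = Y. *)
Lemma picard_global (F : field) (K t0 : R) (x0 : 'rV[R]_n) :
  0 <= K -> lipschitz_field K F ->
  exists y : R -> 'rV[R]_n, [/\ y t0 = x0, is_solution F `[t0, +oo[ y &
    forall b k, lip_primitive t0 b (fun s => F s (y s) 0 k) (fun s => y s 0 k)].
Proof.
move=> K0 lF; have [_ FL _] := lF.
have /choice[step stepP] : forall z : R -> 'rV[R]_n, exists z' : R -> 'rV[R]_n,
    continuous z -> [/\ continuous z', z' t0 = x0,
    (forall t, z' t = z' (Num.max t t0)) &
    forall b k, lip_primitive t0 b (fun s => F s (z s) 0 k) (fun s => z' s 0 k)].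
  move=> z; have [cz|nc] := pselect (continuous z); last by exists z.
  by have [z' Hz'] := picard_step t0 x0 K0 lF cz; exists z'.
pose zs m := iter m step (fun=> x0).
have czs m : continuous (zs m).
  by elim: m => [|m IH]; [move=> t; exact: cvg_cst|have [] := stepP _ IH].
have zs0 m : zs m t0 = x0.
  by case: m => [//|m]; have [] := stepP _ (czs m).
have zsP m b k : lip_primitive t0 b (fun s => F s (zs m s) 0 k) (fun s => zs m.+1 s 0 k).
  by have [] := stepP _ (czs m).
pose k2 := 2 * (K + 1).
have k20 : 0 <= k2 by rewrite mulr_ge0// addr_ge0.
pose e t := expR (k2 * (t - t0)).
have e1 t : t0 <= t -> 1 <= e t.
  by move=> tt0; rewrite /e -expR0 ler_expR mulr_ge0// subr_ge0.
have emono s t : s <= t -> e s <= e t.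
  by move=> st; rewrite /e ler_expR ler_wpM2l// lerD2r.
pose c := `|x0|.
have c0 : 0 <= c by rewrite normr_ge0.
have dist m t : t0 <= t -> `|zs m.+1 t - zs m t| <= c * e t / 2 ^+ m.
  elim: m t => [|m IH] t tt0.
    rewrite expr0 divr1.
    have H1 : `|zs 1%N t - zs 1%N t0| <= K * c * t - K * c * t0.
      apply: (lip_primitive_row_dist tt0 (zsP 0%N t)
        (lip_primitiveZ (K * c) (lip_primitive_id t0 t))).
        by move=> s sI; rewrite mulr1; exact: lipschitz_field_norm lF.
      by rewrite ler_wpM2l// mulr_ge0.
    rewrite zs0 in H1; apply: (le_trans H1).
    have H : 1 + k2 * (t - t0) <= e t by exact: expR_ge1Dx.
    have tt : 0 <= t - t0 by rewrite subr_ge0.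
    rewrite -mulrBr mulrAC mulrC ler_wpM2l//; apply: le_trans H.
    rewrite /k2; have : 0 <= K * (t - t0) by rewrite mulr_ge0.
    by nra.
  have Hd k : lip_primitive t0 t (fun s => (F s (zs m.+1 s) - F s (zs m s)) 0 k)
      (fun s => (zs m.+2 s - zs m.+1 s) 0 k).
    have := lip_primitiveB (zsP m.+1 t k) (zsP m t k).
    by apply: eq_lip_primitive => s _; rewrite !mxE.
  have cm0 : 0 <= c / 2 ^+ m by rewrite divr_ge0// exprn_ge0.
  have Hz := lip_primitiveZ (c / 2 ^+ m / 2) (lip_primitive_exp t0 t t0 k20).
  have := lip_primitive_row_dist tt0 Hd Hz.
  have -> : zs m.+2 t0 - zs m.+1 t0 = 0 by rewrite !zs0 subrr.
  rewrite subr0 => H.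
  apply: (le_trans (H _ _)).
  - move=> s /andP[ts _]; rewrite (le_trans (FL _ _ _))//.
    apply: (le_trans (ler_wpM2l K0 (IH s ts))).
    have es : 0 <= e s by exact: expR_ge0.
    have -> : c / 2 ^+ m / 2 * (k2 * expR (k2 * (s - t0))) = (K + 1) * (c * e s / 2 ^+ m).
      by rewrite /k2 /e; field; rewrite expf_neq0.
    rewrite ler_wpM2r// ?lerDl//.
    by rewrite divr_ge0 ?mulr_ge0// exprn_ge0.
  - by apply: ler_wpM2l; [rewrite divr_ge0|exact: emono].
  - rewrite [X in _ - X](_ : _ = c / 2 ^+ m / 2); last by rewrite subrr mulr0 expR0 mulr1.
    rewrite -/(e t) exprS.
    have -> : c * e t / (2 * 2 ^+ m) = c / 2 ^+ m / 2 * e t.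
      by field; rewrite expf_neq0.
    by rewrite gerBl divr_ge0.
have /choice[y0 Hy0] : forall t, exists yt : 'rV[R]_n, t0 <= t ->
    forall m, `|yt - zs m t| <= 2 * (c * e t) / 2 ^+ m.
  move=> t; have [tt0|nt] := leP t0 t; last by exists 0.
  have /choice[r Hr] : forall k, exists l, forall m, `|l - zs m t 0 k| <= 2 * (c * e t) / 2 ^+ m.
    move=> k; apply: (@geometric_limit (fun m => zs m t 0 k)) => m.
    by have := dist m t tt0; apply: le_trans; have := row_norm_ge (zs m.+1 t - zs m t) k; rewrite !mxE.
  exists (\row_k r k) => _ m; apply: row_norm_le => [|k]; last by rewrite !mxE.
  by rewrite divr_ge0 ?exprn_ge0// !mulr_ge0 ?expR_ge0.
pose y t := y0 (Num.max t t0).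
have yz t m : t0 <= t -> `|y t - zs m t| <= 2 * (c * e t) / 2 ^+ m.
  by move=> tt0; rewrite /y max_l//; exact: Hy0.
have e0 t : 0 <= e t by exact: expR_ge0.
have ce0 t : 0 <= 2 * (c * e t) by rewrite mulr_ge0// mulr_ge0.
have pow_le (A : R) m : 0 <= A -> A / 2 ^+ m <= A.
  move=> A0; rewrite ler_pdivrMr ?exprn_gt0// ler_peMr//.
  by apply: exprn_ege1; rewrite ler1n.
(* On [t0, T] the iterates are bounded independently of m, hence have a common
   Lipschitz constant, which passes to the limit. *)
have zsbound T m t : t0 <= t <= T -> `|zs m t| <= c + 2 * (2 * (c * e T)).
  move=> /andP[tt0 tT].
  have E : 2 * (c * e t) <= 2 * (c * e T) by rewrite !ler_wpM2l// emono.
  have b1 := le_trans (yz t m tt0) (pow_le _ m (ce0 t)).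
  have b2 := le_trans (yz t 0%N tt0) (pow_le _ 0%N (ce0 t)).
  have -> : zs m t = x0 + (y t - x0) - (y t - zs m t).
    by apply/rowP => k; rewrite !mxE; ring.
  have := ler_normB (x0 + (y t - x0)) (y t - zs m t).
  have := ler_normD x0 (y t - x0).
  by rewrite -/c; move: b2; rewrite /=; lra.
have zslip T m s t : t0 <= s -> s <= t -> t <= T ->
    `|zs m t - zs m s| <= K * (c + 2 * (2 * (c * e T))) * (t - s).
  move=> ts st tT; set B := c + _.
  have B0 : 0 <= B by rewrite addr_ge0// mulr_ge0.
  case: m => [|m]; first by rewrite subrr normr0 mulr_ge0 ?mulr_ge0 ?subr_ge0.
  have Hz k : lip_primitive s t (fun r => F r (zs m r) 0 k) (fun r => zs m.+1 r 0 k).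
    by apply: lip_primitive_itv (zsP m t k).
  have := lip_primitive_row_dist st Hz (lip_primitiveZ (K * B) (lip_primitive_id s t)).
  rewrite -mulrBr; apply.
    move=> r /andP[sr rt]; rewrite mulr1 (le_trans (lipschitz_field_norm _ _ lF))//.
    by rewrite ler_wpM2l// zsbound// (le_trans ts)//= (le_trans rt).
  by rewrite ler_wpM2l// mulr_ge0.
have vanish (A B : R) : (forall m : nat, A <= B / 2 ^+ m) -> A <= 0.
  move=> AB; apply/ler_addgt0Pr => d d0; rewrite add0r.
  have B0 : `|B| < (Num.bound `|B / d|)%:R * d.
    rewrite -ltr_pdivrMr// -[d in X in X < _]gtr0_norm// -normfV -normrM.
    exact: archi_boundP.
  set N := Num.bound _ in B0.
  apply: (le_trans (AB N)); rewrite ler_pdivrMr ?exprn_gt0//.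
  apply: (le_trans (ler_norm _)); apply: ltW; apply: (lt_le_trans B0).
  rewrite mulrC ler_pM2l// -natrX ler_nat ltnW//.
  exact: ltn_expl.
have ylip T s t : t0 <= s -> s <= t -> t <= T ->
    `|y t - y s| <= K * (c + 2 * (2 * (c * e T))) * (t - s).
  move=> ts st tT; rewrite -subr_le0.
  apply: (vanish _ (2 * (2 * (c * e T)))) => m.
  have tt := le_trans ts st.
  have E1 : 2 * (c * e t) / 2 ^+ m <= 2 * (c * e T) / 2 ^+ m.
    by rewrite ler_wpM2r ?invr_ge0 ?exprn_ge0// !ler_wpM2l// emono.
  have E2 : 2 * (c * e s) / 2 ^+ m <= 2 * (c * e T) / 2 ^+ m.
    by rewrite ler_wpM2r ?invr_ge0 ?exprn_ge0// !ler_wpM2l// emono// (le_trans st).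
  have := yz t m tt; have := yz s m ts; have := zslip T m s t ts st tT.
  have -> : y t - y s = (zs m t - zs m s) + (y t - zs m t) - (y s - zs m s).
    by apply/rowP => k; rewrite !mxE; ring.
  have := ler_normB ((zs m t - zs m s) + (y t - zs m t)) (y s - zs m s).
  have := ler_normD (zs m t - zs m s) (y t - zs m t).
  have -> : 2 * (2 * (c * e T)) / 2 ^+ m = 2 * (c * e T) / 2 ^+ m + 2 * (c * e T) / 2 ^+ m.
    by ring.
  by lra.
have cy : continuous y.
  move=> t.
  pose T := Num.max t t0 + 1.
  pose Y s := y (clamp t0 T s).
  have t0T : t0 <= T by rewrite /T ler_wpDr// le_max lexx orbT.
  have cY : continuous Y.
    apply: (@lipschitz_continuous _ R^o _ (K * (c + 2 * (2 * (c * e T))))).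
      by rewrite mulr_ge0// addr_ge0// mulr_ge0.
    move=> r s.
    have B0 : 0 <= K * (c + 2 * (2 * (c * e T))) by rewrite mulr_ge0// addr_ge0// mulr_ge0.
    apply: (le_trans _ (ler_wpM2l B0 (clamp_lip t0 T r s))).
    have /andP[r1 r2] := clamp_itv r t0T; have /andP[s1 s2] := clamp_itv s t0T.
    rewrite /Y; set r' := clamp _ _ r in r1 r2 *; set s' := clamp _ _ s in s1 s2 *.
    have [rs|/ltW sr] := leP r' s'.
      by rewrite distrC [`|r' - s'|]distrC [X in _ <= _ * X]ger0_norm ?subr_ge0//; exact: ylip.
    by rewrite [X in _ <= _ * X]ger0_norm ?subr_ge0//; exact: ylip.
  have E : \forall s \near t, Y s = y s.
    have tT : t < T by rewrite /T ltr_pwDr// le_max lexx.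
    near=> s.
    have sT : s <= T by apply: ltW; near: s; exact: lt_nbhsl.
    by rewrite /Y /clamp min_l// /y [Num.max t0 s]maxC -maxA maxxx.
  rewrite /prop_for/continuous_at -(nbhs_singleton E).
  by apply: cvg_trans (cY t); apply: near_eq_cvg.
have [Y [cY Y0 _ YP]] := picard_step t0 x0 K0 lF cy.
have YE t : t0 <= t -> Y t = y t.
  move=> tt0; apply/eqP; rewrite -subr_eq0 -normr_le0.
  apply: (vanish _ (K * (2 * (c * e t)) * (t - t0) + 2 * (c * e t))) => m.
  have Hd k : lip_primitive t0 t (fun s => (F s (y s) - F s (zs m s)) 0 k)
      (fun s => (Y s - zs m.+1 s) 0 k).
    have := lip_primitiveB (YP t k) (zsP m t k).
    by apply: eq_lip_primitive => s _; rewrite !mxE.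
  have K20 : 0 <= K * (2 * (c * e t)) / 2 ^+ m by rewrite divr_ge0 ?mulr_ge0 ?exprn_ge0.
  have := lip_primitive_row_dist tt0 Hd
    (lip_primitiveZ (K * (2 * (c * e t)) / 2 ^+ m) (lip_primitive_id t0 t)).
  rewrite Y0 zs0 subrr subr0 -mulrBr => H.
  have {}H : `|Y t - zs m.+1 t| <= K * (2 * (c * e t)) / 2 ^+ m * (t - t0).
    apply: H; last by rewrite ler_wpM2l.
    move=> s /andP[ts st]; rewrite mulr1 (le_trans (FL _ _ _))// -mulrA ler_wpM2l//.
    apply: (le_trans (yz s m ts)).
    by rewrite ler_wpM2r ?invr_ge0 ?exprn_ge0// !ler_wpM2l// emono.
  have := yz t m.+1 tt0.
  have : 2 * (c * e t) / 2 ^+ m.+1 <= 2 * (c * e t) / 2 ^+ m.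
    rewrite ler_wpM2l// lef_pV2 ?posrE ?exprn_gt0// exprS ler_peMl ?exprn_ge0// ler1n.
    by [].
  have -> : Y t - y t = (Y t - zs m.+1 t) - (y t - zs m.+1 t).
    by apply/rowP => k; rewrite !mxE; ring.
  have := ler_normB (Y t - zs m.+1 t) (y t - zs m.+1 t).
  have -> : (K * (2 * (c * e t)) * (t - t0) + 2 * (c * e t)) / 2 ^+ m =
     K * (2 * (c * e t)) / 2 ^+ m * (t - t0) + 2 * (c * e t) / 2 ^+ m by ring.
  by lra.
have Py b k : lip_primitive t0 b (fun s => F s (y s) 0 k) (fun s => y s 0 k).
  apply: eq_lip_primitive (YP b k) => // s /andP[ts _].
  by rewrite YE.
exists y; split => //.
- by rewrite -YE// Y0.
- move=> k a b; rewrite /= !in_itv/= !andbT => ta tb ab.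
  have := lip_primitive_is_primitive (Py b k).
  by apply; rewrite /= ?in_itv/= ?ta ?tb ?lexx.
Unshelve. all: by end_near. Qed.

End Picard.

(** * Gronwall's inequality for vectors and the Euclidean triangle inequality *)

Section VectorGronwall.
Context {R : realType} {n : nat}.
Local Notation mu := (@lebesgue_measure R).
#[local] Existing Instance lebesgue_ae_filter.

(** The norm of D need not be differentiable, but its right difference quotients are
    bounded by the norm of v, which is what [ae_gronwall] asks for. *)
Lemma vector_gronwall (a b K eps : R) (v D : R -> 'rV[R]_n) : 0 <= K -> 0 <= eps ->
  (forall k, lip_primitive a b (fun t => v t 0 k) (fun t => D t 0 k)) ->
  (forall t, a <= t <= b -> `|v t| <= K * `|D t| + eps) ->
  forall t, a <= t <= b -> `|D t| <= expR (K * (t - a)) * (`|D a| + eps * (t - a)).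
Proof.
move=> K0 eps0 HD vD t1 /andP[at1 t1b].
have {}HD k : lip_primitive a t1 (fun t => v t 0 k) (fun t => D t 0 k).
  exact: (lip_primitive_itv (lexx a) t1b (HD k)).
have {}vD t : a <= t <= t1 -> `|v t| <= K * `|D t| + eps.
  by move=> /andP[at_ tt]; apply: vD; rewrite at_ (le_trans tt).
have [Lam Lam0 DL] := lip_primitive_row HD.
have [E [mE E0 subE]] : {ae mu, forall t, forall k, a < t < t1 ->
    is_derive t (1 : R) (fun s => D s 0 k) (v t 0 k)}.
  by apply: filter_forall => k; have [] := HD k.
have Ee : (mu E <= 0%:E)%E by rewrite [leLHS](_ : _ = 0%E)//; exact: E0.
have lipN s t : a <= s -> s <= t -> t <= t1 -> `|D t| - `|D s| <= Lam * (t - s).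
  move=> as_ st tt1; apply: (le_trans (ler_norm _)).
  apply: (le_trans (ler_dist_dist _ _)).
  rewrite -[X in _ * X]ger0_norm ?subr_ge0//.
  by apply: DL; [rewrite tt1 (le_trans as_)|rewrite as_ (le_trans st)].
have := @ae_gronwall R a t1 K eps Lam 0 (fun t => `|D t|) E at1 K0 eps0 Lam0 (lexx 0)
  mE Ee (normr_ge0 _) lipN.
rewrite mulr0 addr0; apply => t tI nE eta eta0.
have dD k : is_derive t (1 : R) (fun s => D s 0 k) (v t 0 k).
  by apply: contrapT => nd; apply: nE; apply: subE => /= /(_ k tI).
near=> h.
have h0 : 0 < h by near: h; exact: nbhs_right_gt.
have dh : `|D (t + h) - D t - h *: v t| <= eta * h.
  by near: h; exact: near_right_row.
have -> : D (t + h) = (D (t + h) - D t - h *: v t) + h *: v t + D t.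
  by rewrite !subrK.
have tI' : a <= t <= t1 by case/andP: tI => ? ?; rewrite !ltW.
have vt : h * `|v t| <= h * (K * `|D t| + eps) by rewrite ler_pM2l// vD.
apply: (le_trans (ler_normD _ _)); rewrite addrC lerD2l.
apply: (le_trans (ler_normD _ _)); rewrite normrZ (gtr0_norm h0).
rewrite mulrDr addrC [h * eta]mulrC; exact: lerD.
Unshelve. all: by end_near. Qed.

Lemma dot_le_enorm (x y : 'rV[R]_n) : \sum_i x 0 i * y 0 i <= enorm x * enorm y.
Proof.
set A := enorm x; set B := enorm y.
have A2 : A ^+ 2 = \sum_i x 0 i ^+ 2 by rewrite sqr_sqrtr// sumr_ge0// => i _; exact: sqr_ge0.
have B2 : B ^+ 2 = \sum_i y 0 i ^+ 2 by rewrite sqr_sqrtr// sumr_ge0// => i _; exact: sqr_ge0.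
have A0 : 0 <= A by exact: sqrtr_ge0.
have B0 : 0 <= B by exact: sqrtr_ge0.
have x0 : A = 0 -> forall i, x 0 i = 0.
  move=> A00 i; apply/eqP; rewrite -normr_le0.
  apply: (le_trans (row_norm_ge x i)); apply: (le_trans (norm_le_enorm x)).
  by rewrite -/A A00.
have y0 : B = 0 -> forall i, y 0 i = 0.
  move=> B00 i; apply/eqP; rewrite -normr_le0.
  apply: (le_trans (row_norm_ge y i)); apply: (le_trans (norm_le_enorm y)).
  by rewrite -/B B00.
have [AE|An0] := eqVneq A 0.
  by rewrite AE mul0r big1// => i _; rewrite x0// mul0r.
have [BE|Bn0] := eqVneq B 0.
  by rewrite BE mulr0 big1// => i _; rewrite y0// mulr0.
have AB : 0 < A * B by rewrite mulr_gt0// lt0r ?An0 ?Bn0.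
rewrite -(ler_pM2l AB) mulr_sumr.
have -> : A * B * (A * B) = 2^-1 * (B ^+ 2 * A ^+ 2 + A ^+ 2 * B ^+ 2) by field.
have <- : \sum_i (B ^+ 2 * x 0 i ^+ 2 + A ^+ 2 * y 0 i ^+ 2) =
    B ^+ 2 * A ^+ 2 + A ^+ 2 * B ^+ 2 by rewrite big_split/= -!mulr_sumr -A2 -B2.
rewrite mulr_sumr; apply: ler_sum => i _.
have : 0 <= (B * x 0 i - A * y 0 i) ^+ 2 by exact: sqr_ge0.
by nra.
Qed.

Lemma ler_enormD (x y : 'rV[R]_n) : enorm (x + y) <= enorm x + enorm y.
Proof.
have e0 (z : 'rV[R]_n) : 0 <= enorm z by exact: sqrtr_ge0.
have e2 (z : 'rV[R]_n) : enorm z ^+ 2 = \sum_i z 0 i ^+ 2.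
  by rewrite sqr_sqrtr// sumr_ge0// => i _; exact: sqr_ge0.
rewrite -(@ler_pXn2r _ 2)// ?nnegrE ?addr_ge0// e2.
have -> : \sum_i (x + y) 0 i ^+ 2 =
    enorm x ^+ 2 + 2 * (\sum_i x 0 i * y 0 i) + enorm y ^+ 2.
  rewrite !e2 mulr_sumr -!big_split/=; apply: eq_bigr => i _.
  by rewrite mxE; ring.
by have := dot_le_enorm x y; nra.
Qed.

End VectorGronwall.

(** * Near-identity transform to the Lie-bracket system *)

Section Antisymmetry.
Context {R : realType}.

(** Folds the sum over all pairs that averaging produces onto the pairs i < j of the
    Lie-bracket system; with Q i j standing for L_(f_j) f_i, the left-hand side
    is the bracket sum. *)
Lemma antisymmetric_sum l (A Q : 'I_l -> 'I_l -> R) :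
  (forall i j, A j i = - A i j) ->
  \sum_(i < l) \sum_(j < l | (i < j)%N) A i j * (Q j i - Q i j) =
  - \sum_(i < l) \sum_(j < l) A i j * Q i j.
Proof.
move=> Aanti.
have Aii i : A i i = 0 by have := Aanti i i; lra.
have lower : \sum_(i < l) \sum_(j < l | (j < i)%N) A i j * Q i j =
    - \sum_(i < l) \sum_(j < l | (i < j)%N) A i j * Q j i.
  rewrite (exchange_big_dep xpredT)//= -sumrN; apply: eq_bigr => i _.
  by rewrite -sumrN; apply: eq_bigr => j _; rewrite Aanti mulNr.
have split : \sum_(i < l) \sum_(j < l) A i j * Q i j =
    \sum_(i < l) \sum_(j < l | (i < j)%N) A i j * Q i j +
    \sum_(i < l) \sum_(j < l | (j < i)%N) A i j * Q i j.
  rewrite -big_split/=; apply: eq_bigr => i _.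
  rewrite (bigID (fun j : 'I_l => (i < j)%N))/=; congr (_ + _).
  rewrite (bigID (fun j : 'I_l => (j < i)%N))/= [X in _ + X]big1 ?addr0.
    by apply: eq_bigl => j; rewrite -leqNgt; case: ltngtP.
  move=> j; rewrite -!leqNgt -eqn_leq => /eqP ij.
  by rewrite (val_inj ij : j = i) Aii mul0r.
rewrite split lower opprD opprK addrC -sumrN -big_split/=; apply: eq_bigr => i _.
rewrite -sumrN -big_split/=; apply: eq_bigr => j _; ring.
Qed.

End Antisymmetry.

Section LieBracketAveraging.
Context {R : realType} {n l : nat}.
Local Notation field := (R -> 'rV[R]_n -> 'rV[R]_n).

Lemma lipschitz_fieldW K K' (g : field) : K <= K' ->
  lipschitz_field K g -> lipschitz_field K' g.
Proof.
move=> KK' [gc gL g0]; split => // t x y.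
by rewrite (le_trans (gL _ _ _))// ler_wpM2r.
Qed.

Lemma lipschitz_fieldD K K' (g h : field) :
  lipschitz_field K g -> lipschitz_field K' h ->
  lipschitz_field (K + K') (fun t x => g t x + h t x).
Proof.
move=> [gc gL g0] [hc hL h0]; split => [x t|t x y|t]; last by rewrite g0 h0 addr0.
  by apply: cvgD; [exact: gc|exact: hc].
rewrite opprD addrACA mulrDl (le_trans (ler_normD _ _))// lerD//.
Qed.

Lemma lipschitz_fieldZ K a (g : field) :
  lipschitz_field K g -> lipschitz_field (`|a| * K) (fun t x => a *: g t x).
Proof.
move=> [gc gL g0]; split => [x t|t x y|t]; last by rewrite g0 scaler0.
  by apply: cvgZr; exact: gc.
by rewrite -scalerBr normrZ -mulrA ler_wpM2l.
Qed.

Lemma lipschitz_field_sum (I : finType) (P : pred I) K (g : I -> field) : 0 <= K ->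
  (forall i, lipschitz_field K (g i)) ->
  lipschitz_field (#|I|%:R * K) (fun t x => \sum_(i | P i) g i t x).
Proof.
move=> K0 lg.
have [gK g00] : (forall i t x y, `|g i t x - g i t y| <= K * `|x - y|) /\
    (forall i t, g i t 0 = 0).
  by split => i; have [] := lg i.
split => [x t|t x y|t].
- suff H (r : seq I) : (\sum_(i <- r | P i) g i t' x) @[t' --> t] --> \sum_(i <- r | P i) g i t x.
    exact: H.
  elim: r => [|i r IH].
    rewrite big_nil (_ : (fun t' => _) = cst 0); first exact: cvg_cst.
    by apply/funext => t'; rewrite big_nil.
  rewrite big_cons (_ : (fun t' => _) = (fun t' =>
    if P i then g i t' x + \sum_(j <- r | P j) g j t' x else \sum_(j <- r | P j) g j t' x)).
    by have [gc _ _] := lg i; case: (P i) => //; apply: cvgD => //; exact: gc.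
  by apply/funext => t'; rewrite big_cons.
- rewrite -sumrB (le_trans (ler_norm_sum _ _ _))//.
  rewrite (le_trans (ler_sum _ (fun i _ => gK i t x y)))//.
  rewrite big_mkcond/= -mulrA mulr_natl -sumr_const.
  by apply: ler_sum => i _; case: ifP => // _; rewrite mulr_ge0.
- by rewrite big1.
Qed.

(** With exponents 1/2 the coefficient gamma_ij does not depend on the frequency: it
    equals A_ij, so the limit is that of an eventually constant function. *)
Lemma bracket_system_averaged (p : 'I_l -> R) (u : 'I_l -> R -> R)
    (f : 'I_l.+1 -> field) (Lf : 'I_l.+1 -> 'I_l.+1 -> field) (A : 'I_l -> 'I_l -> R) :
  (forall i, p i = 2^-1) ->
  (forall i j omega, 0 < omega ->
    double_integral u i j omega = 2 * pi / omega ^+ 2 * A i j) ->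
  bracket_system p u f Lf =
  (fun t x => f ord0 t x +
    \sum_(i < l) \sum_(j < l | (i < j)%N) A i j *: bracket Lf i j t x).
Proof.
move=> hp dint; apply/funext => t; apply/funext => x; rewrite /bracket_system.
congr (_ + _); apply: lim_near_cst; first exact: norm_hausdorff.
near=> w.
have w0 : 0 < w by near: w; exact: nbhs_pinfty_gt.
apply: eq_bigr => i _; apply: eq_bigr => j _; congr (_ *: _).
rewrite /gamma_ij dint// !hp.
have -> : 2^-1 + 2^-1 = 1 :> R by field.
rewrite powRr1; last exact: ltW.
have pi0 : pi != 0 :> R by rewrite gt_eqF// pi_gt0.
move: pi0; set q := pi => q0; clearbody q.
by field; rewrite (gt_eqF w0) q0.
Unshelve. all: by end_near. Qed.

Lemma solution_lip_primitive (F : field) (M a b : R) (x : R -> 'rV[R]_n) :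
  a < b -> 0 <= M -> (forall t y, `|F t y| <= M * `|y|) ->
  is_solution F `[a, b] x ->
  forall k, lip_primitive a b (fun t => F t (x t) 0 k) (fun t => x t 0 k).
Proof.
move=> ab M0 FM solx k.
have cx j : {within `[a, b], continuous (fun t => `|x t 0 j|)}.
  have [cxj _] := is_primitive_ae_derive ab (solx j).
  by move=> t; apply: cvg_norm; exact: cxj.
have /choice[N HN] : forall j, exists N, forall t, a <= t <= b -> `|x t 0 j| <= N.
  move=> j; have [t0 _ H] := EVT_max (ltW ab) (cx j).
  by exists `|x t0 0 j| => t tI; apply: H; rewrite in_itv.
have xN t : a <= t <= b -> `|x t| <= \sum_j `|N j|.
  move=> tI; apply: row_norm_le => [|j]; first by apply: sumr_ge0.
  rewrite (le_trans (HN j t tI))// (le_trans (ler_norm _))// (bigD1 j)//= lerDl.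
  by apply: sumr_ge0.
apply: (is_primitive_lip ab (solx k)) => t tI.
apply: (le_trans (row_norm_ge _ _)); apply: (le_trans (FM _ _)).
by apply: ler_wpM2l => //; exact: xN.
Qed.

Lemma solution_growth (F : field) (M a b : R) (x : R -> 'rV[R]_n) :
  a < b -> 0 <= M -> (forall t y, `|F t y| <= M * `|y|) ->
  is_solution F `[a, b] x ->
  forall t, a <= t <= b -> `|x t| <= expR (M * (t - a)) * `|x a|.
Proof.
move=> ab M0 FM solx t tI.
have vD r : a <= r <= b -> `|F r (x r)| <= M * `|x r| + 0 by rewrite addr0.
have := vector_gronwall M0 (lexx 0) (solution_lip_primitive ab M0 FM solx) vD tI.
by rewrite mul0r addr0.
Qed.

(** A crude bound that worsens with the frequency; it serves to control trajectories
    between samples once the frequencies are known to be bounded. *)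
Lemma oscillating_growth (K omega : R) (p : 'I_l -> R) (u : 'I_l -> R -> R)
    (f : 'I_l.+1 -> field) :
  0 <= omega -> (forall i, p i = 2^-1) -> (forall i t, `|u i t| <= 1) ->
  0 <= K -> (forall i, lipschitz_field K (f i)) ->
  forall t y, `|oscillating_system p u f omega t y| <=
    (1 + l%:R * Num.sqrt omega) * K * `|y|.
Proof.
move=> w0 hp u1 K0 lf t y; rewrite /oscillating_system.
apply: (le_trans (ler_normD _ _)); rewrite mulrDl mulrDl mul1r lerD//.
  exact: lipschitz_field_norm (lf _).
apply: (le_trans (ler_norm_sum _ _ _)).
have H i : `|(omega `^ p i * u i (omega * t)) *: f (lift ord0 i) t y| <=
    Num.sqrt omega * (K * `|y|).
  rewrite normrZ hp powR12_sqrt// normrM (ger0_norm (sqrtr_ge0 _)).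
  apply: ler_pM; rewrite ?mulr_ge0 ?sqrtr_ge0//.
    by rewrite -[leRHS]mulr1 ler_wpM2l// sqrtr_ge0.
  exact: lipschitz_field_norm (lf _).
apply: (le_trans (ler_sum _ (fun i _ => H i))).
by rewrite sumr_const card_ord -[leLHS]mulr_natl !mulrA.
Qed.

(** The computation of z' uses the chain rule for the f_i and the L_(f_j) f_i along x.
    Writing s = sqrt omega, the input s u_j cancels against s^-1 omega u_j f_j; the
    order 1 terms U_i u_j L_(f_j) f_i, which come from the derivative of
    s^-1 U_i f_i, cancel against the derivative of s^-2 W_ij, up to A_ij. What is left
    carries a factor s^-1, since the inputs in the derivatives of the W_ij terms only
    contribute one factor s against s^-2. *)
Lemma near_identity_transform (K C : R) (p : 'I_l -> R) (u : 'I_l -> R -> R)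
    (f df : 'I_l.+1 -> field) (Lf dLf : 'I_l.+1 -> 'I_l.+1 -> field)
    (LLf : 'I_l.+1 -> 'I_l.+1 -> 'I_l.+1 -> field)
    (U : 'I_l -> R -> R) (W : 'I_l -> 'I_l -> R -> R) (A : 'I_l -> 'I_l -> R) :
  (forall i, p i = 2^-1) -> (forall i t, `|u i t| <= 1) ->
  0 <= K -> 0 <= C ->
  (forall i j, lipschitz_field K (Lf j i) /\ lipschitz_field K (dLf j i)) ->
  (forall i, lipschitz_field K (f i) /\ lipschitz_field K (df i)) ->
  (forall i j m, lipschitz_field K (LLf m j i)) ->
  (forall i, is_partial1 (f i) (df i)) ->
  (forall i j, is_lie_derivative (f j) (f i) (Lf j i)) ->
  (forall i j, is_partial1 (Lf j i) (dLf j i)) ->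
  (forall i j m, is_lie_derivative (f m) (Lf j i) (LLf m j i)) ->
  (forall i a b, lip_primitive a b (u i) (U i)) ->
  (forall i j a b, lip_primitive a b (fun t => U i t * u j t - A i j) (W i j)) ->
  (forall i t, `|U i t| <= C) -> (forall i j t, `|W i j t| <= C) ->
  (forall i j, A j i = - A i j) ->
  exists2 B : R, 0 <= B &
  forall (omega a b : R) (x : R -> 'rV[R]_n), 1 <= omega -> a < b ->
  is_solution (oscillating_system p u f omega) `[a, b] x ->
  exists z v : R -> 'rV[R]_n,
    (forall k, lip_primitive a b (fun t => v t 0 k) (fun t => z t 0 k)) /\
    forall t, a <= t <= b ->
      `|z t - x t| <= B / Num.sqrt omega * `|x t| /\
      `|v t - (f ord0 t (x t) +
         \sum_(i < l) \sum_(j < l | (i < j)%N) A i j *: bracket Lf i j t (x t))|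
        <= B / Num.sqrt omega * `|x t|.
Proof.
move=> hp u1 K0 C0 lL lf lLL dfP LfP dLfP LLfP HU HW UC WC Aanti.
pose L : R := l%:R.
have L0 : 0 <= L by rewrite ler0n.
pose B := L * (C * (2 * K)) + L * (L * (C * (2 * K + L * K))).
have B0 : 0 <= B.
  have K20 : 0 <= 2 * K by rewrite mulr_ge0.
  have LK0 : 0 <= L * K by rewrite mulr_ge0.
  by rewrite /B addr_ge0// !mulr_ge0// addr_ge0.
exists B => // omega a b x w1 ab solx.
have w0 : 0 < omega by lra.
pose s := Num.sqrt omega.
have s1 : 1 <= s by rewrite -[1](@sqrtr1 R) ler_wsqrtr.
have s0 : 0 < s by lra.
have ss : omega = s * s by rewrite -expr2 sqr_sqrtr// ltW.
have ps i : omega `^ p i = s by rewrite hp powR12_sqrt// ltW.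
(* The drift is treated as one more field, with input 1 and primitive t. *)
pose c (i : 'I_l.+1) t := if unlift ord0 i is Some j then s * u j (omega * t) else 1.
pose Ci (i : 'I_l.+1) t := if unlift ord0 i is Some j then s^-1 * U j (omega * t) else t.
have LPU i c' d : lip_primitive c' d (fun t => omega * u i (omega * t)) (fun t => U i (omega * t)).
  have := lip_primitive_affine (a := c') (b := d) (c := 0) w0 (HU i _ _).
  by apply: eq_lip_primitive => t _; rewrite addr0.
have LPW i j c' d : lip_primitive c' d
    (fun t => omega * (U i (omega * t) * u j (omega * t) - A i j)) (fun t => W i j (omega * t)).
  have := lip_primitive_affine (a := c') (b := d) (c := 0) w0 (HW i j _ _).
  by apply: eq_lip_primitive => t _; rewrite addr0.
have cP i : lip_primitive a b (c i) (Ci i).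
  rewrite /c /Ci; case: unliftP => [j _|_]; last exact: lip_primitive_id.
  have := lip_primitiveZ s^-1 (LPU j a b).
  by apply: eq_lip_primitive => // t _; rewrite ss; field; rewrite gt_eqF.
have cs i t : `|c i t| <= s.
  rewrite /c; case: unliftP => [j _|_]; last by rewrite normr1.
  by rewrite normrM (ger0_norm (ltW s0)) -[leRHS]mulr1 ler_wpM2l// ltW.
have csum (F : 'I_l.+1 -> R) t : \sum_(i < l.+1) c i t * F i =
    F ord0 + s * \sum_(j < l) u j (omega * t) * F (lift ord0 j).
  rewrite big_ord_recl /c unlift_none mul1r mulr_sumr; congr (_ + _).
  by apply: eq_bigr => j _; rewrite liftK mulrA.
have oscE t k : oscillating_system p u f omega t (x t) 0 k =
    \sum_(i < l.+1) c i t * f i t (x t) 0 k.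
  rewrite csum /oscillating_system mxE summxE mulr_sumr; congr (_ + _).
  by apply: eq_bigr => j _; rewrite mxE ps mulrA.
have s00 : 0 <= s by exact: ltW.
have grow0 : 0 <= (1 + l%:R * Num.sqrt omega) * K.
  by rewrite mulr_ge0// addr_ge0// mulr_ge0.
have LPx k : lip_primitive a b (fun t => \sum_(i < l.+1) c i t * f i t (x t) 0 k)
    (fun t => x t 0 k).
  have := solution_lip_primitive ab grow0 (oscillating_growth (ltW w0) hp u1 K0
    (fun i => (lf i).1)) solx k.
  by apply: eq_lip_primitive => t _; rewrite ?oscE.
(* Coordinate k of the fields along x: P i k for f_i and Q i j k for L_(f_j) f_i, with
   their derivatives P' and Q'. *)
pose P i k t := f (lift ord0 i) t (x t) 0 k.
pose Q i j k t := Lf (lift ord0 j) (lift ord0 i) t (x t) 0 k.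
pose P' i k t := df (lift ord0 i) t (x t) 0 k +
  \sum_(m < l.+1) c m t * Lf m (lift ord0 i) t (x t) 0 k.
pose Q' i j k t := dLf (lift ord0 j) (lift ord0 i) t (x t) 0 k +
  \sum_(m < l.+1) c m t * LLf m (lift ord0 j) (lift ord0 i) t (x t) 0 k.
have LPP i k : lip_primitive a b (P' i k) (P i k).
  exact: (chain_rule K0 s00 ab (lf _).1 (lf _).2 (fun m => (lf m).1) (fun m => (lL _ m).1)
    (dfP _) (fun m => LfP _ m) cP (fun m t _ => cs m t) LPx).
have LPQ i j k : lip_primitive a b (Q' i j k) (Q i j k).
  exact: (chain_rule K0 s00 ab (lL _ _).1 (lL _ _).2 (fun m => (lf m).1) (fun m => lLL _ _ m)
    (dLfP _ _) (fun m => LLfP _ _ m) cP (fun m t _ => cs m t) LPx).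
pose z t : 'rV[R]_n := \row_k (x t 0 k - s^-1 * (\sum_(i < l) U i (omega * t) * P i k t) +
  s^-1 ^+ 2 * (\sum_(i < l) \sum_(j < l) W i j (omega * t) * Q i j k t)).
pose v t : 'rV[R]_n := \row_k (\sum_(i < l.+1) c i t * f i t (x t) 0 k -
  s^-1 * (\sum_(i < l) (U i (omega * t) * P' i k t + P i k t * (omega * u i (omega * t)))) +
  s^-1 ^+ 2 * (\sum_(i < l) \sum_(j < l) (W i j (omega * t) * Q' i j k t +
     Q i j k t * (omega * (U i (omega * t) * u j (omega * t) - A i j))))).
have LPz k : lip_primitive a b (fun t => v t 0 k) (fun t => z t 0 k).
  have S1 := lip_primitive_sum (fun i => lip_primitiveM (LPU i a b) (LPP i k)).
  have S2 := lip_primitive_sum (fun i =>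
    lip_primitive_sum (fun j => lip_primitiveM (LPW i j a b) (LPQ i j k))).
  have := lip_primitiveD (lip_primitiveB (LPx k) (lip_primitiveZ s^-1 S1))
    (lip_primitiveZ (s^-1 ^+ 2) S2).
  by apply: eq_lip_primitive => t _; rewrite mxE.
exists z, v; split => // t tI.
have X0 : 0 <= `|x t| by [].
have si0 : 0 <= s^-1 by rewrite invr_ge0.
have si1 : s^-1 <= 1 by rewrite invf_le1.
have si2 : s^-1 ^+ 2 <= s^-1 by rewrite expr2 -[leRHS]mulr1 ler_wpM2l.
have si20 : 0 <= s^-1 ^+ 2 by rewrite exprn_ge0.
have fb g k : lipschitz_field K g -> `|g t (x t) 0 k| <= K * `|x t|.
  by move=> lg; rewrite (le_trans (row_norm_ge _ _))//; exact: lipschitz_field_norm lg.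
(* Both bounds to prove concern an expression - s^-1 S1 + s^-2 S2 in which S1 is of
   order 1 and S2 at most of order s. *)
have comb (S1 S2 y1 y2 : R) : 0 <= y1 -> `|S1| <= y1 * `|x t| -> `|S2| <= s * (y2 * `|x t|) ->
    0 <= y2 -> y1 + y2 <= B ->
    `|- (s^-1 * S1) + s^-1 ^+ 2 * S2| <= B / s * `|x t|.
  move=> y10 b1 b2 y20 yB.
  rewrite (le_trans (ler_normD _ _))// normrN [`|s^-1 * _|]normrM [`|s^-1 ^+ 2 * _|]normrM.
  rewrite (ger0_norm si0) (ger0_norm si20).
  apply: (@le_trans _ _ (s^-1 * (y1 * `|x t|) + s^-1 * (y2 * `|x t|))).
    apply: lerD; first exact: ler_wpM2l.
    apply: (le_trans (ler_wpM2l si20 b2)).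
    by rewrite expr2 -mulrA [s^-1 * (s * _)]mulrA mulVf ?gt_eqF// mul1r.
  rewrite -mulrDr -mulrDl mulrA; apply: ler_wpM2r => //.
  by rewrite mulrC ler_wpM2r.
have sumb (F : 'I_l -> R) M : (forall i, `|F i| <= M) -> `|\sum_(i < l) F i| <= L * M.
  by move=> FM; rewrite /L -[X in X%:R]card_ord; exact: sum_norm_le.
have C2K : 0 <= L * (C * (2 * K)) by rewrite !mulr_ge0.
have CLK : 0 <= L * (L * (C * (2 * K + L * K))).
  by rewrite !mulr_ge0// addr_ge0 ?mulr_ge0.
split.
- have Bs : 0 <= B / s * `|x t| by rewrite !mulr_ge0.
  apply: row_norm_le => // k.
  have -> : (z t - x t) 0 k = - (s^-1 * (\sum_(i < l) U i (omega * t) * P i k t)) +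
     s^-1 ^+ 2 * (\sum_(i < l) \sum_(j < l) W i j (omega * t) * Q i j k t).
    by rewrite !mxE; ring.
  apply: (comb _ _ (L * (C * K)) (L * (L * (C * K)))).
  + by rewrite !mulr_ge0.
  + rewrite -!mulrA; apply: (sumb _ _) => i; rewrite normrM ler_pM// fb//.
    exact: (lf _).1.
  + apply: (@le_trans _ _ (L * (L * (C * K)) * `|x t|)).
      rewrite -!mulrA; apply: (sumb _ _) => i; apply: (sumb _ _) => j.
      by rewrite normrM ler_pM// fb//; exact: (lL _ _).1.
    by rewrite ler_peMl// !mulr_ge0.
  + by rewrite !mulr_ge0.
  + have CK : 0 <= C * K by rewrite mulr_ge0.
    have CLK' : 0 <= C * (L * K) by rewrite !mulr_ge0.
    have LK0 : 0 <= L * K by rewrite mulr_ge0.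
    rewrite /B; apply: lerD; first by rewrite ler_wpM2l//; clear -K0 CK; lra.
    by rewrite !ler_wpM2l//; clear -K0 LK0 CK CLK'; lra.
- have Bs : 0 <= B / s * `|x t| by rewrite !mulr_ge0.
  apply: row_norm_le => // k.
  pose R1 i := df (lift ord0 i) t (x t) 0 k + Lf ord0 (lift ord0 i) t (x t) 0 k.
  have P'E i : P' i k t = R1 i + s * \sum_(j < l) u j (omega * t) * Q i j k t.
    by rewrite /P' csum addrA.
  pose av := f ord0 t (x t) +
    \sum_(i < l) \sum_(j < l | (i < j)%N) A i j *: bracket Lf i j t (x t).
  have FE : av 0 k = f ord0 t (x t) 0 k - \sum_(i < l) \sum_(j < l) A i j * Q i j k t.
    rewrite /av mxE summxE -antisymmetric_sum//; congr (_ + _).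
    apply: eq_bigr => i _; rewrite summxE; apply: eq_bigr => j _.
    by rewrite /bracket !mxE.
  rewrite -/av.
  have -> : (v t - av) 0 k = - (s^-1 * (\sum_(i < l) U i (omega * t) * R1 i)) +
     s^-1 ^+ 2 * (\sum_(i < l) \sum_(j < l) W i j (omega * t) * Q' i j k t).
    rewrite mxE [(- av) 0 k]mxE FE mxE csum.
    (* Expanding E1 and E2 isolates the terms in s and omega that cancel. *)
    have E1 : \sum_(i < l) (U i (omega * t) * P' i k t + P i k t * (omega * u i (omega * t))) =
      \sum_(i < l) U i (omega * t) * R1 i +
      s * (\sum_(i < l) \sum_(j < l) U i (omega * t) * u j (omega * t) * Q i j k t) +
      omega * \sum_(i < l) u i (omega * t) * P i k t.
      rewrite !mulr_sumr -!big_split/=; apply: eq_bigr => i _.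
      rewrite P'E mulrDr.
      have -> : U i (omega * t) * (s * \sum_(j < l) u j (omega * t) * Q i j k t) =
        s * \sum_(j < l) U i (omega * t) * u j (omega * t) * Q i j k t.
        rewrite mulrCA; congr (_ * _); rewrite mulr_sumr.
        by apply: eq_bigr => j _; rewrite mulrA.
      by ring.
    have E2 : \sum_(i < l) \sum_(j < l) (W i j (omega * t) * Q' i j k t +
       Q i j k t * (omega * (U i (omega * t) * u j (omega * t) - A i j))) =
      \sum_(i < l) \sum_(j < l) W i j (omega * t) * Q' i j k t +
      omega * (\sum_(i < l) \sum_(j < l) U i (omega * t) * u j (omega * t) * Q i j k t) -
      omega * (\sum_(i < l) \sum_(j < l) A i j * Q i j k t).
      rewrite !mulr_sumr -sumrN -!big_split/=; apply: eq_bigr => i _.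
      rewrite !mulr_sumr -sumrN -!big_split/=; apply: eq_bigr => j _.
      by ring.
    rewrite E1 E2 ss.
    by field; rewrite gt_eqF.
  apply: (comb _ _ (L * (C * (2 * K))) (L * (L * (C * (2 * K + L * K))))) => //.
  + rewrite -!mulrA; apply: (sumb _ _) => i; rewrite normrM ler_pM// mulrA.
    rewrite (le_trans (ler_normD _ _))// mulr2n mulrDl mul1r mulrDl lerD//.
      exact: fb (lf _).2.
    exact: fb (lL _ _).1.
  + have LK0 : 0 <= L * K by rewrite mulr_ge0.
    have Q'b i j : `|Q' i j k t| <= s * ((2 * K + L * K) * `|x t|).
      rewrite /Q' csum addrA.
      have b0 : `|dLf (lift ord0 j) (lift ord0 i) t (x t) 0 k +
          LLf ord0 (lift ord0 j) (lift ord0 i) t (x t) 0 k| <= 2 * K * `|x t|.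
        rewrite (le_trans (ler_normD _ _))// -mulrA [2 * _]mulr_natl mulr2n lerD//.
          exact: fb (lL _ _).2.
        exact: fb (lLL _ _ _).
      have b1 : `|\sum_(m < l) u m (omega * t) *
          LLf (lift ord0 m) (lift ord0 j) (lift ord0 i) t (x t) 0 k| <= L * K * `|x t|.
        rewrite -mulrA; apply: (sumb _ _) => m; rewrite normrM -[leRHS]mul1r ler_pM//.
        exact: fb (lLL _ _ _).
      rewrite (le_trans (ler_normD _ _))// normrM (ger0_norm s00).
      rewrite mulrDl mulrDr; apply: lerD; last by rewrite ler_wpM2l.
      by apply: (le_trans b0); rewrite ler_peMl// !mulr_ge0.
    rewrite [leRHS](_ : _ = L * (L * (C * (s * ((2 * K + L * K) * `|x t|))))); last by ring.
    by apply: (sumb _ _) => i; apply: (sumb _ _) => j; rewrite normrM ler_pM.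
Qed.

End LieBracketAveraging.

(** * Averaging estimate on one sampling interval *)

Section AveragingEstimate.
Context {R : realType} {n l : nat}.
Local Notation field := (R -> 'rV[R]_n -> 'rV[R]_n).

(** The transformed trajectory z stays within B / sqrt omega |x| of x and solves the
    averaged system up to an error of the same size. For omega >= w1 this distance is
    at most |x| / 2, so |x| <= 2 |z| and the error can be expressed in z. Gronwall's
    inequality bounds the difference of z and the averaged solution xb, and
    x = xb + (z - xb) - (z - x). *)
Lemma averaging_estimate (p : 'I_l -> R) (u : 'I_l -> R -> R)
    (f : 'I_l.+1 -> field) (Lf : 'I_l.+1 -> 'I_l.+1 -> field) (alpha beta tf : R) :
  (forall i, p i = 2^-1) -> A1 u -> A2 f Lf ->
  1 <= alpha -> 0 < beta -> 0 < tf ->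
  exponentially_stable_with alpha beta (bracket_system p u f Lf) ->
  exists C w1 : R, [/\ 0 <= C, 1 <= w1 & forall omega a (x : R -> 'rV[R]_n),
    w1 <= omega -> is_solution (oscillating_system p u f omega) `[a, a + tf] x ->
    forall t, a <= t <= a + tf ->
      enorm (x t) <= (alpha * expR (- beta * (t - a)) + C / Num.sqrt omega) * enorm (x a)].
Proof.
move=> hp hA1 [L [df [dLf [LLf [L0 H]]]]] alpha1 beta0 tf0 stab.
pose K := L * Num.sqrt n%:R.
have K0 : 0 <= K by rewrite mulr_ge0 ?sqrtr_ge0// ltW.
have lip (g : field) : regular_field L g -> lipschitz_field K g.
  by move=> rg; exact: (regular_lipschitz (ltW L0) rg).
have u1 i t : `|u i t| <= 1 by have [] := hA1 i.
have [U [W [A [C [[C0 HU] HW [UC WC] Aanti dint]]]]] := averaging_data hA1.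
have lf i : lipschitz_field K (f i) /\ lipschitz_field K (df i).
  by have [_ [r1 r2 _ _ _]] := H i ord0 ord0; split; exact: lip.
have lL i j : lipschitz_field K (Lf j i) /\ lipschitz_field K (dLf j i).
  by have [_ [_ _ r1 r2 _]] := H i j ord0; split; exact: lip.
have lLL i j m : lipschitz_field K (LLf m j i).
  by have [_ [_ _ _ _ r]] := H i j m; exact: lip.
have dfP i : is_partial1 (f i) (df i) by have [[]] := H i ord0 ord0.
have LfP i j : is_lie_derivative (f j) (f i) (Lf j i) by have [[]] := H i j ord0.
have dLfP i j : is_partial1 (Lf j i) (dLf j i) by have [[]] := H i j ord0.
have LLfP i j m : is_lie_derivative (f m) (Lf j i) (LLf m j i) by have [[]] := H i j m.
have [B B0 transform] := near_identity_transform hp u1 K0 C0 lL lf lLL dfP LfP dLfP LLfP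
  HU HW UC WC Aanti.
pose F : field := fun t x => f ord0 t x +
  \sum_(i < l) \sum_(j < l | (i < j)%N) A i j *: bracket Lf i j t x.
have FE : bracket_system p u f Lf = F by exact: bracket_system_averaged.
have [KF KF0 lF] : exists2 KF, 0 <= KF & lipschitz_field KF F.
  pose M := \sum_(i < l) \sum_(j < l) `|A i j|.
  have M0 : 0 <= M by apply: sumr_ge0 => i _; apply: sumr_ge0.
  have AM i j : `|A i j| <= M.
    rewrite /M (bigD1 i)//= (bigD1 j)//= -addrA lerDl addr_ge0//.
      by apply: sumr_ge0.
    by apply: sumr_ge0 => i' _; apply: sumr_ge0.
  have lB i j : lipschitz_field (M * (K + `|-1| * K)) (fun t x => A i j *: bracket Lf i j t x).
    have lb : lipschitz_field (K + `|-1| * K) (bracket Lf i j).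
      have := lipschitz_fieldD (lL (lift ord0 j) (lift ord0 i)).1
        (lipschitz_fieldZ (-1) (lL (lift ord0 i) (lift ord0 j)).1).
      congr lipschitz_field; apply/funext => t; apply/funext => x.
      by rewrite /bracket scaleN1r.
    apply: lipschitz_fieldW (lipschitz_fieldZ (A i j) lb).
    by rewrite ler_wpM2r// addr_ge0// mulr_ge0.
  have Kb0 : 0 <= M * (K + `|-1| * K) by rewrite mulr_ge0// addr_ge0// mulr_ge0.
  have lS (i : 'I_l) := lipschitz_field_sum (fun j : 'I_l => (i < j)%N) Kb0 (lB i).
  have Kc0 : 0 <= #|'I_l|%:R * (M * (K + `|-1| * K)) by rewrite mulr_ge0.
  have := lipschitz_fieldD (lf ord0).1 (lipschitz_field_sum xpredT Kc0 lS).
  by exists (K + #|'I_l|%:R * (#|'I_l|%:R * (M * (K + `|-1| * K)))) => //; rewrite addr_ge0// mulr_ge0.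
have [_ FL _] := lF.
(* d C3 bounds the defect of z in the averaged system relative to |z|, and d C4 the
   distance from z to xb relative to the initial value, where d = 1 / sqrt omega. *)
pose C3 := 2 * B * (1 + KF).
have C30 : 0 <= C3 by rewrite !mulr_ge0// addr_ge0.
pose G := expR ((KF + C3) * tf).
have G0 : 0 <= G by exact: expR_ge0.
have alpha0 : 0 <= alpha by exact: le_trans alpha1.
pose C4 := G * (B + C3 * alpha * tf).
have tf00 := ltW tf0.
have C3a : 0 <= C3 * alpha * tf by apply: mulr_ge0 => //; exact: mulr_ge0.
have C40 : 0 <= C4 by apply: mulr_ge0 => //; exact: addr_ge0.
pose C1 := Num.sqrt n%:R * (C4 + 2 * B * (C4 + alpha)).
have C10 : 0 <= C1.
  apply: mulr_ge0; first exact: sqrtr_ge0.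
  apply: addr_ge0 => //; apply: mulr_ge0; first exact: mulr_ge0.
  exact: addr_ge0.
pose w1 := (2 * B + 1) ^+ 2.
have B21 : 1 <= 2 * B + 1 by rewrite lerDr mulr_ge0.
exists C1, w1; split => //; first by rewrite exprn_ege1.
move=> omega a x w1w solx.
have aatf : a < a + tf by rewrite ltrDl.
have omega1 : 1 <= omega by apply: le_trans w1w; rewrite exprn_ege1.
pose s := Num.sqrt omega.
have s1 : 1 <= s by rewrite -[1](@sqrtr1 R) ler_wsqrtr.
have s0 : 0 < s by apply: lt_le_trans s1.
have sB : 2 * B + 1 <= s.
  have -> : 2 * B + 1 = Num.sqrt w1 by rewrite sqrtr_sqr ger0_norm// (le_trans _ B21).
  by rewrite ler_wsqrtr.
have [z [v [LPz zv]]] := transform omega a (a + tf) x omega1 aatf solx.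
pose d := s^-1.
have d0 : 0 <= d by rewrite invr_ge0 ltW.
have d1 : d <= 1 by rewrite invf_le1.
have dB : B * d <= 2^-1.
  by rewrite ler_pdivrMr// mulrC ler_pdivlMr// mulrC; clear -sB; lra.
have [xb [xb0 solxb LPxb]] := picard_global a (x a) KF0 lF.
rewrite -FE in solxb.
have xbe := stab a (x a) xb solxb xb0.
set e := enorm (x a) in xbe *.
have e0 : 0 <= e by exact: sqrtr_ge0.
have exb t : a <= t -> `|xb t| <= alpha * e.
  move=> at_; apply: (le_trans (norm_le_enorm _)); apply: (le_trans (xbe t at_)).
  rewrite -[leRHS]mulr1 ler_wpM2l ?mulr_ge0//.
  rewrite -expR0 ler_expR mulNr oppr_le0.
  by apply: mulr_ge0; [exact: ltW|rewrite subr_ge0].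
have xz t : a <= t <= a + tf -> `|x t| <= 2 * `|z t| /\ `|z t - x t| <= B * d * `|x t|.
  move=> tI; have [b1 _] := zv t tI; split => //.
  have : `|z t - x t| <= 2^-1 * `|x t| by apply: (le_trans b1); rewrite ler_wpM2r.
  have := ler_normD (z t) (x t - z t); rewrite addrC subrK distrC; clear; lra.
pose D t := z t - xb t.
pose vD t := v t - F t (xb t).
have HD k : lip_primitive a (a + tf) (fun t => vD t 0 k) (fun t => D t 0 k).
  have := lip_primitiveB (LPz k) (LPxb (a + tf) k).
  by apply: eq_lip_primitive => t _; rewrite !mxE.
have zD t : z t = D t + xb t by rewrite /D subrK.
have vDb t : a <= t <= a + tf -> `|vD t| <= (KF + C3) * `|D t| + d * C3 * (alpha * e).
  move=> tI; have [_ b2] := zv t tI; rewrite -/(F t (x t)) in b2.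
  have [xz1 xz2] := xz t tI.
  have [at_ _] := andP tI.
  have -> : vD t = (v t - F t (x t)) + (F t (x t) - F t (z t)) + (F t (z t) - F t (xb t)).
    by rewrite /vD; apply/rowP => k; rewrite !mxE; ring.
  have b3 : `|F t (x t) - F t (z t)| <= KF * (B * d * `|x t|).
    by apply: (le_trans (FL _ _ _)); rewrite ler_wpM2l// distrC.
  have b4 : `|F t (z t) - F t (xb t)| <= KF * `|D t| by exact: FL.
  have b5 : `|z t| <= `|D t| + alpha * e.
    by rewrite zD (le_trans (ler_normD _ _))// lerD2l exb.
  have D0 : 0 <= `|D t| by [].
  have Bd0 : 0 <= B * d by rewrite mulr_ge0.
  have b6 : B * d * `|x t| + KF * (B * d * `|x t|) <= d * C3 * (`|D t| + alpha * e).
    have -> : B * d * `|x t| + KF * (B * d * `|x t|) = B * d * (1 + KF) * `|x t| by ring.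
    have -> : d * C3 * (`|D t| + alpha * e) = B * d * (1 + KF) * (2 * (`|D t| + alpha * e)).
      by rewrite /C3; ring.
    rewrite ler_wpM2l ?mulr_ge0 ?addr_ge0//.
    by apply: (le_trans xz1); rewrite ler_wpM2l.
  have b7 : d * C3 * `|D t| <= C3 * `|D t|.
    by rewrite ler_wpM2r// -[leRHS]mul1r ler_wpM2r.
  apply: (le_trans (ler_normD _ _)).
  apply: (le_trans (lerD (le_trans (ler_normD _ _) (lerD b2 b3)) b4)).
  apply: (le_trans (lerD b6 (lexx _))).
  by rewrite mulrDr mulrDl; clear -b7; lra.
have KC0 : 0 <= KF + C3 by rewrite addr_ge0.
have eps0 : 0 <= d * C3 * (alpha * e) by apply: mulr_ge0; exact: mulr_ge0.
have Db t : a <= t <= a + tf -> `|D t| <= d * C4 * e.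
  move=> tI; apply: (le_trans (vector_gronwall KC0 eps0 HD vDb tI)).
  have [at_ ttf] := andP tI.
  have ta : 0 <= t - a <= tf by rewrite subr_ge0 at_ lerBlDl.
  have [ta0 tatf] := andP ta.
  have Da : `|D a| <= B * d * e.
    have aI : a <= a <= a + tf by rewrite lexx ltW.
    rewrite /D xb0; apply: (le_trans (xz a aI).2).
    by rewrite ler_wpM2l ?mulr_ge0// norm_le_enorm.
  have -> : d * C4 * e = G * (B * d * e + d * C3 * (alpha * e) * tf) by rewrite /C4; ring.
  apply: ler_pM; first exact: expR_ge0.
  - by rewrite addr_ge0// mulr_ge0.
  - by rewrite ler_expR ler_wpM2l.
  - by apply: lerD => //; rewrite ler_wpM2l.
move=> t tI.
have [at_ ttf] := andP tI.
have -> : x t = xb t + (x t - xb t) by rewrite addrC subrK.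
apply: (le_trans (ler_enormD _ _)); rewrite mulrDl; apply: lerD.
  by rewrite mulrAC; exact: xbe.
apply: (le_trans (enorm_le_norm _)).
have [xz1 xz2] := xz t tI.
have zb : `|z t| <= d * C4 * e + alpha * e.
  by rewrite zD (le_trans (ler_normD _ _))// lerD ?Db ?exb.
have d4 : d * C4 * e <= C4 * e.
  by rewrite ler_wpM2r// -[leRHS]mul1r ler_wpM2r.
have xxb : `|x t - xb t| <= d * ((C4 + 2 * B * (C4 + alpha)) * e).
  have -> : x t - xb t = D t - (z t - x t).
    by rewrite /D; apply/rowP => k; rewrite !mxE; ring.
  apply: (le_trans (ler_normB _ _)).
  have : B * d * `|x t| <= B * d * (2 * (C4 * e + alpha * e)).
    rewrite ler_wpM2l ?mulr_ge0//; apply: (le_trans xz1); rewrite ler_wpM2l//.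
    by apply: (le_trans zb); rewrite lerD2r.
  have := Db t tI.
  have -> : d * ((C4 + 2 * B * (C4 + alpha)) * e) =
    d * C4 * e + B * d * (2 * (C4 * e + alpha * e)) by ring.
  by clear -xz2; lra.
apply: (le_trans (ler_wpM2l (sqrtr_ge0 _) xxb)).
rewrite le_eqVlt; apply/orP; left; apply/eqP.
by rewrite /C1 -/d; ring.
Qed.

End AveragingEstimate.

(** * Sampled adaptation of the frequency *)

Section Sampling.
Context {R : realType}.
Local Notation cmu := (@completed_lebesgue_measure R).

Lemma is_primitiveS (I J : set R) (v y : R -> R) : J `<=` I ->
  is_primitive I v y -> is_primitive J v y.
Proof. by move=> JI Hy a b Ja Jb; apply: Hy; exact: JI. Qed.

Lemma is_primitive_ge (a b c : R) (v y : R -> R) : a <= b ->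
  is_primitive `[a, b] v y -> (forall t, a <= t <= b -> c <= v t) ->
  c * (b - a) <= y b - y a.
Proof.
move=> ab Hy cv.
have aI : `[a, b]%classic a by rewrite /= in_itv/= lexx.
have bI : `[a, b]%classic b by rewrite /= in_itv/= lexx ab.
have [iv ->] := Hy _ _ aI bI ab; rewrite [leRHS]addrC addKr.
have mI := borel_cara (measurable_itv `[a, b]).
have -> : c * (b - a) = \int[cmu]_(s in `[a, b]) cst c s.
  rewrite Rintegral_cst//; congr (_ * _).
  by rewrite [X in fine X](_ : _ = (b - a)%:E)//; exact: completed_itv.
apply: le_Rintegral => //.
exact: (bounded_integrable (M := `|c|) (measurable_cst c)).
Qed.

Lemma is_primitive_le (a b c : R) (v y : R -> R) : a <= b ->
  is_primitive `[a, b] v y -> (forall t, a <= t <= b -> `|v t| <= c) ->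
  y b - y a <= c * (b - a).
Proof.
move=> ab Hy vc.
have aI : `[a, b]%classic a by rewrite /= in_itv/= lexx.
have bI : `[a, b]%classic b by rewrite /= in_itv/= lexx ab.
have [iv ->] := Hy _ _ aI bI ab; rewrite [leLHS]addrC addKr.
exact: (le_trans (ler_norm _) (completed_Rintegral_le ab iv vc)).
Qed.

End Sampling.

Theorem lemma1 (R : realType) (n l : nat) (hl : (1 <= l)%N)
  (p : 'I_l -> R) (u : 'I_l -> R -> R)
  (f : 'I_l.+1 -> R -> 'rV[R]_n -> 'rV[R]_n)
  (Lf : 'I_l.+1 -> 'I_l.+1 -> R -> 'rV[R]_n -> 'rV[R]_n)
  (hp : forall i, p i = 2^-1)
  (hA1 : A1 u) (hA2 : A2 f Lf) (hA3 : A3 p u Lf)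
  (alpha beta : R) (halpha : 1 <= alpha) (hbeta : 0 < beta)
  (hstable : exponentially_stable_with alpha beta (bracket_system p u f Lf))
  (tf : R) (htf : 0 < tf)
  (hD : exists D : R, 0 < D /\ 0 < alpha * expR (- beta * tf) + D < 1)
  (t0 : R) (x0 : 'rV[R]_n) (w0 : R) (hw0 : 0 < w0)
  (x : R -> 'rV[R]_n) (w : R -> R)
  (hxw : sampled_trajectory p u f t0 tf x0 w0 x w) :
  (enorm (x t) @[t --> +oo] --> (0 : R)) /\
  (exists M : R, forall t, t0 <= t -> `|w t| <= M) /\
  (exists winf : R, w t @[t --> +oo] --> winf).
Proof.
have [_ wt0 traj] := hxw.
pose tk (k : nat) := t0 + k%:R * tf.
have tkS k : tk k.+1 = tk k + tf by rewrite /tk -natr1; ring.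
have tk_lt k : tk k < tk k.+1 by rewrite tkS ltrDl.
have solk k : is_solution (oscillating_system p u f (w (tk k))) `[tk k, tk k.+1] x.
  by have [] := traj k.
have wk k : is_primitive `[tk k, tk k.+1] (fun t => enorm (x t) ^+ 2) w.
  by have [] := traj k.
have en0 t : 0 <= enorm (x t) by exact: sqrtr_ge0.
have wmono k s t : tk k <= s -> s <= t -> t <= tk k.+1 -> w s <= w t.
  move=> ks st tk1.
  have sub : `[s, t] `<=` `[tk k, tk k.+1] by apply: subset_itv; rewrite bnd_simp.
  have := is_primitive_ge (c := 0) st (is_primitiveS sub (wk k)).
  by rewrite mul0r subr_ge0; apply => r _; exact: sqr_ge0.
have wkS k : w (tk k) <= w (tk k.+1) by apply: (wmono k) => //; exact: ltW.
have wk_mono k m : (k <= m)%N -> w (tk k) <= w (tk m).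
  elim: m => [|m IH]; first by rewrite leqn0 => /eqP ->.
  by rewrite leq_eqVlt => /predU1P[->//|]; rewrite ltnS => /IH/le_trans; exact.
have tk0 : tk 0%N = t0 by rewrite /tk mul0r addr0.
have wk_ge k : w0 <= w (tk k) by rewrite -wt0 -tk0; exact: wk_mono.
have wk0 k : 0 < w (tk k) by exact: lt_le_trans (wk_ge k).
have locate t : t0 <= t -> exists k, tk k <= t < tk k.+1.
  move=> tt0; exists (Num.truncn ((t - t0) / tf)).
  have q0 : 0 <= (t - t0) / tf by rewrite divr_ge0 ?subr_ge0// ltW.
  have /andP[h1 h2] := truncn_itv q0.
  rewrite /tk -lerBrDl -ler_pdivlMr// h1/= -ltrBlDl -ltr_pdivrMr//.
(* Either all samples of w stay below w2, or the averaging estimate applies from a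
   sample k0 above w2 on, since w is nondecreasing. *)
have [M wM] : exists M, forall k, w (tk k) <= M.
  have [C [w1 [C0 w11 avg]]] := averaging_estimate hp hA1 hA2 halpha hbeta htf hstable.
  have [D [D0 /andP[q0 q1]]] := hD.
  set q := alpha * _ + D in q0 q1.
  pose w2 := Num.max w1 ((C / D) ^+ 2).
  have [small|/existsNP[k0 /negP]] := pselect (forall k, w (tk k) <= w2); first by exists w2.
  rewrite -ltNge => big.
  have alpha0 : 0 <= alpha by exact: le_trans halpha.
  (* The threshold makes the averaging error at most the margin D. *)
  have CD omega : w2 <= omega -> C / Num.sqrt omega <= D.
    move=> w2w; have cd0 : 0 <= C / D by rewrite divr_ge0// ltW.
    have h : C / D <= Num.sqrt omega.
      rewrite -[leLHS]ger0_norm// -sqrtr_sqr ler_wsqrtr//.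
      by apply: le_trans w2w; rewrite le_max lexx orbT.
    have omega0 : 0 < omega.
      apply: lt_le_trans w2w; rewrite lt_max; apply/orP; left.
      exact: lt_le_trans w11.
    by rewrite ler_pdivrMr ?sqrtr_gt0// mulrC -ler_pdivrMr.
  have est k t : (k0 <= k)%N -> tk k <= t <= tk k.+1 ->
      enorm (x t) <= (alpha * expR (- beta * (t - tk k)) + D) * enorm (x (tk k)).
    move=> kk; rewrite tkS => tI.
    have w2k : w2 <= w (tk k) by apply: (le_trans (ltW big)); exact: wk_mono.
    have w1k : w1 <= w (tk k) by apply: le_trans w2k; rewrite le_max lexx.
    have solk' := solk k; rewrite tkS in solk'.
    apply: (le_trans (avg _ _ _ w1k solk' t tI)).
    by rewrite ler_wpM2r// lerD2l CD.
  pose e k := enorm (x (tk k)).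
  have eS k : (k0 <= k)%N -> e k.+1 <= q * e k.
    move=> kk; have := est k (tk k.+1) kk.
    by rewrite lexx (ltW (tk_lt k)) => /(_ isT); rewrite {2}tkS [tk k + tf]addrC addrK.
  have AD0 : 0 <= alpha + D by rewrite addr_ge0// ltW.
  have wS k : (k0 <= k)%N -> w (tk k.+1) - w (tk k) <= ((alpha + D) * e k) ^+ 2 * tf.
    move=> kk.
    have -> : tf = tk k.+1 - tk k by rewrite tkS addrC addKr.
    apply: (is_primitive_le (ltW (tk_lt k)) (wk k)) => t tI.
    have ek0 : 0 <= (alpha + D) * e k by apply: mulr_ge0 => //; exact: en0.
    rewrite ger0_norm ?sqr_ge0// ler_pXn2r ?nnegrE//.
    apply: (le_trans (est k t kk tI)); apply: ler_wpM2r; first exact: en0.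
    rewrite lerD2r.
    rewrite -[leRHS]mulr1 ler_wpM2l// -expR0 ler_expR mulNr oppr_le0.
    by apply: mulr_ge0; [exact: ltW|rewrite subr_ge0; case/andP: tI].
  have q20 : 0 < 1 - q ^+ 2 by rewrite subr_gt0 exprn_ilt1// ltW.
  (* A is chosen so that the decrease of A e^2 pays for the increase of w. *)
  pose A := (alpha + D) ^+ 2 * tf / (1 - q ^+ 2).
  have A0 : 0 <= A by rewrite divr_ge0 ?mulr_ge0 ?sqr_ge0 ?(ltW q20) ?(ltW htf).
  have AE : A * (1 - q ^+ 2) = (alpha + D) ^+ 2 * tf by rewrite /A divfK// gt_eqF.
  have lyap m : w (tk (k0 + m)%N) + A * e (k0 + m)%N ^+ 2 <= w (tk k0) + A * e k0 ^+ 2.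
    elim: m => [|m IH]; first by rewrite addn0.
    apply: le_trans IH; rewrite addnS.
    have kk := leq_addr m k0; set r := (k0 + m)%N in kk *.
    have h1 := wS r kk.
    have h2 : A * e r.+1 ^+ 2 <= A * (q * e r) ^+ 2.
      by rewrite ler_wpM2l// ler_pXn2r ?nnegrE ?mulr_ge0 ?(ltW q0) ?en0// eS.
    have h3 : ((alpha + D) * e r) ^+ 2 * tf + A * (q * e r) ^+ 2 = A * e r ^+ 2.
      by rewrite exprMn mulrAC -AE; ring.
    by lra.
  exists (w (tk k0) + A * e k0 ^+ 2) => k.
  have Ae k' : 0 <= A * e k' ^+ 2 by rewrite mulr_ge0 ?sqr_ge0.
  have [kk|/ltnW kk] := leqP k0 k.
    by have := lyap (k - k0)%N; rewrite subnKC// => h; have := Ae k; lra.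
  have := wk_mono _ _ kk; have := Ae k0; lra.
have w_le t : t0 <= t -> w t <= M.
  move=> /locate[k /andP[kt tk1]]; apply: le_trans (wM k.+1).
  by apply: (wmono k) => //; exact: ltW.
have w_ge k t : tk k <= t -> w (tk k) <= w t.
  move=> kt.
  have tt0 : t0 <= t.
    by apply: le_trans kt; rewrite /tk lerDl mulr_ge0 ?(ltW htf).
  have [m /andP[mt tm]] := locate t tt0.
  have km : (k <= m)%N.
    have := le_lt_trans kt tm; rewrite /tk ltrD2l ltr_pM2r// ltr_nat ltnS.
    by [].
  by apply: (le_trans (wk_mono _ _ km)); apply: (wmono m) => //; exact: ltW.
pose winf := sup (range (fun k => w (tk k))).
have hs : has_sup (range (fun k => w (tk k))).
  by split; [exists (w (tk 0%N)); exists 0%N|exists M => _ [k _ <-]; exact: wM].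
have wk_winf k : w (tk k) <= winf by apply: sup_upper_bound => //; exists k.
have w_winf t : t0 <= t -> w t <= winf.
  move=> /locate[k /andP[kt tk1]]; apply: le_trans (wk_winf k.+1).
  by apply: (wmono k) => //; exact: ltW.
have approach e : 0 < e -> exists k, winf - e < w (tk k).
  by move=> e0; have [_ [k _ <-] ?] := sup_adherent e0 hs; exists k.
have wcvg : w t @[t --> +oo] --> winf.
  apply/cvgrPdist_le => e e0; have [k wke] := approach e e0.
  near=> t.
  have kt : tk k <= t by near: t; apply: nbhs_pinfty_ge; exact: num_real.
  have tt0 : t0 <= t.
    by apply: le_trans kt; rewrite /tk lerDl mulr_ge0 ?(ltW htf).
  rewrite ger0_norm ?subr_ge0 ?w_winf//.
  by have := w_ge k t kt; lra.
split; last first.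
  split; last by exists winf.
  exists M => t tt0; rewrite ger0_norm ?w_le//.
  have := w_ge 0%N t; rewrite tk0 => /(_ tt0); have := hw0; rewrite wt0; lra.
(* The samples of w being bounded by M, the growth rate G of |x| is the same on all
   sampling intervals. *)
have [L [df [dLf [LLf [L0 H]]]]] := hA2.
pose K := L * Num.sqrt n%:R.
have K0 : 0 <= K by rewrite mulr_ge0 ?sqrtr_ge0// ltW.
have lf i : lipschitz_field K (f i).
  by have [_ [r1 _ _ _ _]] := H i ord0 ord0; exact: (regular_lipschitz (ltW L0) r1).
have u1 i t : `|u i t| <= 1 by have [] := hA1 i.
pose G := (1 + l%:R * Num.sqrt M) * K.
have G0 : 0 <= G by rewrite mulr_ge0// addr_ge0// mulr_ge0 ?sqrtr_ge0.
pose E := expR (G * tf).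
have E1 : 1 <= E by rewrite /E -expR0 ler_expR mulr_ge0// ltW.
have E0 : 0 <= E by exact: le_trans E1.
have grow k s t : tk k <= s -> s <= t -> t <= tk k.+1 -> `|x t| <= E * `|x s|.
  move=> ks; rewrite le_eqVlt => /predU1P[<- _|st tk1]; first by rewrite ler_peMl.
  have sub : `[s, t] `<=` `[tk k, tk k.+1].
    by apply: subset_itv; rewrite bnd_simp.
  have solst : is_solution (oscillating_system p u f (w (tk k))) `[s, t] x.
    by move=> c; exact: is_primitiveS sub (solk k c).
  have gr r y : `|oscillating_system p u f (w (tk k)) r y| <= G * `|y|.
    apply: (le_trans (oscillating_growth (ltW (wk0 k)) hp u1 K0 lf r y)).
    by rewrite ler_wpM2r// ler_wpM2r// lerD2l ler_wpM2l// ler_wsqrtr.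
  have stI : s <= t <= t by rewrite lexx ltW.
  apply: (le_trans (solution_growth st G0 gr solst stI)).
  rewrite ler_wpM2r// ler_expR ler_wpM2l//.
  rewrite lerBlDr; apply: (le_trans tk1); rewrite tkS addrC lerD2l//.
(* A large value at t forces large values on the whole preceding sampling interval,
   two factors E away, and hence a large increment of w there. *)
have decay k t : tk k.+1 <= t <= tk k.+2 ->
    `|x t| ^+ 2 * tf <= E ^+ 4 * (w (tk k.+1) - w (tk k)).
  move=> /andP[kt tk2].
  have xs s : tk k <= s <= tk k.+1 -> E ^- 4 * `|x t| ^+ 2 <= enorm (x s) ^+ 2.
    move=> /andP[ks sk].
    have h1 := grow k.+1 _ _ (lexx _) kt tk2.
    have h2 := grow k _ _ ks sk (lexx _).
    have h3 : `|x t| <= E ^+ 2 * `|x s|.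
      by apply: (le_trans h1); rewrite expr2 -mulrA ler_wpM2l.
    have E40 : 0 < E ^+ 4 by rewrite exprn_gt0// (lt_le_trans _ E1).
    rewrite mulrC ler_pdivrMr//.
    have -> : enorm (x s) ^+ 2 * E ^+ 4 = (E ^+ 2 * enorm (x s)) ^+ 2 by ring.
    rewrite ler_pXn2r ?nnegrE ?mulr_ge0 ?exprn_ge0//.
    by apply: (le_trans h3); rewrite ler_wpM2l ?exprn_ge0// norm_le_enorm.
  have := is_primitive_ge (ltW (tk_lt k)) (wk k) xs.
  have -> : tk k.+1 - tk k = tf by rewrite tkS addrC addKr.
  have E40 : 0 < E ^+ 4 by rewrite exprn_gt0// (lt_le_trans _ E1).
  by rewrite -mulrA mulrC ler_pdivrMr// [leRHS]mulrC.
apply/cvgrPdist_le => eps eps0.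
pose c := n%:R * (E ^+ 4 / tf).
have c0 : 0 <= c by rewrite mulr_ge0// divr_ge0 ?exprn_ge0 ?(ltW htf).
have d0 : 0 < eps ^+ 2 / (c + 1) by rewrite divr_gt0 ?exprn_gt0// ltr_wpDl.
have [k wkd] := approach _ d0.
near=> t.
have kt : tk k.+1 <= t by near: t; apply: nbhs_pinfty_ge; exact: num_real.
have tt0 : t0 <= t.
  by apply: le_trans kt; rewrite /tk lerDl mulr_ge0 ?(ltW htf).
have [m0 /andP[mt tm]] := locate t tt0.
have : (k < m0)%N.
  have := le_lt_trans kt tm; rewrite /tk ltrD2l ltr_pM2r// ltr_nat ltnS.
  by [].
case: m0 mt tm => // m mt tm; rewrite ltnS => km.
have tI : tk m.+1 <= t <= tk m.+2 by rewrite mt ltW.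
have h1 := decay m t tI.
have h2 : w (tk m.+1) - w (tk m) <= eps ^+ 2 / (c + 1).
  by have := wk_mono _ _ km; have := wk_winf m.+1; lra.
rewrite sub0r normrN ger0_norm// -[leRHS]ger0_norm ?(ltW eps0)// -sqrtr_sqr.
rewrite -[leLHS]ger0_norm// -sqrtr_sqr ler_wsqrtr//.
have h3 : enorm (x t) ^+ 2 <= n%:R * `|x t| ^+ 2.
  have -> : n%:R * `|x t| ^+ 2 = (Num.sqrt n%:R * `|x t|) ^+ 2.
    by rewrite exprMn sqr_sqrtr.
  by rewrite ler_pXn2r ?nnegrE ?mulr_ge0 ?sqrtr_ge0// enorm_le_norm.
apply: (le_trans h3).
have h4 : `|x t| ^+ 2 <= E ^+ 4 / tf * (eps ^+ 2 / (c + 1)).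
  rewrite mulrAC ler_pdivlMr//; apply: (le_trans h1).
  by rewrite ler_wpM2l ?exprn_ge0.
apply: (le_trans (ler_wpM2l (ler0n _ _) h4)).
rewrite mulrA -/c mulrCA ler_piMr ?sqr_ge0//.
by rewrite ler_pdivrMr ?ltr_wpDl// mul1r lerDl.
Unshelve. all: by end_near. Qed.
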